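(* The ring of weak Jacobi forms of weight zero (of arbitrary integer index $k\geq 0$ and without character), graded by the index, is freely generated as a commutative algebra over $\mathbf C$ by three elements of degrees $1$, $2$ and $3$ respectively.
   Context: A weak Jacobi form of weight $0$ and index $k\in\mathbf Z_{\ge0}$ is a holomorphic function $\phi(z,\tau)$ on $\mathbf C\times H$ ($H$ the upper half plane) such that $\phi\big(\frac{z}{c\tau+e},\frac{a\tau+b}{c\tau+e}\big)=e^{2\pi i k\,c z^2/(c\tau+e)}\phi(z,\tau)$ for all $\begin{pmatrix}a&b\\c&e\end{pmatrix}\in SL_2(\mathbf Z)$; $\phi(z+\lambda\tau+\mu,\tau)=e^{-2\pi i k(\lambda^2\tau+2\lambda z)}\phi(z,\tau)$ for all $\lambda,\mu\in\mathbf Z$; and $\phi$ has a Fourier expansion in $q=e^{2\pi i\tau}$, $y=e^{2\pi iz}$ with only nonnegative powers of $q$. The ring is the direct sum over $k\ge0$ of these spaces, with multiplication of functions; the index is the degree. *)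

(* Defs.v *)
From HB Require Import structures.
From mathcomp Require Import all_boot all_order all_algebra.
From mathcomp Require Import complex.
From mathcomp Require Import all_classical all_reals all_analysis.
From mathcomp Require Import ring.
From mathcomp.analysis.showcase Require Import summability.
(* Not imported: the notations of mpoly clash with those of analysis. *)
From mathcomp.multinomials Require mpoly.

Set Implicit Arguments.
Unset Strict Implicit.
Unset Printing Implicit Defensive.

Import Order.TTheory GRing.Theory Num.Theory.
Import numFieldNormedType.Exports.

Local Open Scope classical_set_scope.
Local Open Scope ring_scope.
Local Open Scope complex_scope.

Section UpperHalfPlane.
Variable R : realType.

Definition in_upper (tau : R[i]) : bool := 0 < complex.Im tau.

Definition upper : Type := {tau : R[i] | in_upper tau}.

HB.instance Definition _ := SubChoice.copy upper {tau : R[i] | in_upper tau}.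

Lemma in_upper_i : in_upper 'i%C.
Proof. exact: ltr01. Qed.

HB.instance Definition _ := isPointed.Build upper (exist _ 'i%C in_upper_i).

Definition moebius (a b c e : int) (tau : R[i]) : R[i] :=
  (a%:~R * tau + b%:~R) / (c%:~R * tau + e%:~R).

Lemma in_upper_moebius (a b c e : int) (tau : upper) :
  a * e - b * c = 1 -> in_upper (moebius a b c e (val tau)).
Proof.
case: tau => -[x y]; rewrite /in_upper /= => y_gt0 det1.
have intE (n : int) : n%:~R = (n%:~R : R)%:C by rewrite rmorph_int.
have detR : a%:~R * e%:~R - b%:~R * c%:~R = 1 :> R.
  by rewrite -!intrM -intrB det1.
rewrite /moebius !intE /=; simpc => /=.
set D := (_ ^+ 2 + _ ^+ 2).
have D_gt0 : 0 < D.
  rewrite lt_neqAle addr_ge0 ?sqr_ge0 // andbT eq_sym.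
  apply/eqP => /eqP; rewrite paddr_eq0 ?sqr_ge0 // !sqrf_eq0.
  case/andP => ce0; rewrite mulf_eq0 (gt_eqF y_gt0) orbF => /eqP c0.
  move: ce0; rewrite c0 mul0r add0r => /eqP e0.
  by move: detR; rewrite c0 e0 !mulr0 subr0 => /eqP; rewrite eq_sym oner_eq0.
rewrite (_ : _ + _ = y * (a%:~R * e%:~R - b%:~R * c%:~R) / D); last by ring.
by rewrite detR mulr1 divr_gt0.
Qed.

Definition SL2_act (a b c e : int) (det1 : a * e - b * c = 1) (tau : upper) :
  upper := Sub _ (in_upper_moebius tau det1).

(* The library has no complex exponential. *)
Definition expC (z : R[i]) : R[i] :=
  (expR (complex.Re z))%:C * (cos (complex.Im z) +i* sin (complex.Im z)).

Definition e2pi (x : R[i]) : R[i] := expC (2 * pi%:C * 'i%C * x).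

End UpperHalfPlane.

(* [R[i]] carries its topology and its norm (the modulus) through [R[i]^o]. *)
Notation jacobi_fun R := ((R[i]^o * upper R)%type -> R[i]^o).

Section WeakJacobiForms.
Variable R : realType.
Local Notation C := (R[i]^o).

(* As C x H is open in C x C, the value chosen outside C x H is irrelevant to
   differentiability at the points of C x H. *)
Definition extend0 (f : jacobi_fun R) (p : C * C) : C :=
  if insub p.2 is Some tau then f (p.1, tau) else 0.

(* [differentiable] over the field R[i]: the differential is C-linear. *)
Definition holomorphic (f : jacobi_fun R) : Prop :=
  forall (z : C) (tau : upper R), differentiable (extend0 f) (z, val tau : C).

Definition modular_law (k : nat) (f : jacobi_fun R) : Prop :=
  forall (a b c e : int) (det1 : a * e - b * c = 1) (z : C) (tau : upper R),
    f (z / (c%:~R * val tau + e%:~R), SL2_act det1 tau) =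
    e2pi (k%:R * c%:~R * z ^+ 2 / (c%:~R * val tau + e%:~R)) * f (z, tau).

Definition elliptic_law (k : nat) (f : jacobi_fun R) : Prop :=
  forall (l m : int) (z : C) (tau : upper R),
    f (z + l%:~R * val tau + m%:~R, tau) =
    e2pi (- (k%:R * (l%:~R ^+ 2 * val tau + 2 * l%:~R * z))) * f (z, tau).

(* f(z, tau) = sum of a(n, r) q^n y^r over n >= 0 and r in Z, as an
   unconditionally (equivalently, absolutely) convergent family. *)
Definition fourier_nonneg (f : jacobi_fun R) : Prop :=
  exists a : nat * int -> C, forall (z : C) (tau : upper R),
    partial_sum (fun nr : nat * int =>
        a nr * (e2pi (val tau) ^+ nr.1 * e2pi z ^ nr.2) : C) @ totally
      --> f (z, tau).

Definition weak_jacobi_form (k : nat) : set (jacobi_fun R) :=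
  [set f | [/\ holomorphic f, modular_law k f, elliptic_law k f &
              fourier_nonneg f]].

(* The graded direct sum, inside the polynomials over the ring of all functions
   on C x H: the coefficient of 'X^k is the component of degree k, so that the
   product of polynomials is the graded product of functions. *)
Definition weak_jacobi_ring : set {poly (jacobi_fun R)} :=
  [set p | forall k : nat, weak_jacobi_form k p`_k].

Definition weak_jacobi_homogeneous (k : nat) : set {poly (jacobi_fun R)} :=
  [set f *: 'X^k | f in weak_jacobi_form k].

Definition cst_poly (c : R[i]) : {poly (jacobi_fun R)} := (cst c : jacobi_fun R)%:P.

(* Evaluation at x is a bijection from R[i][X_0, ..., X_(n-1)] onto A. *)
Definition freely_generated n (x : 'I_n -> {poly (jacobi_fun R)})
    (A : set {poly (jacobi_fun R)}) : Prop :=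
  set_bij [set: mpoly.mpoly n R[i]] A (mpoly.mmap cst_poly x).

End WeakJacobiForms.

(* Main.v *)
Require Import Defs.
From HB Require Import structures.
From mathcomp Require Import all_boot all_order all_algebra.
From mathcomp Require Import complex finmap.
From mathcomp Require Import all_classical all_reals all_analysis.
From mathcomp Require Import ring lra zify.
From mathcomp.analysis.showcase Require Import summability.
From mathcomp.multinomials Require mpoly.
Set Implicit Arguments.
Unset Strict Implicit.
Unset Printing Implicit Defensive.
Import Order.TTheory GRing.Theory Num.Theory.
Import numFieldNormedType.Exports.
Import (canonicals, coercions) mpoly.
Local Open Scope classical_set_scope.
Local Open Scope ring_scope.
Local Open Scope complex_scope.

(** Write q = e(tau), y = e(z), where e(w) = exp(2 pi i w).

    The forms. Infinite products (Phi) give an even function A of index 1 with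
    a double zero at z = 0; divided by the fourth power of the product of the
    1 - q^n it has weight -2 (AN_modular).  Its translates by the three half
    periods, normalised to the value 1 at z = 0, are permuted by SL2(Z)
    (XT_modular).  So a symmetric homogeneous polynomial of degree k in the
    three translates is a weak Jacobi form of weight 0 and index k
    (Gq_jacobi).  The three generators are the sum B of the translates, the
    sum C2 of the squares of their differences, and the product C3 of the
    three numbers 2 x_i - x_j - x_k.  The translates differ by multiples of A
    that do not depend on z (x10_sub); hence C2 = E4 A^2 and C3 = E6 A^3, where
    E4 and E6 are modular forms of weights 4 and 6, and the product of the
    squared differences is Delta A^6 with Delta of weight 12 and
    E4^3 / 2 = E6^2 + 27 Delta.

    Generation. At a fixed q, an even function of index k is determined by its
    Laurent coefficients of index 0, ..., k (index_coefs0), and the k + 1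
    products A^j B^(k-j) form a basis of such functions, because A tends to 0
    and B to 3 as y tends to 1 (span_repr).  So a weak Jacobi form of index k
    is the sum of the h_j A^j B^(k-j), where h_j is holomorphic in q on the
    whole disc and, by uniqueness, modular of weight 2j (gen_form).  As Delta
    has a simple zero at the cusp and no other one (Delta_shift), the usual
    argument shows that h_j is a polynomial in E4, E6 and Delta (mf_ind), so
    that h_j A^j is a polynomial in C2 and C3.  The analytic input is that a
    form of weight 0 vanishing at the cusp is zero (mf0_cusp), which follows
    from the maximum principle.

    Independence. In a relation between B, C2 and C3, homogeneous of degree k,
    the coefficient of A^j B^(k-j) is a relation between E4 and E6 homogeneous
    of weight 2j.  It would make E6^2 / E4^3 algebraic over the constants,
    whereas this function tends to 1/2 at the cusp without taking that value
    off the cusp, because Delta has no zero there (isobaric).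

    Analysis. All functions are sums of unconditionally convergent families
    of monomials.  A power series can be divided by z - z0, which gives
    the order of a zero and the maximum principle for quotients
    (max_principle).  It is used twice: for forms of weight 0, and to show that
    two entire functions with the same quasi-periodicity and the same zeros
    are proportional (quasi_periodic_prop), from which the modular law of A
    follows. *)

(** * The modulus as a real number *)

Section Modulus.
Variable R : realType.
Local Notation C := R[i].
Implicit Types z w : C.

Definition nrm z : R := complex.Re `|z|.

Lemma normE z : `|z| = (nrm z)%:C.
Proof. by rewrite /nrm normc_def. Qed.

Lemma nrm_sqrt z : nrm z = Num.sqrt (complex.Re z ^+ 2 + complex.Im z ^+ 2).
Proof. by rewrite /nrm normc_def. Qed.

Lemma nrm0 : nrm 0 = 0. Proof. by rewrite /nrm normr0. Qed.
Lemma nrm1 : nrm 1 = 1. Proof. by rewrite /nrm normr1. Qed.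
Lemma nrm_ge0 z : 0 <= nrm z. Proof. by have := normr_ge0 z; rewrite normE ler0c. Qed.
Lemma nrmM z w : nrm (z * w) = nrm z * nrm w.
Proof. by apply: complexI; have := normrM z w; rewrite !normE -rmorphM. Qed.
Lemma nrmN z : nrm (- z) = nrm z. Proof. by rewrite /nrm normrN. Qed.
Lemma nrmV z : nrm z^-1 = (nrm z)^-1.
Proof. by apply: complexI; have := normfV z; rewrite !normE -fmorphV. Qed.
Lemma nrmX z n : nrm (z ^+ n) = nrm z ^+ n.
Proof. by apply: complexI; have := normrX n z; rewrite !normE -rmorphXn. Qed.
Lemma nrmXz z (n : int) : nrm (z ^ n) = nrm z ^ n.
Proof. by case: n => n; rewrite ?NegzE -?exprnN ?nrmV nrmX. Qed.
Lemma nrmD z w : nrm (z + w) <= nrm z + nrm w.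
Proof. by have := ler_normD z w; rewrite !normE -rmorphD lecR. Qed.
Lemma nrmBC z w : nrm (z - w) = nrm (w - z).
Proof. by rewrite -nrmN opprB. Qed.
Lemma nrmB z w : nrm (z - w) <= nrm z + nrm w.
Proof. by rewrite -(nrmN w) nrmD. Qed.
Lemma nrm_eq0 z : (nrm z == 0) = (z == 0).
Proof. by rewrite -[RHS]normr_eq0 normE -(inj_eq (@complexI R)). Qed.
Lemma nrm_gt0 z : (0 < nrm z) = (z != 0).
Proof. by rewrite lt0r nrm_eq0 nrm_ge0 andbT. Qed.
Lemma nrm_real (x : R) : nrm x%:C = `|x|.
Proof. by rewrite nrm_sqrt /= expr0n addr0 sqrtr_sqr. Qed.
Lemma nrm_nat n : nrm n%:R = n%:R.
Proof. by rewrite -(rmorph_nat (real_complex R)) nrm_real normr_nat. Qed.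
Lemma nrm_Re z : `|complex.Re z| <= nrm z.
Proof. by rewrite nrm_sqrt -sqrtr_sqr ler_wsqrtr // lerDl sqr_ge0. Qed.
Lemma nrm_Im z : `|complex.Im z| <= nrm z.
Proof. by rewrite nrm_sqrt -sqrtr_sqr ler_wsqrtr // lerDr sqr_ge0. Qed.
Lemma nrm_le_ReIm z : nrm z <= `|complex.Re z| + `|complex.Im z|.
Proof.
rewrite {1}[z]complexE; apply: le_trans (nrmD _ _) _.
by rewrite nrmM !nrm_real [nrm 'i]nrm_sqrt /= expr0n add0r expr1n sqrtr1 mul1r.
Qed.
Lemma nrm_sum (I : Type) (s : seq I) (P : pred I) (F : I -> C) :
  nrm (\sum_(i <- s | P i) F i) <= \sum_(i <- s | P i) nrm (F i).
Proof.
elim/big_ind2 : _ => [|x1 x2 y1 y2 h1 h2|//]; first by rewrite nrm0.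
by apply: le_trans (nrmD _ _) _; rewrite lerD.
Qed.
Lemma nrm_le0 z : nrm z <= 0 -> z = 0.
Proof. by move=> h; apply/eqP; rewrite -nrm_eq0 eq_le h nrm_ge0. Qed.
Lemma nrm_small z : (forall e : R, 0 < e -> nrm z <= e) -> z = 0.
Proof.
move=> h; apply: nrm_le0; apply/ler_addgt0Pr => e e0; rewrite add0r.
exact: h.
Qed.

End Modulus.

(** * Unconditional sums *)

(** Convergence of the net of partial sums over finite sets. With the real-valued
    modulus and a non-strict bound, estimates on the sums pass to the limit
    directly; hsum_cvgP links it to the filter of finite sets. *)
Definition hsum (R : realType) (T : choiceType) (a : T -> R[i]) (l : R[i]) : Prop :=
  forall e : R, 0 < e ->
  exists A : {fset T}, forall B : {fset T}, (A `<=` B)%fset ->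
    nrm (l - \sum_(i <- B) a i)%R <= e.

(** Locked, as is the product Phi below, so that unification does not unfold the
    choice operator. *)
HB.lock Definition tsum (R : realType) (T : choiceType) (a : T -> R[i]) : R[i] :=
  xget 0%R [set l | hsum a l].
Canonical locked_tsum := Unlockable tsum.unlock.

Section UnconditionalSums.
Variable R : realType.
Local Notation C := R[i].

(** Bounding all the finite sums of moduli expresses absolute convergence without
    any enumeration of the index type. *)
Definition absum (T : choiceType) (a : T -> C) (M : R) : Prop :=
  forall A : {fset T}, \sum_(i <- A) nrm (a i) <= M.

Definition summ (T : choiceType) (a : T -> C) : Prop := exists M, absum a M.

Variable T : choiceType.
Implicit Types (a b : T -> C) (A B : {fset T}) (u : T -> R).

Lemma sum_fsetD (V : nmodType) (f : T -> V) A B : (A `<=` B)%fset ->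
  (\sum_(i <- B) f i = \sum_(i <- A) f i + \sum_(i <- (B `\` A)%fset) f i)%R.
Proof.
move=> AB; rewrite (big_fsetID _ (fun i => i \in A)) /=; congr (_ + _)%R.
  apply: perm_big; apply: uniq_perm; rewrite ?fset_uniq // => i.
  rewrite !inE /=; case iA: (i \in A); rewrite ?andbF ?andbT //.
  exact: (fsubsetP AB).
apply: perm_big; apply: uniq_perm; rewrite ?fset_uniq // => i.
by rewrite !inE /= andbC.
Qed.

Lemma sum_fset_mono u A B : (forall i, 0 <= u i) -> (A `<=` B)%fset ->
  \sum_(i <- A) u i <= \sum_(i <- B) u i.
Proof. by move=> u0 AB; rewrite (sum_fsetD _ AB) lerDl sumr_ge0. Qed.

Lemma hsum_cvgP a l : hsum a l <-> (partial_sum a @ totally --> (l : C^o)).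
Proof.
have psE B : partial_sum a B = \sum_(i <- B) a i.
  by rewrite /partial_sum big_seq_fsetE.
have FF : ProperFilter (@totally T) by apply: totally_filter.
split=> h.
  apply/(@cvgrPdist_le R[i] (R[i]^o)) => /= e; rewrite ltcE /= => /andP[/eqP Ime e0].
  have [A hA] := h _ e0; exists A => //= B AB.
  rewrite psE -[X in X <= _]/(`|l - \sum_(i <- B) a i|%R) normE.
  by rewrite lecE /= Ime eqxx hA.
move=> e e0; move/(@cvgrPdist_le R[i] (R[i]^o)): h => /(_ e%:C); rewrite ltcR => /(_ e0).
case=> A _ hA; exists A => B AB; have := hA B AB.
by rewrite /= psE -[X in X <= _]/(`|l - \sum_(i <- B) a i|%R) normE lecR.
Qed.

Lemma hsum_uniq a l l' : hsum a l -> hsum a l' -> l = l'.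
Proof.
move=> h h'; apply/eqP; rewrite -subr_eq0; apply/eqP; apply: nrm_small => e e0.
have e2 : 0 < e / 2 by rewrite divr_gt0.
have [A hA] := h _ e2; have [A' hA'] := h' _ e2.
have := hA (A `|` A')%fset (fsubsetUl _ _); have := hA' (A `|` A')%fset (fsubsetUr _ _).
set s := (\sum_(i <- _) _)%R => k' k.
have -> : (l - l' = (l - s) - (l' - s))%R by ring.
by apply: le_trans (nrmB _ _) _; rewrite [leRHS]splitr lerD.
Qed.

Lemma eq_hsum a b l : (forall i, b i = a i) -> hsum a l -> hsum b l.
Proof. by move=> /funext ->. Qed.

Lemma hsumD a b l m : hsum a l -> hsum b m ->
  hsum (fun i => a i + b i)%R (l + m)%R.
Proof.
move=> h h' e e0; have e2 : 0 < e / 2 by rewrite divr_gt0.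
have [A hA] := h _ e2; have [A' hA'] := h' _ e2.
exists (A `|` A')%fset => B; rewrite fsubUset => /andP[AB AB'].
rewrite big_split /= opprD addrACA (splitr e).
by apply: le_trans (nrmD _ _) _; rewrite lerD ?hA ?hA'.
Qed.

Lemma hsumZ a l c : hsum a l -> hsum (fun i => c * a i)%R (c * l)%R.
Proof.
move=> h e e0; have d0 : 0 < nrm c + 1 by rewrite ltr_wpDl ?nrm_ge0.
have [A hA] := h _ (divr_gt0 e0 d0); exists A => B AB.
rewrite -mulr_sumr -mulrBr nrmM.
apply: le_trans (ler_wpM2l (nrm_ge0 _) (hA _ AB)) _.
rewrite mulrA ler_pdivrMr // mulrC ler_wpM2l ?(ltW e0) // lerDl //.
Qed.

Lemma hsumN a l : hsum a l -> hsum (fun i => - a i)%R (- l)%R.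
Proof.
move=> /(hsumZ (-1)%R); rewrite mulN1r; congr hsum.
by apply/funext => i; rewrite mulN1r.
Qed.

Lemma hsumB a b l m : hsum a l -> hsum b m ->
  hsum (fun i => a i - b i)%R (l - m)%R.
Proof. by move=> ha hb; apply: hsumD => //; apply: hsumN. Qed.

Lemma hsum_sum (I : Type) (s : seq I) (P : pred I) (a : I -> T -> C) (l : I -> C) :
  (forall i, P i -> hsum (a i) (l i)) ->
  hsum (fun t => \sum_(i <- s | P i) a i t)%R (\sum_(i <- s | P i) l i)%R.
Proof.
move=> h; elim: s => [|i s IH].
  rewrite big_nil => e e0; exists fset0 => B _.
  by under eq_bigr do rewrite big_nil; rewrite big1 // subr0 nrm0 ltW.
rewrite big_cons; case: ifPn => Pi; last first.
  by under eq_fun do rewrite big_cons (negbTE Pi).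
by under eq_fun do rewrite big_cons Pi; apply: hsumD => //; apply: h.
Qed.

Lemma hsum_le a l M : absum a M -> hsum a l -> nrm l <= M.
Proof.
move=> aM h; apply/ler_addgt0Pr => e e0; have [A hA] := h _ e0.
have -> : (l = \sum_(i <- A) a i + (l - \sum_(i <- A) a i))%R by ring.
apply: le_trans (nrmD _ _) _; rewrite lerD ?hA ?fsubset_refl //.
by apply: le_trans (nrm_sum _ _ _) _; apply: aM.
Qed.

(** Completeness of the real numbers enters here: the sum is the supremum of the
    finite sums. *)
Lemma hsum_nonneg u M : (forall i, 0 <= u i) ->
  (forall A, \sum_(i <- A) u i <= M) -> exists l, hsum (fun i => (u i)%:C) l.
Proof.
move=> u0 uM; pose S := [set x | exists A, x = \sum_(i <- A) u i].
have supS : has_sup S.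
  split; first by exists (\sum_(i <- fset0) u i); exists fset0.
  by exists M => _ [A ->]; apply: uM.
exists (sup S)%:C => e e0.
have [_ [A ->] hA] := sup_adherent e0 supS.
exists A => B AB; rewrite -rmorph_sum -rmorphB /= nrm_real ger0_norm; last first.
  by rewrite subr_ge0; apply: (ub_le_sup supS.2); exists B.
rewrite lerBlDr -lerBlDl; apply: le_trans (ltW hA) _.
exact: sum_fset_mono.
Qed.

Lemma absum_ge0 a M : absum a M -> 0 <= M.
Proof. by move=> /(_ fset0); rewrite big_seq_fset0. Qed.

Lemma absum_dom a b M : (forall i, nrm (b i) <= nrm (a i)) -> absum a M ->
  absum b M.
Proof. by move=> h aM A; apply: le_trans (aM A); apply: ler_sum => i _. Qed.

Lemma summ_dom a b : (forall i, nrm (b i) <= nrm (a i)) -> summ a -> summ b.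
Proof. by move=> h [M aM]; exists M; apply: absum_dom aM. Qed.

Lemma summZ a c : summ a -> summ (fun i => c * a i)%R.
Proof.
case=> M aM; exists (nrm c * M) => A; under eq_bigr do rewrite nrmM.
by rewrite -mulr_sumr ler_wpM2l ?nrm_ge0.
Qed.

Lemma summD a b : summ a -> summ b -> summ (fun i => a i + b i)%R.
Proof.
case=> M aM [N bN]; exists (M + N) => A.
apply: (@le_trans _ _ (\sum_(i <- A) (nrm (a i) + nrm (b i)))).
  by apply: ler_sum => i _; apply: nrmD.
by rewrite big_split lerD.
Qed.

Lemma summ_hsum a : summ a -> exists l, hsum a l.
Proof.
case=> M aM.
have pos (f : C -> R) : (forall z, `|f z| <= nrm z) ->
    exists l, hsum (fun i => (f (a i))%:C) l.
  move=> fz.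
  have [l1 h1] : exists l, hsum (fun i => (f (a i) + nrm (a i))%:C) l.
    apply: (@hsum_nonneg _ (M + M)).
      by move=> i; have := fz (a i); rewrite ler_norml => /andP[]; lra.
    move=> A; rewrite big_split lerD //; apply: le_trans (aM A).
    by apply: ler_sum => i _; apply: le_trans (ler_norm _) (fz _).
  have [l2 h2] : exists l, hsum (fun i => (nrm (a i))%:C) l.
    by apply: (@hsum_nonneg _ M) => // i; apply: nrm_ge0.
  exists (l1 - l2)%R; have := hsumB h1 h2; congr hsum.
  by apply/funext => i; rewrite rmorphD /= addrK.
have [lr hr] := pos _ (@nrm_Re R); have [li hi] := pos _ (@nrm_Im R).
exists (lr + 'i * li)%R; have := hsumD hr (hsumZ 'i%C hi); congr hsum.
by apply/funext => i; rewrite -complexE.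
Qed.

(** A convergent net has all its partial sums over sets disjoint from some finite
    set bounded, and splitting such a sum by the signs of the real and imaginary
    parts bounds the sum of the moduli. *)
Lemma hsum_summ a l : hsum a l -> summ a.
Proof.
move=> h; have [A hA] := h 1 ltr01.
have dis B : [disjoint A & B]%fset -> nrm (\sum_(i <- B) a i)%R <= 2.
  move=> AB; have := hA A (fsubset_refl _).
  have := hA (A `|` B)%fset (fsubsetUl _ _).
  rewrite (sum_fsetD _ (fsubsetUl A B)) fsetDUl fsetDv fset0U.
  have -> : (B `\` A = B)%fset by apply/fsetDidPl; rewrite fdisjoint_sym.
  set s := (\sum_(i <- B) _)%R; set t := (\sum_(i <- A) _)%R => h1 h2.
  have -> : (s = (l - t) - (l - (t + s)))%R by ring.
  by apply: le_trans (nrmB _ _) _; lra.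
have half (f : {additive C -> R}) B : (forall z, `|f z| <= nrm z) ->
    [disjoint A & B]%fset -> \sum_(i <- B) `|f (a i)| <= 4.
  move=> fz AB; rewrite (big_fsetID _ (fun i => 0 <= f (a i))) /=.
  have sub (p : pred T) : [disjoint A & [fset x in B | p x]]%fset.
    by apply: fdisjointWr AB; apply: fset_sub.
  have -> : 4 = 2 + 2 :> R by lra.
  rewrite lerD //.
    apply: le_trans (dis _ (sub (fun i => 0 <= f (a i)))).
    apply: le_trans (fz _); rewrite raddf_sum ger0_norm.
      by rewrite le_eqVlt; apply/orP; left; apply/eqP; apply: eq_big_seq => i;
         rewrite !inE => /andP[_ ?]; rewrite ger0_norm.
    by rewrite big_seq; apply: sumr_ge0 => i; rewrite !inE => /andP[].
  apply: le_trans (dis _ (sub (fun i => ~~ (0 <= f (a i))))).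
  apply: le_trans (fz _); rewrite raddf_sum -normrN -sumrN ger0_norm.
    rewrite le_eqVlt; apply/orP; left; apply/eqP; apply: eq_big_seq => i.
    by rewrite !inE -ltNge => /andP[_ /ltW ?]; rewrite ler0_norm.
  rewrite big_seq; apply: sumr_ge0 => i; rewrite !inE -ltNge => /andP[_ /ltW].
  by rewrite oppr_ge0.
exists (\sum_(i <- A) nrm (a i) + 8) => B.
apply: (@le_trans _ _ (\sum_(i <- (A `|` B)%fset) nrm (a i))).
  by apply: sum_fset_mono; [move=> i; apply: nrm_ge0|apply: fsubsetUr].
rewrite (sum_fsetD _ (fsubsetUl A B)) lerD2l.
have AB : [disjoint A & ((A `|` B) `\` A)]%fset by apply/fdisjointP => x xA; rewrite !inE xA.
apply: (@le_trans _ _ (\sum_(i <- ((A `|` B) `\` A)%fset)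
  (`|complex.Re (a i)| + `|complex.Im (a i)|))).
  by apply: ler_sum => i _; apply: nrm_le_ReIm.
rewrite big_split /=.
have := half _ _ (@nrm_Re R) AB; have := half _ _ (@nrm_Im R) AB; lra.
Qed.

Lemma tsumP a : summ a -> hsum a (tsum a).
Proof. by move=> /summ_hsum [l hl]; rewrite unlock; apply: (@xgetPex _ 0%R [set l | hsum a l]); exists l. Qed.

Lemma tsumE a l : hsum a l -> tsum a = l.
Proof. by move=> hl; apply: hsum_uniq (tsumP (hsum_summ hl)) hl. Qed.

Lemma hsum_fin a A : (forall i, i \notin A -> a i = 0%R) ->
  hsum a (\sum_(i <- A) a i)%R.
Proof.
move=> h e e0; exists A => B AB; rewrite (big_fset_incl _ AB) ?subrr ?nrm0 ?ltW //.
by move=> i _; apply: h.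
Qed.

Lemma hsum1 a t : (forall i, i != t -> a i = 0%R) -> hsum a (a t).
Proof.
move=> h; have := @hsum_fin a [fset t]%fset; rewrite big_seq_fset1; apply=> i.
by rewrite !inE; apply: h.
Qed.

Lemma hsum0 : hsum (fun _ : T => 0%R : C) 0%R.
Proof. by have := @hsum_fin (fun=> 0%R : C) fset0; rewrite big_seq_fset0; apply. Qed.

(** The finite sums of moduli have a supremum; a finite set that comes within e
    of it leaves at most e outside. *)
Lemma absum_tail a : summ a -> forall e : R, 0 < e -> exists A, forall B,
  [disjoint A & B]%fset -> \sum_(i <- B) nrm (a i) <= e.
Proof.
case=> M aM e e0; pose S := [set x | exists A, x = \sum_(i <- A) nrm (a i)].
have supS : has_sup S.
  split; first by exists (\sum_(i <- fset0) nrm (a i)); exists fset0.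
  by exists M => _ [A ->]; apply: aM.
have [_ [A ->] hA] := sup_adherent e0 supS.
exists A => B AB; have : \sum_(i <- (A `|` B)%fset) nrm (a i) <= sup S.
  by apply: (ub_le_sup supS.2); exists (A `|` B)%fset.
rewrite (sum_fsetD _ (fsubsetUl A B)) fsetDUl fsetDv fset0U.
have -> : (B `\` A = B)%fset by apply/fsetDidPl; rewrite fdisjoint_sym.
move: hA; lra.
Qed.

Definition restr (p : pred T) a : T -> C := fun i => if p i then a i else 0%R.

Lemma nrm_restr p a i : nrm (restr p a i) <= nrm (a i).
Proof. by rewrite /restr; case: ifP => // _; rewrite nrm0 nrm_ge0. Qed.

Lemma summ_restr p a : summ a -> summ (restr p a).
Proof. by apply: summ_dom => i; apply: nrm_restr. Qed.

Lemma sum_restr_le p a A : \sum_(i <- A) nrm (restr p a i) =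
  \sum_(i <- [fset x in A | p x]%fset) nrm (a i).
Proof.
rewrite (big_fsetID _ p) /= [X in (_ + X)%R]big1_fset ?addr0.
  by apply: eq_big_seq => i; rewrite !inE /restr => /andP[_ ->].
by move=> i; rewrite !inE /restr => /andP[_ /negbTE ->] _; rewrite nrm0.
Qed.

End UnconditionalSums.

(** * Regrouping and products of sums *)

Section PushForward.
Variable R : realType.
Local Notation C := R[i].
Variables (T K : choiceType) (p : T -> K).

Let fib (k : K) : pred T := fun t => p t == k.

Lemma sum_fibres (B : {fset K}) (a : T -> C) t :
  (\sum_(k <- B) restr (fib k) a t = restr (fun t => p t \in B) a t)%R.
Proof.
rewrite /restr /fib; case: ifPn => h.
  rewrite (big_fsetD1 _ h) /= eqxx big1_fset ?addr0 // => k.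
  by rewrite !inE eq_sym => /andP[/negbTE ->].
rewrite big1_fset // => k kB _; case: eqP => // E; by rewrite E kB in h.
Qed.

(** Regrouping: a summable family may be summed fibre by fibre along any map p.
    All the rearrangements below (products, Fubini, collecting monomials by
    degree) are instances. *)
Lemma hsum_push (a : T -> C) l (b : K -> C) : summ a -> hsum a l ->
  (forall k, hsum (restr (fib k) a) (b k)) -> hsum b l.
Proof.
move=> sa ha hb e e0; have [A hA] := absum_tail sa e0.
exists [fset p x | x in A]%fset => B AB.
have h1 : hsum (restr (fun t => p t \in B) a) (\sum_(k <- B) b k)%R.
  have := @hsum_sum R T _ B xpredT (fun k => restr (fib k) a) b (fun k _ => hb k).
  by congr hsum; apply/funext => t; rewrite sum_fibres.
have := hsumB ha h1.
set c := (fun _ => _); move=> hc; apply: hsum_le hc => D.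
have cE : c = restr (fun t => p t \notin B) a.
  by apply/funext => t; rewrite /c /restr; case: (p t \in B); rewrite ?subrr ?subr0.
rewrite cE sum_restr_le; apply: hA; apply/fdisjointP => t tA.
rewrite !inE negb_and negbK; apply/orP; right; apply: (fsubsetP AB).
exact: in_imfset.
Qed.

Lemma absum_push (a : T -> C) (b : K -> C) M : absum a M ->
  (forall k, hsum (restr (fib k) a) (b k)) -> absum b M.
Proof.
move=> aM hb; have sa : summ a by exists M.
pose na t := (nrm (a t))%:C.
have sna : summ na.
  by apply: summ_dom sa => t; rewrite nrm_real ger0_norm ?nrm_ge0.
pose nb k := tsum (restr (fib k) na).
have hnb k : hsum (restr (fib k) na) (nb k) by apply/tsumP/summ_restr.
have naM : absum na M.
  by apply: absum_dom aM => t; rewrite nrm_real ger0_norm ?nrm_ge0.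
have nb_ge k : nrm (b k) <= complex.Re (nb k).
  apply/ler_addgt0Pr => e e0.
  have e2 : 0 < e / 2 by rewrite divr_gt0.
  have [A1 h1] := hb k _ e2; have [A2 h2] := hnb k _ e2.
  have := h1 (A1 `|` A2)%fset (fsubsetUl _ _).
  have := h2 (A1 `|` A2)%fset (fsubsetUr _ _).
  set s1 := (\sum_(i <- _) _)%R; set s2 := (\sum_(i <- _) _)%R => k1 k2.
  have : nrm s2 <= complex.Re s1.
    rewrite /s2 /s1 raddf_sum; apply: le_trans (nrm_sum _ _ _) _.
    apply: ler_sum => t _; rewrite /restr /na; case: ifP => // _.
    by rewrite nrm0.
  have := le_trans (nrm_Re _) k1; rewrite raddfB /= ler_norml => /andP[? ?].
  have : nrm (b k) <= nrm (b k - s2) + nrm s2 by rewrite -{1}(subrK s2 (b k)) nrmD.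
  lra.
move=> B; apply: (@le_trans _ _ (complex.Re (\sum_(k <- B) nb k)%R)).
  by rewrite raddf_sum; apply: ler_sum.
apply: le_trans (ler_norm _) _; apply: le_trans (nrm_Re _) _.
have h1 : hsum (restr (fun t => p t \in B) na) (\sum_(k <- B) nb k)%R.
  have := @hsum_sum R T _ B xpredT (fun k => restr (fib k) na) nb (fun k _ => hnb k).
  by congr hsum; apply/funext => t; rewrite sum_fibres.
by apply: hsum_le h1; apply: absum_dom naM => t; apply: nrm_restr.
Qed.

Lemma summ_push (a : T -> C) (b : K -> C) : summ a ->
  (forall k, hsum (restr (fib k) a) (b k)) -> summ b.
Proof. by case=> M aM hb; exists M; apply: absum_push hb. Qed.

End PushForward.

Section Reindex.
Variable R : realType.
Local Notation C := R[i].

Lemma absum_inj (T K : choiceType) (f : T -> K) (a : K -> C) M : injective f ->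
  absum a M -> absum (a \o f) M.
Proof.
move=> fI aM A; apply: le_trans (aM [fset f x | x in A]%fset).
by rewrite big_imfset //= => x y _ _; apply: fI.
Qed.

Lemma summ_inj (T K : choiceType) (f : T -> K) (a : K -> C) : injective f ->
  summ a -> summ (a \o f).
Proof. by move=> fI [M aM]; exists M; apply: absum_inj. Qed.

(** Terms outside the image of an injection vanish, so both nets have the same
    partial sums. *)
Lemma hsum_inj (T K : choiceType) (f : T -> K) (a : K -> C) l : injective f ->
  (forall k, (forall t, f t != k) -> a k = 0%R) ->
  hsum (a \o f) l <-> hsum a l.
Proof.
move=> fI a0.
have key l' : hsum (a \o f) l' -> hsum a l'.
  move=> h; apply: (hsum_push (p := f) (hsum_summ h) h) => k.
  have [[t ft]|nf] := pselect (exists t, f t = k).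
    have <- : restr (fun x => f x == k) (a \o f) t = a k.
      by rewrite /restr /= ft eqxx.
    by apply: hsum1 => i; rewrite /restr -ft (inj_eq fI) => /negbTE ->.
  rewrite a0 => [|t]; last by apply/eqP => ft; apply: nf; exists t.
  have -> : restr (fun x => f x == k) (a \o f) = (fun=> 0%R).
    apply/funext => t; rewrite /restr; case: eqP => // ft.
    by case: nf; exists t.
  exact: hsum0.
split; first exact: key.
move=> h; have h1 := tsumP (summ_inj fI (hsum_summ h)).
by rewrite (hsum_uniq h (key _ h1)).
Qed.

Lemma absum_prod (T K : choiceType) (a : T -> C) (b : K -> C) M N :
  absum a M -> absum b N -> absum (fun tk : T * K => a tk.1 * b tk.2)%R (M * N).
Proof.
move=> aM bN A.
pose A1 := [fset x.1 | x in A]%fset; pose A2 := [fset x.2 | x in A]%fset.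
apply: (@le_trans _ _ (\sum_(x <- (A1 `*` A2)%fset) nrm (a x.1 * b x.2)%R)).
  apply: sum_fset_mono => [i|]; first exact: nrm_ge0.
  apply/fsubsetP => -[x y] xy; rewrite in_fsetM /=.
  by apply/andP; split; apply/imfsetP; exists (x, y).
under eq_bigr do rewrite nrmM.
rewrite (_ : \sum_(x <- _) _ =
  (\sum_(x <- A1) nrm (a x)) * (\sum_(y <- A2) nrm (b y)))%R.
  by apply: ler_pM => //; apply: sumr_ge0 => ? _; apply: nrm_ge0.
rewrite mulr_suml; under [RHS]eq_bigr do rewrite mulr_sumr.
rewrite -(big_allpairs (F := fun x => nrm (a x.1) * nrm (b x.2))).
apply: perm_big; apply: uniq_perm; first exact: fset_uniq.
  by apply: allpairs_uniq; rewrite ?fset_uniq // => -[? ?] [? ?] _ _ [-> ->].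
move=> [x y]; rewrite in_fsetM /=; apply/andP/allpairsP => [[xA yA]|].
  by exists (x, y).
by case=> -[x' y'] [xA yA [-> ->]].
Qed.

Lemma summ_prod (T K : choiceType) (a : T -> C) (b : K -> C) :
  summ a -> summ b -> summ (fun tk : T * K => a tk.1 * b tk.2)%R.
Proof. by case=> M aM [N bN]; exists (M * N); apply: absum_prod. Qed.

Lemma hsum_prod (T K : choiceType) (a : T -> C) (b : K -> C) l m :
  hsum a l -> hsum b m -> hsum (fun tk : T * K => a tk.1 * b tk.2)%R (l * m)%R.
Proof.
move=> ha hb.
have sp := summ_prod (hsum_summ ha) (hsum_summ hb); have h := tsumP sp.
suff E : tsum (fun tk : T * K => a tk.1 * b tk.2)%R = (l * m)%R by rewrite -E.
have h1 : hsum (fun t => a t * m)%R (tsum (fun tk : T * K => a tk.1 * b tk.2)%R).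
  apply: (hsum_push (p := fst) sp h) => t.
  apply/(@hsum_inj _ _ (fun k => (t, k))); first by move=> ? ? [].
    move=> [t' k'] /(_ k'); rewrite /restr /=; case: (t' =P t) => // -> .
    by rewrite eqxx.
  have := hsumZ (a t) hb; congr hsum; apply/funext => k.
  by rewrite /= /restr /= eqxx.
have h2 := hsumZ m ha; rewrite [RHS]mulrC; apply: hsum_uniq h1 _.
by move: h2; congr hsum; apply/funext => t; rewrite mulrC.
Qed.

(** Fubini, by regrouping along the first projection. *)
Lemma hsum_fst (T K : choiceType) (a : T * K -> C) l (b : T -> C) :
  hsum a l -> (forall t, hsum (fun k => a (t, k)) (b t)) -> hsum b l.
Proof.
move=> h hb; apply: (hsum_push (p := fst) (hsum_summ h) h) => t.
apply/(@hsum_inj _ _ (fun k => (t, k))); first by move=> ? ? [].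
  move=> [t' k'] /(_ k'); rewrite /restr /=; case: (t' =P t) => // -> .
  by rewrite eqxx.
by have := hb t; congr hsum; apply/funext => k; rewrite /= /restr /= eqxx.
Qed.

Lemma summ_pairs (T K : choiceType) (a : T * K -> C) (u : T -> R) :
  (forall t, absum (fun k => a (t, k)) (u t)) ->
  summ (fun t => (u t)%:C) -> summ a.
Proof.
move=> hu [M uM]; exists M => A.
pose A1 := [fset x.1 | x in A]%fset; pose A2 := [fset x.2 | x in A]%fset.
apply: le_trans (uM A1).
apply: (@le_trans _ _ (\sum_(x <- (A1 `*` A2)%fset) nrm (a x))).
  apply: sum_fset_mono => [i|]; first exact: nrm_ge0.
  apply/fsubsetP => -[x y] xy; rewrite in_fsetM /=.
  by apply/andP; split; apply/imfsetP; exists (x, y).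
apply: (@le_trans _ _ (\sum_(t <- A1) \sum_(k <- A2) nrm (a (t, k)))).
  rewrite -(big_allpairs (F := fun x => nrm (a x))) le_eqVlt; apply/orP; left.
  apply/eqP; apply: perm_big; apply: uniq_perm; first exact: fset_uniq.
    by apply: allpairs_uniq; rewrite ?fset_uniq // => -[? ?] [? ?] _ _ [-> ->].
  move=> [x y]; rewrite in_fsetM /=; apply/andP/allpairsP => [[xA yA]|].
    by exists (x, y).
  by case=> -[x' y'] [xA yA [-> ->]].
apply: ler_sum => t _; rewrite nrm_real.
by apply: le_trans (ler_norm _); apply: hu.
Qed.

End Reindex.

(** * Power series on a disc and the maximum principle *)

Section PowerSeries.
Variable R : realType.
Local Notation C := R[i].
Implicit Types (f g : C -> C) (z : C) (r : R).

Lemma realC_neq0 r : 0 < r -> r%:C != 0 :> C.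
Proof. by move=> r0; rewrite -nrm_gt0 nrm_real gtr0_norm. Qed.

Lemma absum_nat (a : nat -> C) M :
  (forall N, \sum_(i < N) nrm (a i) <= M) -> absum a M.
Proof.
move=> h A; pose N := (\sum_(i <- A) i)%N.+1.
apply: le_trans (h N); rewrite -(big_mkord xpredT (fun i => nrm (a i))).
have sub : (A `<=` [fset i in iota 0 N])%fset.
  apply/fsubsetP => i iA; rewrite in_fset mem_iota leq0n add0n ltnS.
  by rewrite (big_fsetD1 _ iA) leq_addr.
apply: le_trans (sum_fset_mono (fun i => nrm_ge0 (a i)) sub) _.
rewrite le_eqVlt; apply/orP; left; apply/eqP; apply: perm_big.
rewrite /index_iota subn0; apply: uniq_perm; rewrite ?fset_uniq ?iota_uniq //.
by move=> i; rewrite in_fset.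
Qed.

Lemma absum_geom (s : C) : nrm s < 1 -> absum (fun n => s ^+ n) (1 - nrm s)^-1.
Proof.
move=> s1; have d0 : 0 < 1 - nrm s by rewrite subr_gt0.
apply: absum_nat => N; under eq_bigr do rewrite nrmX.
rewrite -[leRHS]mul1r ler_pdivlMr // mulrC.
have -> : (1 - nrm s) * (\sum_(i < N) nrm s ^+ i) = 1 - nrm s ^+ N.
  by rewrite -opprB mulNr -subrX1 opprB.
by rewrite lerBlDr lerDl exprn_ge0 ?nrm_ge0.
Qed.

Lemma hsum_shift (u : nat -> C) l : hsum u l -> hsum (fun n => u n.+1) (l - u 0%N).
Proof.
move=> hu; pose v n : C := if n is 0 then u 0%N else 0.
have hv : hsum v (u 0%N) by apply: (@hsum1 R _ v 0%N) => -[].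
have -> : (fun n => u n.+1) = (fun n => u n - v n) \o S.
  by apply/funext => n /=; rewrite subr0.
apply/(@hsum_inj R _ _ S (fun n => u n - v n)); first by move=> ? ? [].
  by move=> [|n] hn; rewrite ?subrr //; have := hn n; rewrite eqxx.
exact: hsumB hu hv.
Qed.

(** Sums on the closed disc of radius r of a power series that converges
    absolutely at r. A value f z outside the disc is unconstrained. *)
Definition psd r f : Prop := exists a : nat -> C,
  summ (fun n => a n * (r%:C) ^+ n) /\
  forall z, nrm z <= r -> hsum (fun n => a n * z ^+ n) (f z).

Lemma nrm_mono r z (N : nat) (c : C) : 0 < r -> nrm z <= r ->
  nrm (c * z ^+ N) <= nrm (c * (r%:C) ^+ N).
Proof.
move=> r0 zr; rewrite !nrmM !nrmX nrm_real (ger0_norm (ltW r0)).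
by rewrite ler_wpM2l ?nrm_ge0 // lerXn2r // nnegrE ?nrm_ge0 ?ltW.
Qed.

(** Regrouping along the degree. *)
Lemma ps_push (I : choiceType) (c : I -> C) (N : I -> nat) r f : 0 < r ->
  summ (fun i => c i * (r%:C) ^+ N i) ->
  (forall z, nrm z <= r -> hsum (fun i => c i * z ^+ N i) (f z)) -> psd r f.
Proof.
move=> r0 sc hf.
have sf n : summ (restr (fun i => N i == n) c).
  apply: summ_dom (summZ ((r%:C) ^- n) (summ_restr (fun i => N i == n) sc)) => i.
  rewrite /restr; case: eqP => [<-|_]; last by rewrite mulr0.
  by rewrite mulrCA mulVf ?mulr1 // expf_neq0 // realC_neq0.
pose a n := tsum (restr (fun i => N i == n) c).
have fibre z n : hsum (restr (fun i => N i == n) (fun i => c i * z ^+ N i))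
    (a n * z ^+ n).
  rewrite mulrC; have := hsumZ (z ^+ n) (tsumP (sf n)); congr hsum.
  apply/funext => i; rewrite /restr; case: eqP => [<-|_]; rewrite ?mulr0 //.
  by rewrite mulrC.
exists a; split.
  exact: (summ_push (p := N) sc (fibre _)).
move=> z zr; apply: (hsum_push (p := N) _ (hf z zr)) => //.
by apply: summ_dom sc => i; apply: nrm_mono.
Qed.

Lemma psd_eq r f g : (forall z, nrm z <= r -> f z = g z) -> psd r f -> psd r g.
Proof.
by move=> fg [a [sa ha]]; exists a; split=> // z zr; rewrite -fg //; apply: ha.
Qed.

Lemma psdD r f g : psd r f -> psd r g -> psd r (fun z => f z + g z).
Proof.
move=> [a [sa ha]] [b [sb hb]]; exists (fun n => a n + b n); split.
  by have := summD sa sb; congr summ; apply/funext => n; rewrite mulrDl.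
move=> z zr; have := hsumD (ha z zr) (hb z zr); congr hsum.
by apply/funext => n; rewrite mulrDl.
Qed.

Lemma psdM r f g : 0 < r -> psd r f -> psd r g -> psd r (fun z => f z * g z).
Proof.
move=> r0 [a [sa ha]] [b [sb hb]].
apply: (@ps_push _ (fun x : nat * nat => a x.1 * b x.2) (fun x => x.1 + x.2)%N)
  => //.
  have := summ_prod sa sb; congr summ; apply/funext => x.
  by rewrite exprD mulrACA.
move=> z zr; have := hsum_prod (ha z zr) (hb z zr); congr hsum.
by apply/funext => x; rewrite exprD mulrACA.
Qed.

Lemma psd_mono r c N : psd r (fun z => c * z ^+ N).
Proof.
pose a n := if n == N then c else 0.
have h z : hsum (fun n => a n * z ^+ n) (c * z ^+ N).
  have aN : a N = c by rewrite /a eqxx.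
  have := @hsum1 R nat (fun n => a n * z ^+ n) N; rewrite aN; apply.
  by move=> n /negbTE nN; rewrite /a nN mul0r.
by exists a; split=> [|z _]; [apply: hsum_summ (h _)|apply: h].
Qed.

Lemma psd_cst r c : psd r (fun=> c).
Proof. by apply: psd_eq (psd_mono r c 0) => z _; rewrite mulr1. Qed.

Lemma psdZ r c f : 0 < r -> psd r f -> psd r (fun z => c * f z).
Proof. by move=> r0 hf; apply: psdM => //; apply: psd_cst. Qed.

Lemma psdN r f : 0 < r -> psd r f -> psd r (fun z => - f z).
Proof.
by move=> r0 /(psdZ (-1) r0); apply: psd_eq => z _; rewrite mulN1r.
Qed.

Lemma psdB r f g : 0 < r -> psd r f -> psd r g -> psd r (fun z => f z - g z).
Proof. by move=> r0 hf hg; apply: psdD => //; apply: psdN. Qed.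

Lemma psdX r f n : 0 < r -> psd r f -> psd r (fun z => f z ^+ n).
Proof.
move=> r0 hf; elim: n => [|n IH]; first exact: psd_cst.
by apply: psd_eq (psdM r0 hf IH) => z _; rewrite exprS.
Qed.

Lemma psd_sum r (I : Type) (s : seq I) (P : pred I) (F : I -> C -> C) : 0 < r ->
  (forall i, psd r (F i)) -> psd r (fun z => \sum_(i <- s | P i) F i z).
Proof.
move=> r0 hF; elim: s => [|i s IH].
  by apply: psd_eq (psd_cst r 0) => z _; rewrite big_nil.
case Pi : (P i); last by apply: psd_eq IH => z _; rewrite big_cons Pi.
by apply: psd_eq (psdD (hF i) IH) => z _; rewrite big_cons Pi.
Qed.

Lemma psd_scale r c f : 0 < r -> psd (r * nrm c + 1) f -> psd r (fun z => f (c * z)).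
Proof.
move=> r0 [a [sa ha]]; exists (fun n => a n * c ^+ n); split.
  apply: summ_dom sa => n; rewrite -mulrA -exprMn; apply: nrm_mono.
    by rewrite ltr_wpDl // mulr_ge0 ?nrm_ge0 ?ltW.
  by rewrite nrmM nrm_real ger0_norm ?ltW // mulrC ltrDl.
move=> z zr; have := ha (c * z); rewrite nrmM => /(_ _).
under eq_fun do rewrite exprMn mulrA; apply.
by apply: ler_wpDr => //; rewrite mulrC ler_wpM2r ?nrm_ge0.
Qed.

(** As psd, with an explicit bound of the norm of the series, needed to iterate
    the division by z - z0. *)
Definition psn r M f : Prop := exists a : nat -> C,
  absum (fun n => a n * (r%:C) ^+ n) M /\
  forall z, nrm z <= r -> hsum (fun n => a n * z ^+ n) (f z).

Lemma psd_psn r f : psd r f -> exists M, psn r M f.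
Proof. by case=> a [[M sa] ha]; exists M, a. Qed.

Lemma psn_psd r M f : psn r M f -> psd r f.
Proof. by case=> a [sa ha]; exists a; split=> //; exists M. Qed.

Lemma psn_le r M f z : 0 < r -> psn r M f -> nrm z <= r -> nrm (f z) <= M.
Proof.
move=> r0 [a [sa ha]] zr; apply: hsum_le (ha z zr).
by apply: absum_dom sa => n; apply: nrm_mono.
Qed.

(** Dividing a power series by z - z0: the n-th coefficient of the quotient is
    the sum of a_(n+1+k) z0^k over k, a subfamily of the product of the family
    a_m r^m with a geometric one. *)
Lemma psn_div r M f z0 : 0 < r -> nrm z0 < r -> psn r M f -> f z0 = 0 ->
  exists g, psn r (M / (r - nrm z0)) g /\
    forall z, nrm z <= r -> f z = (z - z0) * g z.
Proof.
move=> r0 z0r [a [sa ha]] f0.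
have rC0 : r%:C != 0 :> C by apply: realC_neq0.
pose s := z0 / r%:C.
have s1 : nrm s < 1.
  by rewrite nrmM nrmV nrm_real (ger0_norm (ltW r0)) ltr_pdivrMr // mul1r.
pose d (x : nat * nat) := a (x.1 + x.2).+1 * z0 ^+ x.2.
pose inj (x : nat * nat) := ((x.1 + x.2).+1, x.2).
have injI : injective inj.
  by move=> [n k] [n' k'] [nk kk]; rewrite kk in nk *; rewrite (addIn nk).
pose a' n := a n * (r%:C) ^+ n.
have dE x : d x * (r%:C) ^+ x.1 = (r%:C)^-1 * (a' (inj x).1 * s ^+ (inj x).2).
  rewrite /d /a' /s /inj /= expr_div_n !(exprS, exprD).
  have k0 : (r%:C) ^+ x.2 != 0 :> C by rewrite expf_neq0.
  by field; rewrite k0 rC0.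
have bnd : absum (fun x => d x * (r%:C) ^+ x.1) (M / (r - nrm z0)).
  have := absum_inj injI (absum_prod sa (absum_geom s1)).
  move=> h A; apply: (@le_trans _ _ (r^-1 * (M * (1 - nrm s)^-1))); last first.
    rewrite /s nrmM nrmV nrm_real (ger0_norm (ltW r0)) le_eqVlt; apply/orP; left.
    apply/eqP; field; rewrite (gt_eqF r0) /=.
    by rewrite subr_eq0 eq_sym (lt_eqF z0r).
  under eq_bigr do rewrite dE nrmM.
  rewrite -mulr_sumr nrmV nrm_real (ger0_norm (ltW r0)) ler_wpM2l ?h //.
  by rewrite invr_ge0 ltW.
have sd n : summ (fun k => d (n, k)).
  have h : summ (fun x => d x * (r%:C) ^+ x.1) by exists (M / (r - nrm z0)).
  have I1 : injective (fun k : nat => (n, k)) by move=> ? ? [].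
  have := summZ ((r%:C) ^- n) (summ_inj I1 h); congr summ; apply/funext => k.
  by rewrite /= mulrCA mulVf ?mulr1 // expf_neq0.
pose b n := tsum (fun k => d (n, k)).
have bz z n : hsum (fun k => d (n, k) * z ^+ n) (b n * z ^+ n).
  have := hsumZ (z ^+ n) (tsumP (sd n)); rewrite mulrC; congr hsum.
  by apply/funext => k; rewrite mulrC.
have absb : absum (fun n => b n * (r%:C) ^+ n) (M / (r - nrm z0)).
  apply: (absum_push (p := fst) bnd) => n.
  apply/(@hsum_inj R _ _ (fun k => (n, k))); first by move=> ? ? [].
    move=> [t' k'] /(_ k'); rewrite /restr /=; case: (t' =P n) => // -> .
    by rewrite eqxx.
  by have := bz r%:C n; congr hsum; apply/funext => k; rewrite /= /restr /= eqxx.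
pose g z := tsum (fun n => b n * z ^+ n).
have hg z : nrm z <= r -> hsum (fun n => b n * z ^+ n) (g z).
  move=> zr; apply: tsumP; apply: (@summ_dom _ _ (fun n => b n * (r%:C) ^+ n)).
    by move=> n; apply: nrm_mono.
  by exists (M / (r - nrm z0)).
exists g; split; first by exists b.
have a0 : a 0%N = - z0 * b 0%N.
  have := hsum_shift (ha z0 (ltW z0r)); rewrite f0 expr0 mulr1 sub0r => h.
  have := hsumZ z0 (tsumP (sd 0%N)); rewrite -/(b _) => h'.
  apply: oppr_inj; rewrite mulNr opprK; apply: hsum_uniq h _.
  move: h'; congr hsum; apply/funext => k; rewrite /d /= add0n exprS; ring.
have aS n : a n.+1 = b n - z0 * b n.+1.
  have := hsum_shift (tsumP (sd n)); rewrite -/(b _) /d /= addn0 expr0 mulr1 => h.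
  have := hsumZ z0 (tsumP (sd n.+1)); rewrite -/(b _) => h'.
  suff <- : b n - a n.+1 = z0 * b n.+1 by ring.
  apply: hsum_uniq h _; move: h'; congr hsum.
  by apply/funext => k; rewrite /d /= addnS addSn exprS; ring.
move=> z zr; have h1 := hsum_shift (ha z zr).
have h2 := hsumZ z (hg z zr).
have h3 := hsumZ z0 (hsum_shift (hg z zr)).
have h4 : hsum (fun n => a n.+1 * z ^+ n.+1)
    (z * g z - z0 * (g z - b 0%N * z ^+ 0)).
  have := hsumB h2 h3; congr hsum; apply/funext => n.
  by rewrite aS exprS; ring.
have := hsum_uniq h1 h4; rewrite a0 !expr0 !mulr1 => E.
have -> : f z = (f z - - z0 * b 0%N) - z0 * b 0%N by ring.
by rewrite E; ring.
Qed.

(** Writing f z - f z0 = (z - z0) g z with g bounded shows f to be Lipschitz at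
    z0. *)
Lemma psd_lip r f z0 : 0 < r -> nrm z0 < r -> psd r f ->
  exists2 K, 0 < K & forall z, nrm z <= r -> nrm (f z - f z0) <= K * nrm (z - z0).
Proof.
move=> r0 zr hf.
have [M hM] := psd_psn (psdB r0 hf (psd_cst r (f z0))).
have [g [hg fg]] := psn_div r0 zr hM (subrr _).
exists (`|M / (r - nrm z0)| + 1) => [|z zr']; first by rewrite ltr_wpDl.
rewrite fg // nrmM mulrC ler_wpM2r ?nrm_ge0 //.
apply: le_trans (psn_le r0 hg zr') _; apply: le_trans (ler_norm _) _.
by rewrite lerDl.
Qed.

(** Write f = z^m f1 with f1 0 <> 0; the factors (z - z0) that split off f1 are
    finite in number, because each division by z - z0 multiplies the constant
    coefficient by |z0|^-1 in modulus and the norm of the series by at most (r -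
    |z0|)^-1 < |z0|^-1. This is where |z0| < r/2 is used. *)
Lemma psd_order r f z0 : 0 < r -> nrm z0 < r / 2 -> psd r f ->
  (exists2 z, nrm z <= r & f z != 0) ->
  exists p g, [/\ psd r g, g z0 != 0 & forall z, nrm z <= r ->
    f z = (z - z0) ^+ p * g z].
Proof.
move=> r0 zr2; have zr : nrm z0 < r by move: zr2 r0; lra.
have key f1 M : psn r M f1 -> (z0 != 0 -> f1 0 != 0) -> f1 z0 != 0 \/ z0 != 0 ->
    exists p g, [/\ psd r g, g z0 != 0 & forall z, nrm z <= r ->
    f1 z = (z - z0) ^+ p * g z].
  move=> hM f10 [f1z|z00].
    exists 0%N, f1; split=> //; first exact: psn_psd hM.
    by move=> z _; rewrite mul1r.
  apply: contrapT => nex.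
  pose s := r - nrm z0.
  have s0 : 0 < s by rewrite subr_gt0.
  have all p : exists g, psn r (M / s ^+ p) g /\ forall z, nrm z <= r ->
      f1 z = (z - z0) ^+ p * g z.
    elim: p => [|p [g [hg fg]]].
      by exists f1; rewrite expr0 divr1; split=> // z _; rewrite mul1r.
    have g0 : g z0 = 0.
      apply/eqP; apply: contrapT => /negP g0; apply: nex; exists p, g.
      by split=> //; apply: psn_psd hg.
    have [h [hh gh]] := psn_div r0 zr hg g0; exists h; split.
      by rewrite exprSr invfM mulrA.
    by move=> z zr'; rewrite fg // gh // exprSr mulrA.
  have M0 : 0 <= M by case: hM => a [sa _]; apply: absum_ge0 sa.
  pose x := nrm z0 / s.
  have x1 : x < 1 by rewrite ltr_pdivrMr // mul1r /s; move: zr2; lra.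
  have x0 : 0 <= x by rewrite divr_ge0 ?nrm_ge0 ?ltW.
  have bd p : nrm (f1 0) <= x ^+ p * M.
    have [g [hg fg]] := all p; have n0 : nrm (0 : C) <= r by rewrite nrm0 ltW.
    rewrite (fg 0 n0) sub0r nrmM nrmX nrmN.
    have -> : x ^+ p * M = nrm z0 ^+ p * (M / s ^+ p).
      by rewrite /x expr_div_n mulrAC mulrA.
    rewrite ler_wpM2l ?exprn_ge0 ?nrm_ge0 //.
    exact: (psn_le r0 hg).
  have xM : (fun p => x ^+ p * M) @ \oo --> (0 : R).
    rewrite -[X in _ --> X](mul0r M); apply: cvgMr_tmp.
    by apply: cvg_expr; rewrite ger0_norm.
  have : nrm (f1 0) <= 0.
    by apply: (ler_cvg_to (cvg_cst _) xM); apply: nearW => p; apply: bd.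
  by rewrite leNgt nrm_gt0 f10.
case=> a [[M sa] ha] [z1 z1r fz1].
have [m am amin] : exists2 m, a m != 0 & forall k, (k < m)%N -> a k = 0.
  have ex : exists m, a m != 0.
    apply: contrapT => nex; case/eqP: fz1.
    have h := ha _ z1r; apply: hsum_uniq h _.
    have -> : (fun n => a n * z1 ^+ n) = (fun=> 0); last exact: hsum0.
    apply/funext => n; have [->|an] := eqVneq (a n) 0; rewrite ?mul0r //.
    by case: nex; exists n.
  exists (ex_minn ex); case: ex_minnP => // m _ hm k km.
  by apply/eqP; apply: contraLR km => /hm; rewrite -leqNgt.
pose f1 z := tsum (fun n => a (m + n)%N * z ^+ n).
have rC0 := realC_neq0 r0.
have s1 : absum (fun n => a (m + n)%N * (r%:C) ^+ n) (r ^- m * M).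
  move=> A; have I1 : injective (addn m) by move=> ? ? /addnI.
  have := absum_inj I1 sa A; rewrite -(ler_pM2l (_ : 0 < r ^- m)); last first.
    by rewrite invr_gt0 exprn_gt0.
  apply: le_trans; rewrite mulr_sumr; apply: ler_sum => n _ /=.
  rewrite exprD !nrmM !nrmX !nrm_real (ger0_norm (ltW r0)) le_eqVlt.
  by rewrite [X in _ == X]mulrCA mulKf ?eqxx // expf_neq0 // lt0r_neq0.
have h1 z : nrm z <= r -> hsum (fun n => a (m + n)%N * z ^+ n) (f1 z).
  move=> zr'; apply: tsumP; apply: (@summ_dom _ _ (fun n => a (m + n)%N * (r%:C) ^+ n)).
    by move=> n; apply: nrm_mono.
  by eexists; apply: s1.
have f1E z : nrm z <= r -> f z = z ^+ m * f1 z.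
  move=> zr'; apply: hsum_uniq (ha z zr') _.
  apply/(@hsum_inj R _ _ (addn m)); first by move=> ? ? /addnI.
    move=> k hk; rewrite amin ?mul0r // ltnNge; apply/negP => mk.
    by have := hk (k - m)%N; rewrite subnKC // eqxx.
  have := hsumZ (z ^+ m) (h1 z zr'); congr hsum; apply/funext => n /=.
  by rewrite exprD; ring.
have f10 : f1 0 != 0.
  have := h1 0; rewrite nrm0 => /(_ (ltW r0)) h.
  rewrite (hsum_uniq h (@hsum1 R _ (fun n => a (m + n)%N * 0 ^+ n) 0%N _)).
    by rewrite addn0 expr0 mulr1.
  by move=> [|n] // _; rewrite exprS mul0r mulr0.
have psf1 : psn r (r ^- m * M) f1 by exists (fun n => a (m + n)%N).
have [z00|z00] := eqVneq z0 0.
  exists m, f1; rewrite z00; split=> //; first exact: psn_psd psf1.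
  by move=> z zr'; rewrite subr0 f1E.
have [p [g [hg gz fg]]] := key f1 _ psf1 (fun=> f10) (or_intror z00).
exists p, (fun z => z ^+ m * g z); split.
- apply: psdM => //.
  by apply: psd_eq (psd_mono r 1 m) => z _; rewrite mul1r.
- by rewrite mulf_neq0 // expf_neq0.
- by move=> z zr'; rewrite f1E // fg // mulrCA.
Qed.

(** The polynomial X^p - x has a root, as R[i] is algebraically closed. *)
Lemma complex_root (x : C) p : (0 < p)%N -> exists w, w ^+ p = x.
Proof.
move=> p0.
have [w hw] := solve_monicpoly (fun i => if i == 0%N then x else 0) p0.
exists w; rewrite hw (bigD1 (Ordinal p0)) //= expr0 mulr1 big1 ?addr0 //.
by move=> i /negbTE; rewrite -(inj_eq val_inj) /= => ->; rewrite mul0r.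
Qed.

Lemma nrm_subr_le z z' : nrm z <= nrm z' + nrm (z - z').
Proof. by rewrite -{1}(subrKC z' z) nrmD. Qed.

(** The maximum principle for the quotient f/g, in a form that allows zeros of g
    away from z0. If F = f g(z0) - f(z0) g were not zero, F = (z - z0)^p G with
    G(z0) <> 0, and for a suitable direction w the quotient f(z0 + t w)/g(z0 + t
    w) would be close to (1 + t^p) f(z0)/g(z0), hence larger in modulus. *)
Lemma max_principle r f g z0 : 0 < r -> nrm z0 < r / 2 -> psd r f -> psd r g ->
  g z0 != 0 ->
  (exists2 d, 0 < d & forall z, nrm (z - z0) <= d ->
     nrm (f z) * nrm (g z0) <= nrm (f z0) * nrm (g z)) ->
  forall z, nrm z <= r -> f z * g z0 = f z0 * g z.
Proof.
move=> r0 zr2 hf hg gz0 [d d0 hd] z1 z1r; apply/eqP.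
apply: contrapT => /negP ne.
have zr : nrm z0 < r by move: zr2 r0; lra.
pose F z := f z * g z0 - f z0 * g z.
have hF : psd r F.
  apply: psdB => //; last exact: psdZ.
  by apply: psdM => //; apply: psd_cst.
have [|p [G [hG Gz0 FG]]] := psd_order r0 zr2 hF.
  by exists z1 => //; rewrite subr_eq0.
have p0 : (0 < p)%N.
  case: p FG => // FG; case/eqP: Gz0; have := FG z0 (ltW zr).
  by rewrite mul1r /F mulrC subrr => <-.
have [Kg Kg0 lipg] := psd_lip r0 zr hg.
have [KG KG0 lipG] := psd_lip r0 zr hG.
have [fz0|fz0] := eqVneq (f z0) 0.
  (* Then f vanishes near z0, so G does too, away from z0. *)
  case/negP: Gz0; apply/eqP/nrm_small => e e0.
  pose t := Num.min (Num.min d (r - nrm z0)) (e / KG).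
  have t0 : 0 < t by rewrite !lt_min d0 subr_gt0 zr divr_gt0.
  have [td [tr te]] : t <= d /\ t <= r - nrm z0 /\ t <= e / KG.
    by rewrite /t !ge_min !lexx !orbT.
  pose z := z0 + t%:C.
  have zz : z - z0 = t%:C by rewrite /z; ring.
  have nz : nrm (z - z0) = t by rewrite zz nrm_real gtr0_norm.
  have zr' : nrm z <= r by have := nrm_subr_le z z0; rewrite nz; move: tr; lra.
  have := hd z; rewrite nz fz0 nrm0 mul0r => /(_ td) h.
  have fz : f z = 0.
    apply/eqP; rewrite -nrm_eq0; apply: contraTT isT => fz; move: h.
    by rewrite leNgt mulr_gt0 // ?nrm_gt0 // -nrm_eq0.
  have := FG z zr'; rewrite /F fz fz0 !mul0r subrr zz => /esym/eqP.
  rewrite mulf_eq0 expf_eq0 (negbTE (realC_neq0 t0)) andbF /= => /eqP Gz.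
  have := lipG z zr'; rewrite Gz sub0r nrmN nz => h'.
  by apply: le_trans h' _; rewrite mulrC -ler_pdivlMr.
pose c := f z0 * g z0; have c0 : c != 0 by rewrite mulf_neq0.
(* In the direction w the leading term of F is a positive multiple of f z0 * g
   z0. *)
have [w hw] := complex_root (c / G z0) p0.
have w0 : w != 0.
  apply/eqP => w0; move: hw; rewrite w0 expr0n gtn_eqF // => /esym/eqP.
  by rewrite mulf_eq0 invr_eq0 (negbTE c0) (negbTE Gz0).
pose W := nrm w; have W0 : 0 < W by rewrite nrm_gt0.
pose K := nrm (f z0) * Kg * W + W ^+ p * KG * W + 1.
have K0 : 0 < K.
  by rewrite ltr_wpDl // addr_ge0 // !mulr_ge0 ?exprn_ge0 ?nrm_ge0 ?ltW.
pose t := Num.min (Num.min (d / W) ((r - nrm z0) / W)) (nrm c / (8 * K)).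
have t0 : 0 < t.
  by rewrite !lt_min !divr_gt0 ?subr_gt0 ?nrm_gt0 ?mulr_gt0.
have [td [tr tK]] : t * W <= d /\ t * W <= r - nrm z0 /\ t * K <= nrm c / 8.
  rewrite -!ler_pdivlMr // /t !ge_min !lexx !orbT; do 2!split=> //.
  by rewrite invfM mulrA lexx orbT.
pose z := z0 + t%:C * w.
have zz : z - z0 = t%:C * w by rewrite /z; ring.
have nz : nrm (z - z0) = t * W by rewrite zz nrmM nrm_real gtr0_norm.
have zr' : nrm z <= r by have := nrm_subr_le z z0; rewrite nz; move: tr; lra.
pose U := f z0 * g z; pose V := w ^+ p * G z.
have FU : f z * g z0 = U + (t ^+ p)%:C * V.
  have := FG z zr'; rewrite /F zz exprMn rmorphXn => E.
  have -> : f z * g z0 = (f z * g z0 - f z0 * g z) + U by rewrite /U; ring.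
  by rewrite E /V; ring.
have Uc : nrm (U - c) <= nrm (f z0) * Kg * W * t.
  rewrite /U /c -mulrBr nrmM -!mulrA ler_wpM2l ?nrm_ge0 //.
  by apply: le_trans (lipg z zr') _; rewrite nz [t * W]mulrC.
have Vc : nrm (V - c) <= W ^+ p * KG * W * t.
  have -> : V - c = w ^+ p * (G z - G z0) by rewrite /V mulrBr hw divfK.
  rewrite nrmM nrmX -!mulrA ler_wpM2l ?exprn_ge0 ?nrm_ge0 //.
  by apply: le_trans (lipG z zr') _; rewrite nz [t * W]mulrC.
have UVc : nrm (U - c) + nrm (V - c) <= nrm c / 8.
  apply: le_trans tK; apply: le_trans (lerD Uc Vc) _.
  by rewrite /K -mulrDl mulrC ler_wpM2l ?(ltW t0) // lerDl.
have c0' : 0 < nrm c by rewrite nrm_gt0.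
have nUc := nrm_ge0 (U - c); have nVc := nrm_ge0 (V - c).
have UV : nrm (V - U) <= nrm c / 8.
  have -> : V - U = (V - c) - (U - c) by ring.
  by apply: le_trans (nrmB _ _) _; move: UVc; lra.
have Ub : nrm c <= nrm U + nrm c / 8.
  by apply: le_trans (nrm_subr_le c U) _; rewrite nrmBC; move: UVc; lra.
have tp0 : 0 < t ^+ p by rewrite exprn_gt0.
have := hd z; rewrite nz => /(_ td); rewrite -!nrmM -/U FU.
have -> : U + (t ^+ p)%:C * V = (1 + t ^+ p)%:C * U - (t ^+ p)%:C * (U - V).
  by rewrite rmorphD rmorph1; ring.
set X := nrm _; move=> hX.
have := nrm_subr_le ((1 + t ^+ p)%:C * U) ((1 + t ^+ p)%:C * U - (t ^+ p)%:C * (U - V)).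
rewrite subKr !nrmM !nrm_real (gtr0_norm tp0) gtr0_norm ?addr_gt0 // -/X.
rewrite [nrm (U - V)]nrmBC mulrDl mul1r -[nrm (f z0) * nrm (g z)]nrmM -/U => h.
have : t ^+ p * nrm U <= t ^+ p * nrm (V - U) by move: h hX; lra.
by rewrite ler_pM2l //; move: UV Ub c0'; lra.
Qed.

End PowerSeries.

(** * The complex exponential as a power series *)

Section Exponential.
Variable R : realType.
Local Notation C := R[i].
Implicit Types (z w : C) (x y r : R).

Lemma hsum_finType (T : finType) (a : T -> C) : hsum a (\sum_t a t).
Proof.
have -> : \sum_t a t = \sum_(t <- [fset t in enum T]%fset) a t.
  apply: perm_big; apply: uniq_perm; rewrite ?fset_uniq ?index_enum_uniq //.
  by move=> t; rewrite in_fset mem_index_enum mem_enum inE.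
by apply: hsum_fin => t; rewrite in_fset mem_enum inE.
Qed.

Lemma hsum_series (u : nat -> R) (l : R) :
  hsum (fun n => (u n)%:C) l%:C -> series u @ \oo --> l.
Proof.
move=> h; apply/cvgrPdist_le => e e0; have [A hA] := h _ e0.
exists (\sum_(i <- A) i)%N.+1 => //= N hN.
have := hA [fset i in iota 0 N]%fset.
have -> : \sum_(i <- [fset i in iota 0 N]%fset) (u i)%:C = (series u N)%:C.
  rewrite /series /= rmorph_sum /index_iota subn0; apply: perm_big.
  by apply: uniq_perm; rewrite ?fset_uniq ?iota_uniq // => i; rewrite in_fset.
rewrite -rmorphB nrm_real; apply; apply/fsubsetP => i iA.
rewrite in_fset mem_iota leq0n add0n; apply: leq_trans hN.
by rewrite ltnS (big_fsetD1 _ iA) leq_addr.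
Qed.

Lemma hsum_Re (T : choiceType) (a : T -> C) l : hsum a l ->
  hsum (fun t => (complex.Re (a t))%:C) (complex.Re l)%:C.
Proof.
move=> h e e0; have [A hA] := h e e0; exists A => B AB.
rewrite -rmorph_sum -rmorphB /= nrm_real -raddf_sum -raddfB.
exact: le_trans (nrm_Re _) (hA B AB).
Qed.

Lemma hsum_Im (T : choiceType) (a : T -> C) l : hsum a l ->
  hsum (fun t => (complex.Im (a t))%:C) (complex.Im l)%:C.
Proof.
move=> h e e0; have [A hA] := h e e0; exists A => B AB.
rewrite -rmorph_sum -rmorphB /= nrm_real -raddf_sum -raddfB.
exact: le_trans (nrm_Im _) (hA B AB).
Qed.

Let ec z n : C := z ^+ n / (n`!)%:R.

Lemma absum_ec z : absum (ec z) (expR (nrm z)).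
Proof.
apply: absum_nat => N.
rewrite (eq_bigr (fun i : 'I_N => exp_coeff (nrm z) i)); last first.
  by move=> i _; rewrite /ec nrmM nrmV nrm_nat nrmX.
rewrite -(big_mkord xpredT (fun i => exp_coeff (nrm z) i)).
apply: (@nondecreasing_cvgn_le R (series (exp_coeff (nrm z)))).
  apply: nondecreasing_series => n _ _.
  by rewrite exp_coeff_ge0 // nrm_ge0.
exact: is_cvg_series_exp_coeff.
Qed.

Lemma summ_ec z : summ (ec z).
Proof. by exists (expR (nrm z)); apply: absum_ec. Qed.

Let E z := tsum (ec z).

Lemma hE z : hsum (ec z) (E z). Proof. exact: tsumP (summ_ec z). Qed.

Lemma hsum_antidiag (f : nat * nat -> C) k :
  hsum (restr (fun u : nat * nat => (u.1 + u.2)%N == k) f) (\sum_(i < k.+1) f (k - i, i : nat)%N).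
Proof.
pose g (i : 'I_k.+1) := (k - i, i : nat)%N.
have gI : injective g by move=> i j [_ /val_inj].
apply/(@hsum_inj R _ _ g) => //.
  move=> [n m] h; rewrite /restr /=; case: eqP => // nm.
  have mk : (m < k.+1)%N by rewrite ltnS -nm leq_addl.
  by have := h (Ordinal mk); rewrite /g /= -nm addnK eqxx.
have := hsum_finType (fun i : 'I_k.+1 => f (g i)); congr hsum.
apply/funext => i; rewrite /restr /= /g /= subnK ?eqxx //.
by rewrite -ltnS.
Qed.

Lemma E_D z w : E (z + w) = E z * E w.
Proof.
have h := hsum_prod (hE z) (hE w).
apply: hsum_uniq (hE (z + w)) _.
apply: (hsum_push (p := fun u : nat * nat => (u.1 + u.2)%N) (hsum_summ h) h) => k.
suff -> : ec (z + w) k = \sum_(i < k.+1) ec z (k - i)%N * ec w i.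
  exact: (hsum_antidiag (fun u => ec z u.1 * ec w u.2)).
rewrite /ec exprDn mulr_suml; apply: eq_bigr => i _.
have ik : (i <= k)%N by rewrite -ltnS.
rewrite -(bin_fact ik) !natrM -mulr_natr.
have f0 n : (n`!)%:R != 0 :> C by rewrite pnatr_eq0 -lt0n fact_gt0.
by field; rewrite !f0 pnatr_eq0 -lt0n bin_gt0.
Qed.

Lemma E_real x : E x%:C = (expR x)%:C.
Proof.
have h := hE x%:C.
have ecE n : ec x%:C n = (exp_coeff x n)%:C.
  by rewrite /ec /exp_coeff /= rmorphM fmorphV rmorphXn rmorph_nat.
have hR := hsum_Re h; have hI := hsum_Im h.
rewrite [LHS]complexE.
have -> : (complex.Im (E x%:C))%:C = 0.
  apply: hsum_uniq hI _; have := @hsum0 R nat; congr hsum; apply/funext => n.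
  by rewrite ecE.
rewrite mulr0 addr0; congr (_%:C).
have := hsum_series hR; under eq_fun do rewrite ecE /=.
move=> /cvg_lim <- //; rewrite /expR; congr (limn (series _)).
Qed.

Lemma E_imag y : E ('i%C * y%:C) = cos y +i* sin y.
Proof.
have h := hE ('i%C * y%:C).
have ecE n : ec ('i%C * y%:C) n = (cos_coeff y n) +i* (sin_coeff y n).
  have -> : ec ('i%C * y%:C) n = 'i%C ^+ n * (y ^+ n / n`!%:R)%:C.
    by rewrite /ec exprMn rmorphM fmorphV rmorphXn rmorph_nat mulrA.
  rewrite /cos_coeff /sin_coeff /=.
  have i2 k : ('i%C : C) ^+ k.*2 = ((-1) ^+ k)%:C.
    by rewrite -mul2n exprM sqr_i rmorphXn rmorphN1.
  rewrite -{1}(odd_double_half n) exprD i2.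
  have [on|en] := boolP (odd n).
    have -> : n.-1./2 = n./2.
      by rewrite -{1}(odd_double_half n) on add1n /= doubleK.
    rewrite expr1.
rewrite /= -?exprnP ?mulr0n ?mulr1n. simpc.
   
    by rewrite !mulrA.
  rewrite expr0.
rewrite /= -?exprnP ?mulr0n ?mulr1n. simpc.
  by rewrite !mulrA.
have hR := hsum_series (hsum_Re h); have hI := hsum_series (hsum_Im h).
apply/eqP; rewrite eq_complex /=; apply/andP; split; apply/eqP.
  rewrite cos.unlock; apply/esym/cvg_lim => //.
  by move: hR; under eq_fun do rewrite ecE.
rewrite sin.unlock; apply/esym/cvg_lim => //.
by move: hI; under eq_fun do rewrite ecE.
Qed.

(** The exponential of the definitions, built from the real functions exp, cos
    and sin, is the sum of the exponential series; this gives access to its power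
    series. *)
Lemma expC_E z : expC z = E z.
Proof. by rewrite {2}[z]complexE E_D E_real E_imag /expC. Qed.

Lemma hsum_expC z : hsum (fun n => z ^+ n / (n`!)%:R) (expC z).
Proof. by rewrite expC_E; apply: hE. Qed.

Lemma expCD z w : expC (z + w) = expC z * expC w.
Proof. by rewrite !expC_E E_D. Qed.

Lemma expC0 : expC (0 : C) = 1.
Proof. by rewrite expC_E (E_real 0) expR0. Qed.

Lemma nrm_expC z : nrm (expC z) = expR (complex.Re z).
Proof.
rewrite /expC nrmM nrm_real ger0_norm ?expR_ge0 // nrm_sqrt /= cos2Dsin2.
by rewrite sqrtr1 mulr1.
Qed.

Lemma expC_neq0 z : expC z != 0.
Proof. by rewrite -nrm_gt0 nrm_expC expR_gt0. Qed.

Lemma psd_expC r : 0 < r -> psd r (@expC R).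
Proof.
move=> r0; exists (fun n => (n`!)%:R^-1); split.
  by have := summ_ec r%:C; congr summ; apply/funext => n; rewrite mulrC.
by move=> z _; have := hsum_expC z; congr hsum; apply/funext => n; rewrite mulrC.
Qed.

(** The bound on the second order remainder which makes Fourier series
    differentiable. *)
Lemma nrm_expC_sub1z z : nrm (expC z - 1 - z) <= nrm z ^+ 2 * expR (nrm z).
Proof.
have := hsum_shift (hsum_shift (hsum_expC z)); rewrite !expr0 !expr1 !fact0 !divr1.
apply: hsum_le => A.
apply: le_trans (ler_wpM2l (exprn_ge0 2 (nrm_ge0 z)) (@absum_ec z A)).
rewrite mulr_sumr; apply: ler_sum => n _.
have -> : z ^+ n.+2 / (n.+2)`!%:R = z ^+ 2 * (z ^+ n / (n.+2)`!%:R).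
  by rewrite -addn2 exprD mulrAC mulrC.
rewrite nrmM nrmX ler_wpM2l ?exprn_ge0 ?nrm_ge0 // /ec !nrmM.
rewrite ler_wpM2l ?nrm_ge0 //.
rewrite !nrmV !nrm_nat lef_pV2 ?posrE ?ltr0n ?fact_gt0 // ler_nat.
by rewrite !factS mulnA leq_pmull // muln_gt0.
Qed.

End Exponential.

(** * The function e(z) *)

Section E2pi.
Variable R : realType.
Local Notation C := R[i].
Implicit Types (z w q : C) (r b : R).

(** The constant 2 pi i. *)
Definition tpi : C := 2 * pi%:C * 'i%C.

Lemma e2piE z : e2pi z = expC (tpi * z). Proof. by []. Qed.

Lemma tpi_neq0 : tpi != 0.
Proof.
rewrite !mulf_neq0 ?pnatr_eq0 //; last by rewrite eq_complex /= oner_eq0 andbF.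
by apply: realC_neq0; apply: pi_gt0.
Qed.

Lemma e2piD z w : e2pi (z + w) = e2pi z * e2pi w.
Proof. by rewrite !e2piE mulrDr expCD. Qed.

Lemma e2pi0 : e2pi (0 : C) = 1.
Proof. by rewrite e2piE mulr0 expC0. Qed.

Lemma e2pi_neq0 z : e2pi z != 0. Proof. exact: expC_neq0. Qed.

Lemma e2piN z : e2pi (- z) = (e2pi z)^-1.
Proof.
apply: (mulfI (e2pi_neq0 z)); rewrite -e2piD subrr e2pi0 mulfV //.
exact: e2pi_neq0.
Qed.

Lemma e2piB z w : e2pi (z - w) = e2pi z / e2pi w.
Proof. by rewrite e2piD e2piN. Qed.

Lemma e2piMn z n : e2pi (n%:R * z) = e2pi z ^+ n.
Proof.
elim: n => [|n IH]; first by rewrite mul0r e2pi0.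
by rewrite -addn1 natrD mulrDl mul1r e2piD IH exprD expr1.
Qed.

Lemma e2piMz z (n : int) : e2pi (n%:~R * z) = e2pi z ^ n.
Proof.
case: n => n; first exact: e2piMn.
by rewrite NegzE mulrNz mulNr e2piN e2piMn.
Qed.

Lemma Re_tpi z : complex.Re (tpi * z) = - (2 * pi * complex.Im z).
Proof.
case: z => x y; rewrite /tpi -(rmorph_nat (real_complex R)); by simpc => /=.
Qed.

Lemma Im_tpi z : complex.Im (tpi * z) = 2 * pi * complex.Re z.
Proof.
case: z => x y; rewrite /tpi -(rmorph_nat (real_complex R)); by simpc => /=.
Qed.

Lemma e2pi_half : e2pi (2^-1 : C) = -1.
Proof.
have -> : (2^-1 : C) = (2^-1 : R)%:C by rewrite fmorphV rmorph_nat.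
rewrite e2piE /expC Re_tpi Im_tpi /= mulr0 oppr0 expR0 mul1r.
have -> : 2 * pi * 2^-1 = pi :> R by rewrite mulrC mulrA mulVf ?mul1r ?pnatr_eq0.
by rewrite cospi sinpi; apply/eqP; rewrite eq_complex /= oppr0 !eqxx.
Qed.

Lemma e2pi1 : e2pi (1 : C) = 1.
Proof.
have h : (1 : C) = 2^-1 + 2^-1 by field.
by rewrite {1}h e2piD e2pi_half mulrNN mulr1.
Qed.

Lemma e2pi_int (n : int) : e2pi (n%:~R : C) = 1.
Proof. by rewrite -[n%:~R]mulr1 e2piMz e2pi1 exp1rz. Qed.

Lemma nrm_tpi : nrm tpi = 2 * pi.
Proof.
rewrite /tpi !nrmM nrm_nat nrm_real ger0_norm ?pi_ge0 //.
by rewrite [nrm 'i]nrm_sqrt /= expr0n add0r expr1n sqrtr1 mulr1.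
Qed.

Lemma nrm_e2pi z : nrm (e2pi z) = expR (- (2 * pi * complex.Im z)).
Proof. by rewrite e2piE nrm_expC Re_tpi. Qed.

Lemma e2pi_surj q : q != 0 -> exists z, e2pi z = q.
Proof.
move=> q0; have nq : 0 < nrm q by rewrite nrm_gt0.
pose u := q / (nrm q)%:C; have nu : nrm u = 1.
  by rewrite nrmM nrmV nrm_real gtr0_norm // mulfV // gt_eqF.
have uu : complex.Re u ^+ 2 + complex.Im u ^+ 2 = 1.
  by rewrite -[LHS]sqr_sqrtr ?addr_ge0 ?sqr_ge0 // -nrm_sqrt nu expr1n.
have [t ht] : exists t, cos t +i* sin t = u.
  have uRe : -1 <= complex.Re u <= 1 by rewrite -ler_norml -nu nrm_Re.
  have s0 := sin_acos uRe.
  have sE : Num.sqrt (1 - complex.Re u ^+ 2) = `|complex.Im u|.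
    by rewrite -uu addrC addKr sqrtr_sqr.
  have cE : cos (acos (complex.Re u)) = complex.Re u by rewrite acosK.
  have [i0|i0] := lerP 0 (complex.Im u).
    exists (acos (complex.Re u)); rewrite s0 cE sE ger0_norm //.
    by apply/eqP; rewrite eq_complex !eqxx.
  exists (- acos (complex.Re u)); rewrite cosN sinN s0 cE sE ltr0_norm // opprK.
  by apply/eqP; rewrite eq_complex !eqxx.
exists (tpi^-1 * (ln (nrm q) +i* t)).
rewrite e2piE mulVKf ?tpi_neq0 // /expC /= ht lnK ?posrE // /u.
by rewrite mulrCA mulfV ?mulr1 // realC_neq0.
Qed.

Lemma e2pi_upper z : in_upper z -> nrm (e2pi z) < 1.
Proof.
rewrite /in_upper nrm_e2pi => z0; rewrite expR_lt1 oppr_lt0.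
by rewrite !mulr_gt0 // pi_gt0.
Qed.

Lemma e2pi_upper_surj q : q != 0 -> nrm q < 1 ->
  exists tau : upper R, e2pi (val tau) = q.
Proof.
move=> /e2pi_surj[z zq] q1.
have zu : in_upper z.
  move: q1; rewrite -zq nrm_e2pi expR_lt1 oppr_lt0 /in_upper.
  by rewrite pmulr_rgt0 // mulr_gt0 // pi_gt0.
by exists (exist _ z zu).
Qed.

Lemma e2pi_real_eq1 b : `|b| <= 2^-1 -> e2pi b%:C = 1 -> b = 0.
Proof.
move=> b2; rewrite e2piE /expC Re_tpi Im_tpi /= mulr0 oppr0 expR0 mul1r.
move=> /eqP; rewrite eq_complex /= => /andP[/eqP c1 _].
have p0 := pi_gt0 R.
have c2 : cos (2 * pi * `|b|) = 1.
  by have [h|h] := ger0P b; rewrite ?mulrN ?cosN.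
have bnd : 0 <= 2 * pi * `|b| <= pi.
  apply/andP; split; first by rewrite !mulr_ge0 // ltW.
  have -> : 2 * pi * `|b| = pi * (2 * `|b|) by ring.
  by apply: ler_piMr; [apply: ltW|move: b2; lra].
have : 2 * pi * `|b| = 0.
  by apply: (@cos_inj R); rewrite ?c2 ?cos0 // in_itv //= lexx pi_ge0.
move/eqP; rewrite !mulf_eq0 pnatr_eq0 (gt_eqF p0) normr_eq0 /=.
by move/eqP.
Qed.

Lemma psd_e2pi r c : 0 < r -> psd r (fun z => e2pi (c * z)).
Proof.
move=> r0; have h : psd r (fun z => expC (tpi * c * z)).
  apply: psd_scale => //; apply: psd_expC.
  by rewrite ltr_wpDl // mulr_ge0 ?nrm_ge0 // ltW.
by apply: psd_eq h => z _; rewrite e2piE mulrA.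
Qed.

Lemma psd_sqr r (f : C -> C) : 0 < r -> psd (r ^+ 2) f ->
  psd r (fun z => f (z ^+ 2)).
Proof.
move=> r0 [a [sa ha]]; apply: (@ps_push R _ a (fun n => 2 * n)%N) => //.
  by have := sa; congr summ; apply/funext => n; rewrite rmorphXn exprM.
move=> z zr; have := ha (z ^+ 2); rewrite nrmX => /(_ _).
have -> : (fun n => a n * (z ^+ 2) ^+ n) = (fun n => a n * z ^+ (2 * n)%N).
  by apply/funext => n; rewrite exprM.
by apply; rewrite lerXn2r // nnegrE ?nrm_ge0 ?ltW.
Qed.

(** The entire function (e(z) - 1)/z, extended by its value at 0; it exhibits the
    simple zero of e(z) - 1 at 0. *)
Definition e2pi_quot z : C := if z == 0 then tpi else (e2pi z - 1) / z.

Lemma e2pi_quotE z : e2pi z - 1 = z * e2pi_quot z.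
Proof.
rewrite /e2pi_quot; case: eqVneq => [->|z0]; first by rewrite e2pi0 subrr mul0r.
by rewrite mulrCA mulfV ?mulr1.
Qed.

Lemma psd_e2pi_quot r : 0 < r -> psd r e2pi_quot.
Proof.
move=> r0; pose a n : C := tpi ^+ n.+1 / (n.+1)`!%:R.
have h z : hsum (fun n => a n * z ^+ n) (e2pi_quot z).
  rewrite /e2pi_quot; case: eqVneq => [->|z0].
    have a0 : a 0%N * 0 ^+ 0 = tpi by rewrite /a expr1 factS fact0 muln1 divr1 expr0 mulr1.
    rewrite -[X in hsum _ X]a0.
    apply: (@hsum1 R _ (fun n => a n * 0 ^+ n) 0%N) => -[|n] // _.
    by rewrite exprS mul0r mulr0.
  have := hsum_shift (hsum_expC (tpi * z)); rewrite expr0 fact0 divr1.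
  move=> /(hsumZ z^-1) h; rewrite [X in hsum _ X]mulrC e2piE; move: h.
  congr hsum; apply/funext => n.
  by rewrite /a exprMn [z ^+ n.+1]exprS; field; rewrite z0 pnatr_eq0 -lt0n fact_gt0.
exists a; split; last by move=> z _; apply: h.
exact: hsum_summ (h r%:C).
Qed.

End E2pi.

(** * Fourier series in q and y *)

Section FourierClass.
Variable R : realType.
Local Notation C := R[i].
Implicit Types (q y : C) (G H : C -> C -> C).

(** Functions with a Fourier expansion with nonnegative powers of q, as functions
    of q = e(tau) and y = e(z). The value at q = 0 is part of the data, which
    makes values at the cusp available. *)
Definition lau G : Prop := exists a : nat * int -> C, forall q y,
  nrm q < 1 -> y != 0 -> hsum (fun nr => a nr * (q ^+ nr.1 * y ^ nr.2)) (G q y).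

Lemma lau_push (I : choiceType) (c : I -> C) (N : I -> nat) (r : I -> int) G :
  (forall q y, nrm q < 1 -> y != 0 ->
    hsum (fun i => c i * (q ^+ N i * y ^ r i)) (G q y)) -> lau G.
Proof.
move=> hG; pose p i := (N i, r i).
have h2 : nrm (2^-1 : C) < 1.
  by rewrite nrmV nrm_nat invf_lt1 ?ltr1n.
have sf k : summ (restr (fun i => p i == k) c).
  have s0 := hsum_summ (hG _ 1 h2 (oner_neq0 _)).
  apply: summ_dom (summZ ((2%:R : C) ^+ k.1) (summ_restr (fun i => p i == k) s0)).
  move=> i; rewrite /restr; case: eqP => [<-|_]; last by rewrite mulr0.
  by rewrite exp1rz mulr1 mulrCA -exprMn mulfV ?pnatr_eq0 // expr1n mulr1.
exists (fun k => tsum (restr (fun i => p i == k) c)) => q y q1 y0.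
apply: (hsum_push (p := p) (hsum_summ (hG q y q1 y0)) (hG q y q1 y0)) => k.
rewrite mulrC; have := hsumZ (q ^+ k.1 * y ^ k.2) (tsumP (sf k)); congr hsum.
apply/funext => i; rewrite /restr; case: eqP => [<-|_]; rewrite ?mulr0 //.
by rewrite mulrC.
Qed.

Lemma lau_eq G H : (forall q y, nrm q < 1 -> y != 0 -> G q y = H q y) ->
  lau G -> lau H.
Proof. by move=> GH [a ha]; exists a => q y q1 y0; rewrite -GH //; apply: ha. Qed.

Lemma lauD G H : lau G -> lau H -> lau (fun q y => G q y + H q y).
Proof.
move=> [a ha] [b hb]; exists (fun k => a k + b k) => q y q1 y0.
have := hsumD (ha q y q1 y0) (hb q y q1 y0); congr hsum.
by apply/funext => k; rewrite mulrDl.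
Qed.

Lemma lauM G H : lau G -> lau H -> lau (fun q y => G q y * H q y).
Proof.
move=> [a ha] [b hb].
apply: (@lau_push _ (fun u : (nat * int) * (nat * int) => a u.1 * b u.2)
  (fun u => u.1.1 + u.2.1)%N (fun u => u.1.2 + u.2.2)) => q y q1 y0.
have := hsum_prod (ha q y q1 y0) (hb q y q1 y0); congr hsum.
by apply/funext => u; rewrite exprD expfzDr //; ring.
Qed.

Lemma lau_mono c N (r : int) : lau (fun q y => c * (q ^+ N * y ^ r)).
Proof.
apply: (@lau_push unit (fun=> c) (fun=> N) (fun=> r)) => q y _ _.
by apply: (@hsum1 R unit (fun=> c * (q ^+ N * y ^ r)) tt); case.
Qed.

Lemma lau_cst c : lau (fun _ _ => c).
Proof. by apply: lau_eq (lau_mono c 0 0) => q y _ _; rewrite expr0z !mulr1. Qed.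

Lemma lau_y (r : int) : lau (fun _ y => y ^ r).
Proof. by apply: lau_eq (lau_mono 1 0 r) => q y _ _; rewrite !mul1r. Qed.

Lemma lauZ c G : lau G -> lau (fun q y => c * G q y).
Proof. by apply: lauM; apply: lau_cst. Qed.

Lemma lauN G : lau G -> lau (fun q y => - G q y).
Proof. by move=> /(lauZ (-1)); apply: lau_eq => q y _ _; rewrite mulN1r. Qed.

Lemma lauB G H : lau G -> lau H -> lau (fun q y => G q y - H q y).
Proof. by move=> hG hH; apply: lauD => //; apply: lauN. Qed.

Lemma lauX G n : lau G -> lau (fun q y => G q y ^+ n).
Proof.
move=> hG; elim: n => [|n IH]; first exact: lau_cst.
by apply: lau_eq (lauM hG IH) => q y _ _; rewrite exprS.
Qed.

Lemma lau_psd G y r : lau G -> y != 0 -> 0 < r -> r < 1 -> psd r (fun q => G q y).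
Proof.
move=> [a ha] y0 r0 r1.
have h q : nrm q < 1 ->
    hsum (fun k : nat * int => a k * y ^ k.2 * q ^+ k.1) (G q y).
  move=> q1; have := ha q y q1 y0; congr hsum; apply/funext => k.
  by rewrite -mulrA [X in _ = _ * X]mulrC.
apply: (@ps_push R _ (fun k : nat * int => a k * y ^ k.2) fst) => //.
  by apply: hsum_summ (h _ _); rewrite nrm_real gtr0_norm.
by move=> q qr; apply: h; apply: le_lt_trans r1.
Qed.

(** The average of G q and G (- q) only involves even powers of q. *)
Lemma lau_even G : lau G -> (forall q y, nrm q < 1 -> y != 0 -> G (- q) y = G q y) ->
  exists2 H, lau H & forall q y, nrm q < 1 -> y != 0 -> H (q ^+ 2) y = G q y.
Proof.
move=> [a ha] Gev; exists (fun q y => G (sqrtc q) y); last first.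
  move=> q y q1 y0.
  have /eqP : (sqrtc (q ^+ 2) - q) * (sqrtc (q ^+ 2) + q) = 0.
    by rewrite -subr_sqr sqr_sqrtc subrr.
  rewrite mulf_eq0 subr_eq0 addr_eq0 => /orP[/eqP->//|/eqP->].
  exact: Gev.
exists (fun k => a (k.1.*2, k.2)) => q y q1 y0.
set s := sqrtc q; have sq : s ^+ 2 = q by apply: sqr_sqrtc.
have s1 : nrm s < 1.
  by rewrite -(@expr_lt1 _ 2) ?nrm_ge0 // -nrmX sq.
have s1' : nrm (- s) < 1 by rewrite nrmN.
pose f (k : nat * int) : nat * int := (k.1.*2, k.2).
have fI : injective f by move=> [n r] [n' r'] [/double_inj -> ->].
have h := hsumZ 2^-1 (hsumD (ha s y s1 y0) (ha (- s) y s1' y0)).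
rewrite Gev // in h; have E : 2^-1 * (G s y + G s y) = G s y by field.
rewrite E in h.
move: h; set u := (fun _ : nat * int => _) => h.
have uf : u \o f = (fun k => a (k.1.*2, k.2) * (q ^+ k.1 * y ^ k.2)).
  apply/funext => -[n r]; rewrite /u /f /= exprNn -!mul2n !exprM sq sqrrN !expr1n.
  by field.
rewrite -uf; apply/(@hsum_inj R _ _ f u) => //.
move=> [n r] nf; rewrite /u /= exprNn; have [on|en] := boolP (odd n).
  by rewrite -signr_odd on expr1; ring.
have := nf (n./2, r); rewrite /f /= -{2}(odd_double_half n) (negbTE en) add0n.
by rewrite eqxx.
Qed.

End FourierClass.

(** * Majorants of power series in q *)

Section Majorants.
Variable R : realType.
Local Notation C := R[i].

(** Power series on the unit disc with a bound for the sum of the moduli of their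
    terms. The bound is multiplicative, which makes products of geometric series
    summable uniformly. *)
Definition majorized (f : C -> C) (B : R -> R) : Prop := exists a : nat -> C,
  (forall r, 0 <= r < 1 -> absum (fun n => a n * (r%:C) ^+ n) (B r)) /\
  forall q, nrm q < 1 -> hsum (fun n => a n * q ^+ n) (f q).

Lemma majM f g B D : majorized f B -> majorized g D ->
  majorized (fun q => f q * g q) (fun r => B r * D r).
Proof.
move=> [a [aB ha]] [b [bD hb]].
pose c (u : nat * nat) := a u.1 * b u.2.
pose p (u : nat * nat) := (u.1 + u.2)%N.
have pE q u : c u * q ^+ p u = (a u.1 * q ^+ u.1) * (b u.2 * q ^+ u.2).
  by rewrite /c /p exprD mulrACA.
have h q : nrm q < 1 -> hsum (fun u => c u * q ^+ p u) (f q * g q).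
  move=> q1; have := hsum_prod (ha q q1) (hb q q1); congr hsum.
  by apply/funext => u; rewrite pE.
have fib q k : hsum (restr (fun u => p u == k) (fun u => c u * q ^+ p u))
    ((\sum_(i < k.+1) c (k - i, i : nat)%N) * q ^+ k).
  rewrite mulrC; have := hsumZ (q ^+ k) (hsum_antidiag c k); congr hsum.
  by apply/funext => u; rewrite /restr /p; case: eqP => [<-|_]; rewrite ?mulr0 // mulrC.
exists (fun k => \sum_(i < k.+1) c (k - i, i : nat)%N); split.
  move=> r r1; apply: (absum_push (p := p) _ (fib _)).
  have := absum_prod (aB r r1) (bD r r1); congr absum.
  by apply/funext => u; rewrite pE.
by move=> q q1; apply: hsum_push (hsum_summ (h q q1)) (h q q1) (fib q).
Qed.

Lemma maj_exp n : majorized (fun q => q ^+ n) (fun r => r ^+ n).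
Proof.
pose a k : C := (k == n)%:R.
have h q : hsum (fun k => a k * q ^+ k) (q ^+ n).
  have an : a n * q ^+ n = q ^+ n by rewrite /a eqxx mul1r.
  rewrite -[X in hsum _ X]an; apply: (@hsum1 R _ (fun k => a k * q ^+ k)) => k.
  by rewrite /a => /negbTE ->; rewrite mul0r.
exists a; split=> // r /andP[r0 _] A.
have h' : hsum (fun k => (nrm (a k * r%:C ^+ k))%:C) (r ^+ n)%:C.
  have an : (nrm (a n * r%:C ^+ n))%:C = (r ^+ n)%:C.
    by rewrite /a eqxx mul1r nrmX nrm_real ger0_norm.
  rewrite -an; apply: (@hsum1 R _ (fun k => (nrm (a k * r%:C ^+ k))%:C)) => k.
  by rewrite /a => /negbTE ->; rewrite mul0r nrm0.
apply/ler_addgt0Pr => e e0; have [B hB] := h' e e0.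
have := hB (A `|` B)%fset (fsubsetUr _ _).
rewrite -rmorph_sum -rmorphB nrm_real ler_norml => /andP[+ _].
have := sum_fset_mono (fun k => nrm_ge0 (a k * r%:C ^+ k)) (fsubsetUl A B).
lra.
Qed.

Lemma maj_geom m : majorized (fun q => (1 - q ^+ m.+1)^-1) (fun r => (1 - r ^+ m.+1)^-1).
Proof.
pose f k := (k * m.+1)%N.
have fI : injective f by move=> k k' /eqP; rewrite eqn_pmul2r // => /eqP.
pose a n : C := (m.+1 %| n)%:R.
have aE q : (fun n => a n * q ^+ n) \o f = (fun k => (q ^+ m.+1) ^+ k).
  by apply/funext => k; rewrite /a /f /= dvdn_mull // mul1r mulnC exprM.
have a0 q k : (forall t, f t != k) -> a k * q ^+ k = 0.
  move=> nf; rewrite /a; case: dvdnP => [[k' kk]|_]; last by rewrite mul0r.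
  by have := nf k'; rewrite kk eqxx.
have q1m (q : C) : nrm q < 1 -> nrm (q ^+ m.+1) < 1.
  by move=> q1; rewrite nrmX exprn_ilt1 ?nrm_ge0.
exists a; split=> [r /andP[r0 r1]|q q1].
  have rC : nrm r%:C < 1 by rewrite nrm_real ger0_norm.
  have := absum_geom (q1m _ rC); rewrite -aE nrmX nrm_real ger0_norm // => h.
  apply: (absum_push (p := f) h) => k.
  have [[t ft]|nf] := pselect (exists t, f t = k).
    have <- : restr (fun x => f x == k) ((fun n => a n * r%:C ^+ n) \o f) t =
      a k * r%:C ^+ k by rewrite /restr /= ft eqxx.
    by apply: hsum1 => i; rewrite /restr -ft (inj_eq fI) => /negbTE ->.
  rewrite a0 => [|t]; last by apply/eqP => ft; apply: nf; exists t.
  have -> : restr (fun x => f x == k) ((fun n => a n * r%:C ^+ n) \o f) = (fun=> 0).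
    by apply/funext => t; rewrite /restr; case: eqP => // ft; case: nf; exists t.
  exact: hsum0.
apply/(@hsum_inj R _ _ f) => //; first exact: a0.
rewrite aE; have s0 : summ (fun k => (q ^+ m.+1) ^+ k).
  by eexists; apply: absum_geom (q1m _ q1).
have h := tsumP s0; have := hsum_shift h; rewrite expr0 => h1.
have h2 := hsumZ (q ^+ m.+1) h.
have E : tsum (fun k => (q ^+ m.+1) ^+ k) - 1 =
    q ^+ m.+1 * tsum (fun k => (q ^+ m.+1) ^+ k).
  by apply: hsum_uniq h1 _; move: h2; congr hsum; apply/funext => k; rewrite [RHS]exprS.
have d0 : 1 - q ^+ m.+1 != 0.
  rewrite subr_eq0; apply/eqP => E1; have := q1m _ q1.
  by rewrite -E1 nrm1 ltxx.
suff <- : tsum (fun k => (q ^+ m.+1) ^+ k) = (1 - q ^+ m.+1)^-1 by [].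
apply: (mulfI d0); rewrite mulfV // mulrBl mul1r -E; ring.
Qed.

(** The ratio test. *)
Lemma summ_ratio (u : nat -> C) m :
  (forall n, (m <= n)%N -> nrm (u n.+1) <= nrm (u n) / 2) -> summ u.
Proof.
move=> h; exists (\sum_(i < m) nrm (u i) + 2 * nrm (u m)); apply: absum_nat => N.
have key k : \sum_(i < (m + k)%N) nrm (u i) + 2 * nrm (u (m + k)%N) <=
    \sum_(i < m) nrm (u i) + 2 * nrm (u m).
  elim: k => [|k IH]; first by rewrite addn0.
  apply: le_trans IH; rewrite addnS big_ord_recr /= -addrA lerD2l.
  by have := h (m + k)%N (leq_addr _ _); lra.
apply: le_trans (key N); rewrite -[leLHS]addr0 lerD ?mulr_ge0 ?nrm_ge0 //.
rewrite addnC big_split_ord /= lerDl; apply: sumr_ge0 => i _; exact: nrm_ge0.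
Qed.

End Majorants.

(** * The product of the 1 + q^n x *)

(** The coefficients of Euler's expansion of the product of the 1 + q^n x over n
    >= 0: the coefficient of x^m is q^(m(m-1)/2) / ((1-q)...(1-q^m)). *)
Definition phi (R : realType) m (q : R[i]) : R[i] :=
  \prod_(i < m) (q ^+ i / (1 - q ^+ i.+1)).

(** The infinite product of the 1 + q^n x over n >= 0, defined by Euler's
    expansion in powers of x, which gives its analyticity in q and x at once. *)
HB.lock Definition Phi (R : realType) (q x : R[i]) : R[i] :=
  tsum (fun m => phi m q * x ^+ m).
Canonical locked_Phi := Unlockable Phi.unlock.

Section EulerFunction.
Variable R : realType.
Local Notation C := R[i].
Implicit Types (q x y : C).

Let B m (r : R) := \prod_(i < m) (r ^+ i / (1 - r ^+ i.+1)).

Lemma maj_phi m : majorized (phi m) (B m).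
Proof.
elim: m => [|m IH].
  have := maj_exp R 0; rewrite /phi /B; congr majorized; apply/funext => q;
  by rewrite big_ord0 expr0.
have := majM IH (majM (maj_exp R m) (maj_geom R m)).
rewrite /phi /B; congr majorized; apply/funext => q; by rewrite big_ord_recr.
Qed.

Lemma expr_small (r : R) e : 0 <= r < 1 -> 0 < e ->
  exists N, forall n, (N <= n)%N -> r ^+ n <= e.
Proof.
move=> /andP[r0 r1] e0.
have r1' : `|r| < 1 by rewrite ger0_norm.
have /cvgrPdist_le/(_ _ e0)[N _ hN] := cvg_expr r1'.
exists N => n Nn; have := hN n Nn; rewrite /= sub0r normrN.
by rewrite ger0_norm ?exprn_ge0.
Qed.

Lemma summ_B (r X : R) : 0 <= r < 1 -> 0 <= X ->
  summ (fun m => (B m r * X ^+ m)%:C).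
Proof.
move=> r01 X0; have /andP[r0 r1] := r01.
have d0 : 0 < 1 - r by rewrite subr_gt0.
pose Y := X / (1 - r) + 1.
have Y0 : 0 < Y by rewrite ltr_wpDl // divr_ge0 // ltW.
have [N hN] := expr_small r01 (divr_gt0 (ltr01 : 0 < 1 :> R) (mulr_gt0 (ltr0Sn R 1) Y0)).
have Bge m : 0 <= B m r.
  apply: prodr_ge0 => i _; rewrite divr_ge0 ?exprn_ge0 //.
  by rewrite subr_ge0 exprn_ile1 // ltW.
apply: (@summ_ratio R _ N) => n Nn.
rewrite !nrm_real !ger0_norm ?mulr_ge0 ?exprn_ge0 //.
have -> : B n.+1 r * X ^+ n.+1 = B n r * X ^+ n * (r ^+ n * (X / (1 - r ^+ n.+1))).
  by rewrite /B big_ord_recr /= [X ^+ n.+1]exprSr; ring.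
rewrite ler_wpM2l ?mulr_ge0 ?exprn_ge0 //.
have rn : r ^+ n.+1 <= r by rewrite exprS ler_piMr // exprn_ile1 // ltW.
have XY : X / (1 - r ^+ n.+1) <= Y.
  apply: (@le_trans _ _ (X / (1 - r))); last by rewrite lerDl.
  rewrite ler_wpM2l // lef_pV2 ?posrE //; first by rewrite lerD2l lerN2.
  by rewrite subr_gt0; apply: le_lt_trans rn r1.
apply: le_trans (_ : r ^+ n * Y <= _).
  by rewrite ler_wpM2l // exprn_ge0.
apply: le_trans (ler_wpM2r (ltW Y0) (hN n Nn)) _.
by rewrite mul1r invfM -mulrA mulVf ?mulr1 ?lexx // gt_eqF.
Qed.

Lemma phi_le m q : nrm q < 1 -> nrm (phi m q) <= B m (nrm q).
Proof.
move=> q1; have [a [aB ha]] := maj_phi m.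
have q01 : 0 <= nrm q < 1 by rewrite nrm_ge0.
apply: hsum_le (ha q q1); apply: absum_dom (aB _ q01) => n.
by rewrite !nrmM !nrmX nrm_real ger0_norm ?nrm_ge0.
Qed.

Lemma hsum_Phi q x : nrm q < 1 -> hsum (fun m => phi m q * x ^+ m) (Phi q x).
Proof.
move=> q1; rewrite unlock; apply: tsumP.
have q01 : 0 <= nrm q < 1 by rewrite nrm_ge0.
apply: summ_dom (summ_B q01 (nrm_ge0 x)) => m.
rewrite nrm_real nrmM nrmX; apply: le_trans (ler_norm _).
by rewrite ler_wpM2r ?exprn_ge0 ?nrm_ge0 // phi_le.
Qed.

(** Comparing the coefficients of the two sides; phi is made for this. *)
Lemma Phi_rec q x : nrm q < 1 -> Phi q x = (1 + x) * Phi q (q * x).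
Proof.
move=> q1.
have h := hsumB (hsum_Phi x q1) (hsum_Phi (q * x) q1).
have h1 := hsum_shift h; rewrite [X in hsum _ X]/= !expr0 subrr subr0 in h1.
have h2 := hsumZ x (hsum_Phi (q * x) q1).
suff E : Phi q x - Phi q (q * x) = x * Phi q (q * x).
  by rewrite mulrDl mul1r -E; ring.
apply: hsum_uniq h1 _; move: h2; congr hsum; apply/funext => m.
have d0 : 1 - q ^+ m.+1 != 0.
  rewrite subr_eq0; apply/eqP => E1.
  have : nrm (q ^+ m.+1) < 1 by rewrite nrmX exprn_ilt1 ?nrm_ge0.
  by rewrite -E1 nrm1 ltxx.
rewrite /phi big_ord_recr /= !exprMn [x ^+ m.+1]exprS.
move: (q ^+ m.+1) d0 (\prod_(i < m) _) (q ^+ m) (x ^+ m) => Q d0 P u v.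
by field.
Qed.

Lemma Phi0 q : nrm q < 1 -> Phi q 0 = 1.
Proof.
move=> q1; apply: hsum_uniq (hsum_Phi 0 q1) _.
have E : phi 0 q * 0 ^+ 0 = 1 by rewrite /phi big_ord0 mulr1.
rewrite -[X in hsum _ X]E.
apply: (@hsum1 R _ (fun m => phi m q * 0 ^+ m) 0%N) => -[|n] // _.
by rewrite exprS mul0r mulr0.
Qed.

Lemma psd_Phi q (r : R) : nrm q < 1 -> 0 < r -> psd r (Phi q).
Proof.
move=> q1 r0; exists (fun m => phi m q); split; last by move=> x _; apply: hsum_Phi.
exact: hsum_summ (hsum_Phi _ q1).
Qed.

Lemma Phi_iter q x N : nrm q < 1 ->
  Phi q x = \prod_(n < N) (1 + q ^+ n * x) * Phi q (q ^+ N * x).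
Proof.
move=> q1; elim: N => [|N IH]; first by rewrite big_ord0 !mul1r.
rewrite IH big_ord_recr /= -[RHS]mulrA; congr (_ * _).
by rewrite [LHS](Phi_rec _ q1) exprS mulrA.
Qed.

(** Functions which satisfy the same recurrence x -> q x and tend to 1 at 0 are
    equal, see near1_uniq; product identities for Phi are proved in this way. *)
Definition near1 (F : C -> C) : Prop := forall e : R, 0 < e ->
  exists2 d : R, 0 < d & forall x, nrm x <= d -> nrm (F x - 1) <= e.

Lemma orbit_small q x d : nrm q < 1 -> 0 < d -> exists N, forall n, (N <= n)%N ->
  nrm (q ^+ n * x) <= d.
Proof.
move=> q1 d0; have q01 : 0 <= nrm q < 1 by rewrite nrm_ge0.
have x0 : 0 < nrm x + 1 by rewrite ltr_wpDl ?nrm_ge0.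
have [N hN] := expr_small q01 (divr_gt0 d0 x0).
exists N => n /hN h; rewrite nrmM nrmX.
apply: le_trans (_ : nrm q ^+ n * (nrm x + 1) <= _).
  by rewrite ler_wpM2l ?exprn_ge0 ?nrm_ge0 // lerDl.
by rewrite -ler_pdivlMr.
Qed.

Lemma near1_Phi q : nrm q < 1 -> near1 (Phi q).
Proof.
move=> q1 e e0; have n0 : nrm (0 : C) < 1 by rewrite nrm0.
have [K K0 hK] := psd_lip ltr01 n0 (psd_Phi q1 ltr01).
exists (Num.min 1 (e / K)) => [|x]; first by rewrite lt_min ltr01 divr_gt0.
rewrite le_min => /andP[x1 xe]; have := hK x x1; rewrite Phi0 // subr0.
by move=> h; apply: le_trans h _; rewrite mulrC -ler_pdivlMr.
Qed.

Lemma near1M F G : near1 F -> near1 G -> near1 (fun x => F x * G x).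
Proof.
move=> hF hG e e0.
pose e' := Num.min 1 (e / 3).
have e'0 : 0 < e' by rewrite lt_min ltr01 divr_gt0.
have [e1 e3] : e' <= 1 /\ e' <= e / 3 by rewrite /e' !ge_min !lexx orbT.
have [d d0 hd] := hF e' e'0; have [d' d'0 hd'] := hG e' e'0.
exists (Num.min d d') => [|x]; first by rewrite lt_min d0.
rewrite le_min => /andP[/hd h /hd' h'].
have -> : F x * G x - 1 = (F x - 1) * (G x - 1) + ((F x - 1) + (G x - 1)) by ring.
apply: le_trans (nrmD _ _) _; have := nrmD (F x - 1) (G x - 1).
have : nrm ((F x - 1) * (G x - 1)) <= 1 * e'.
  by rewrite nrmM ler_pM ?nrm_ge0 //; apply: le_trans e1.
by move: h h' e1 e3; lra.
Qed.

Lemma near1_scale c F : near1 F -> near1 (fun x => F (c * x)).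
Proof.
move=> hF e e0; have [d d0 hd] := hF e e0.
have c0 : 0 < nrm c + 1 by rewrite ltr_wpDl ?nrm_ge0.
exists (d / (nrm c + 1)) => [|x]; first by rewrite divr_gt0.
rewrite ler_pdivlMr // => h; apply: hd; rewrite nrmM mulrC.
by apply: le_trans h; rewrite ler_wpM2l ?nrm_ge0 // lerDl.
Qed.

Lemma near1_sqr F : near1 F -> near1 (fun x => F (- x ^+ 2)).
Proof.
move=> hF e e0; have [d d0 hd] := hF e e0.
exists (Num.min 1 d) => [|x]; first by rewrite lt_min ltr01.
rewrite le_min => /andP[x1 xd]; apply: hd; rewrite nrmN nrmX expr2.
by apply: le_trans xd; rewrite ler_piMr ?nrm_ge0.
Qed.

Lemma near1_uniq q (m F G : C -> C) : nrm q < 1 -> near1 F -> near1 G ->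
  (forall x, F x = m x * F (q * x)) -> (forall x, G x = m x * G (q * x)) ->
  F =1 G.
Proof.
move=> q1 hF hG rF rG x.
have it H n : (forall x, H x = m x * H (q * x)) ->
    H x = \prod_(i < n) m (q ^+ i * x) * H (q ^+ n * x).
  move=> rH; elim: n => [|n IH]; first by rewrite big_ord0 !mul1r.
  rewrite IH big_ord_recr /= -[RHS]mulrA; congr (_ * _).
  by rewrite [LHS]rH exprS mulrA.
have cross n : F x * G (q ^+ n * x) = G x * F (q ^+ n * x).
  by rewrite (it F n rF) (it G n rG); ring.
apply/eqP; rewrite -subr_eq0; apply/eqP/nrm_small => e e0.
pose K := nrm (F x) + nrm (G x) + 1.
have K0 : 0 < K by rewrite ltr_wpDl // addr_ge0 ?nrm_ge0.
have eK : 0 < e / K by rewrite divr_gt0.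
have [d d0 hd] := hF _ eK; have [d' d'0 hd'] := hG _ eK.
have [N hN] := orbit_small x q1 d0; have [N' hN'] := orbit_small x q1 d'0.
pose n := maxn N N'; set z := q ^+ n * x.
have hFz : nrm (F z - 1) <= e / K by apply: hd; apply: hN; apply: leq_maxl.
have hGz : nrm (G z - 1) <= e / K by apply: hd'; apply: hN'; apply: leq_maxr.
have -> : F x - G x = G x * (F z - 1) - F x * (G z - 1).
  have := cross n; rewrite -/z => E.
  have E0 : G x * F z - F x * G z = 0 by rewrite E subrr.
  by rewrite -[LHS]addr0 -E0; ring.
apply: le_trans (nrmB _ _) _; rewrite !nrmM.
apply: le_trans (_ : (nrm (G x) + nrm (F x)) * (e / K) <= _).
  by rewrite mulrDl lerD // ler_wpM2l ?nrm_ge0.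
by rewrite mulrA ler_pdivrMr // mulrC ler_wpM2l ?ltW // /K; lra.
Qed.

Lemma sqr_lt1 q : nrm q < 1 -> nrm (q ^+ 2) < 1.
Proof. by move=> q1; rewrite nrmX exprn_ilt1 ?nrm_ge0. Qed.

(** By iterating the recurrence, Phi q x is a finite product of nonzero factors
    and of a value of Phi close to 1. *)
Lemma Phi_neq0 q x : nrm q < 1 -> (forall n, 1 + q ^+ n * x != 0) -> Phi q x != 0.
Proof.
move=> q1 h.
have e0 : 0 < 2^-1 :> R by rewrite invr_gt0.
have [d d0 hd] := near1_Phi q1 e0.
have [N hN] := orbit_small x q1 d0.
rewrite (Phi_iter x N q1) mulf_neq0 //.
  by apply/prodf_neq0 => i _; apply: h.
apply/eqP => P0; have := hd _ (hN N (leqnn _)).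
by rewrite P0 sub0r nrmN nrm1; lra.
Qed.

Lemma Phi_neq0_small q x : nrm q < 1 -> nrm x < 1 -> Phi q x != 0.
Proof.
move=> q1 x1; apply: Phi_neq0 => // n; apply/eqP => /eqP.
rewrite addrC addr_eq0 => /eqP E.
have : nrm (q ^+ n * x) < 1.
  rewrite nrmM nrmX; apply: le_lt_trans x1.
  by rewrite ler_piMl ?nrm_ge0 // exprn_ile1 ?nrm_ge0 // ltW.
by rewrite E nrmN nrm1 ltxx.
Qed.

Lemma Phi_mulN q x : nrm q < 1 -> Phi q x * Phi q (- x) = Phi (q ^+ 2) (- x ^+ 2).
Proof.
move=> q1; have q2 := sqr_lt1 q1.
have h := near1_Phi q1.
have hN := near1_scale (-1) h.
have hS := near1_sqr (near1_Phi q2).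
have := near1_uniq (m := fun x => 1 - x ^+ 2) q1 (near1M h hN) hS.
move=> /(_ _ _ x); rewrite mulN1r; apply=> {}x.
  rewrite mulN1r [Phi q x](Phi_rec x q1) [Phi q (- x)](Phi_rec _ q1) !mulrN mulN1r.
  by ring.
by rewrite [LHS](Phi_rec _ q2) exprMn mulrN.
Qed.

Lemma Phi_split q x : nrm q < 1 -> Phi q x = Phi (q ^+ 2) x * Phi (q ^+ 2) (q * x).
Proof.
move=> q1; have q2 := sqr_lt1 q1.
have h := near1_Phi q1; have h2 := near1_Phi q2.
apply: (near1_uniq (m := fun x => 1 + x) q1 h (near1M h2 (near1_scale q h2))) => {}x.
  exact: Phi_rec.
rewrite [Phi _ x](Phi_rec x q2) -mulrA; congr (_ * _).
by rewrite mulrC !mulrA -expr2.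
Qed.

(** Euler's identity: the product of the 1 + q^n times the product of the 1 -
    q^(2n-1) is 1. It normalises the half-period functions to the value 1 at z =
    0. *)
Lemma Phi_euler q : nrm q < 1 -> Phi q q * Phi (q ^+ 2) (- q) = 1.
Proof.
move=> q1; have q2 := sqr_lt1 q1.
have n0 : Phi (q ^+ 2) (- q ^+ 2) != 0 by rewrite Phi_neq0_small // nrmN.
apply: (mulIf n0); rewrite mul1r -[RHS](Phi_mulN q q1) [Phi q (- q)](Phi_split _ q1).
by rewrite mulrN -expr2; ring.
Qed.

(** Substituting monomials in q and y for the arguments of Phi: the majorants of
    the coefficients phi m keep the triple family summable. *)
Lemma lau_Phi (s t : C) e f (j : int) : nrm s <= 1 -> (0 < e)%N ->
  lau (fun q y => Phi (s * q ^+ e) (t * q ^+ f * y ^ j)).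
Proof.
move=> s1 e0.
have [a ha] := choice maj_phi.
pose Nx (u : nat * nat) := (e * u.2 + f * u.1)%N.
apply: (@lau_push R _ (fun u : nat * nat => a u.1 u.2 * s ^+ u.2 * t ^+ u.1) Nx
  (fun u => j * u.1%:Z)) => q y q1 y0.
set Q := s * q ^+ e; set x := t * q ^+ f * y ^ j.
have Q1 : nrm Q < 1.
  rewrite nrmM nrmX; apply: le_lt_trans (_ : nrm q ^+ e < 1).
    by rewrite ler_piMl // exprn_ge0 // nrm_ge0.
  by rewrite exprn_ilt1 ?nrm_ge0 // -lt0n.
pose F (u : nat * nat) := a u.1 u.2 * Q ^+ u.2 * x ^+ u.1.
have -> : (fun u => a u.1 u.2 * s ^+ u.2 * t ^+ u.1 *
    (q ^+ Nx u * y ^ (j * u.1%:Z))) = F.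
  apply/funext => u; rewrite /F /Q /x /Nx !exprMn -!exprM -exprz_exp -exprnP.
  by rewrite exprD; ring.
move: @F; clearbody Q x => F.
have Q01 : 0 <= nrm Q < 1 by rewrite nrm_ge0.
have row m : hsum (fun n => F (m, n)) (phi m Q * x ^+ m).
  have := hsumZ (x ^+ m) ((ha m).2 Q Q1); rewrite mulrC; congr hsum.
  by apply/funext => n; rewrite /F /= mulrC.
have sF : summ F.
  apply: (summ_pairs (u := fun m => B m (nrm Q) * nrm x ^+ m)).
    move=> m A; rewrite /F /=.
    have := (ha m).1 _ Q01 A => h.
    apply: le_trans (_ : (\sum_(n <- A) nrm (a m n * (nrm Q)%:C ^+ n)) * nrm x ^+ m <= _).
      rewrite mulr_suml; apply: ler_sum => n _.
      by rewrite !nrmM !nrmX nrm_real ger0_norm ?nrm_ge0 ?lexx.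
    by rewrite ler_wpM2r ?exprn_ge0 ?nrm_ge0 ?h.
  by apply: summ_B => //; apply: nrm_ge0.
have h := tsumP sF; have := hsum_fst h row => h1.
by rewrite (hsum_uniq (hsum_Phi x Q1) h1).
Qed.

End EulerFunction.

(** * Entire quasi-periodic functions *)

Section RealParts.
Variable R : realType.

Lemma ReZ (s : R) (z : R[i]) : complex.Re (s%:C * z) = s * complex.Re z.
Proof. by case: z => x y; simpc. Qed.
Lemma ImZ (s : R) (z : R[i]) : complex.Im (s%:C * z) = s * complex.Im z.
Proof. by case: z => x y; simpc. Qed.
Lemma ReD (z w : R[i]) : complex.Re (z + w) = complex.Re z + complex.Re w.
Proof. by case: z => ? ?; case: w. Qed.
Lemma ImD (z w : R[i]) : complex.Im (z + w) = complex.Im z + complex.Im w.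
Proof. by case: z => ? ?; case: w. Qed.
Lemma ReN (z : R[i]) : complex.Re (- z) = - complex.Re z.
Proof. by case: z. Qed.
Lemma ImN (z : R[i]) : complex.Im (- z) = - complex.Im z.
Proof. by case: z. Qed.
Lemma intC (n : int) : n%:~R = (n%:~R : R)%:C.
Proof. by rewrite rmorph_int. Qed.

End RealParts.

Section LocalContinuity.
Variable R : realType.
Local Notation C := R[i].
Implicit Types (f g : C -> C) (z w : C).

Definition ccont f z0 : Prop := forall e : R, 0 < e ->
  exists2 d : R, 0 < d & forall z, nrm (z - z0) <= d -> nrm (f z - f z0) <= e.

Lemma psd_ccont f z0 (r : R) : 0 < r -> nrm z0 < r -> psd r f -> ccont f z0.
Proof.
move=> r0 zr hf e e0; have [K K0 hK] := psd_lip r0 zr hf.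
exists (Num.min (r - nrm z0) (e / K)).
  by rewrite lt_min subr_gt0 zr divr_gt0.
move=> z; rewrite le_min => /andP[h1 h2].
have zr' : nrm z <= r by have := nrm_subr_le z z0; move: h1; lra.
by apply: le_trans (hK z zr') _; rewrite mulrC -ler_pdivlMr.
Qed.

Lemma ccont_nz f z0 : ccont f z0 -> f z0 != 0 ->
  exists2 d : R, 0 < d & forall z, nrm (z - z0) <= d -> nrm (f z0) / 2 <= nrm (f z).
Proof.
move=> hf f0; have f0' : 0 < nrm (f z0) / 2 by rewrite divr_gt0 // nrm_gt0.
have [d d0 hd] := hf _ f0'; exists d => // z /hd.
by have := nrm_subr_le (f z0) (f z); rewrite nrmBC; lra.
Qed.

Lemma ccont_div f g z0 : ccont f z0 -> ccont g z0 -> g z0 != 0 ->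
  ccont (fun z => f z / g z) z0.
Proof.
move=> hf hg g0 e e0; have [d1 d10 h1] := ccont_nz hg g0.
have G0 : 0 < nrm (g z0) by rewrite nrm_gt0.
pose K := nrm (f z0) + nrm (g z0).
have K0 : 0 < K by rewrite ltr_wpDl ?nrm_ge0.
pose e' := e * (nrm (g z0) ^+ 2 / 2) / K.
have e'0 : 0 < e' by rewrite divr_gt0 // mulr_gt0 // divr_gt0 // exprn_gt0.
have [d2 d20 h2] := hf _ e'0; have [d3 d30 h3] := hg _ e'0.
exists (Num.min d1 (Num.min d2 d3)) => [|z]; first by rewrite !lt_min d10 d20.
rewrite !le_min => /and3P[/h1 hz /h2 hfz /h3 hgz].
have gz : 0 < nrm (g z) by apply: lt_le_trans hz; rewrite divr_gt0.
have gz0 : g z != 0 by rewrite -nrm_gt0.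
have -> : f z / g z - f z0 / g z0 =
    ((f z - f z0) * g z0 - f z0 * (g z - g z0)) / (g z * g z0).
  by field; rewrite gz0 g0.
rewrite nrmM nrmV nrmM ler_pdivrMr ?mulr_gt0 //.
apply: le_trans (nrmB _ _) _; rewrite !nrmM.
apply: le_trans (_ : K * e' <= _).
  rewrite /K mulrDl addrC lerD //; first by rewrite ler_wpM2l ?nrm_ge0.
  by rewrite mulrC ler_wpM2l ?nrm_ge0.
rewrite /e' mulrC divfK ?gt_eqF // ler_wpM2l ?(ltW e0) // expr2 mulrAC.
by rewrite ler_wpM2r ?nrm_ge0.
Qed.

Lemma nrm_dist z w : `|nrm z - nrm w| <= nrm (z - w).
Proof.
rewrite ler_norml; have := nrm_subr_le z w; have := nrm_subr_le w z.
by rewrite (nrmBC w z) => h1 h2; apply/andP; split; lra.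
Qed.

(** Pulled back to real coordinates, the function is continuous on a compact
    square. *)
Lemma evt_par (u v : C) (b : R) (f : C -> R) : 0 <= b ->
  let par z := exists s t : R, [/\ `|s| <= b, `|t| <= b & z = s%:C * u + t%:C * v] in
  (forall z0, par z0 -> forall e : R, 0 < e -> exists2 d : R, 0 < d &
    forall z, nrm (z - z0) <= d -> `|f z - f z0| <= e) ->
  exists2 z0, par z0 & forall z, par z -> f z <= f z0.
Proof.
move=> b0 par hf.
pose A : set (R * R) := `[- b, b]%classic `*` `[- b, b]%classic.
pose pt (p : R * R) : C := p.1%:C * u + p.2%:C * v.
have Apar p : A p -> par (pt p).
  case: p => s t [/=]; rewrite !in_itv /= -!ler_norml => sb tb.
  by exists s, t.
have cA : compact A by apply: compact_setX; apply: segment_compact.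
have A0 : A !=set0.
  by exists (0, 0); split; rewrite /= in_itv /= oppr_le0 b0.
have cf : {within A, continuous (fun p => f (pt p))}.
  apply: continuous_in_subspaceT => -[s t] /set_mem /Apar hp.
  apply/cvgrPdist_le => e e0; have [d d0 hd] := hf _ hp e e0.
  pose K := nrm u + nrm v + 1.
  have K0 : 0 < K by rewrite ltr_wpDl // addr_ge0 ?nrm_ge0.
  apply/(@nbhs_ballP _ (R * R)%type); exists (d / K); first by rewrite /= divr_gt0.
  move=> [s' t'] [/= hs ht]; rewrite distrC; apply: hd.
  have -> : pt (s', t') - pt (s, t) = (s' - s)%:C * u + (t' - t)%:C * v.
    by rewrite /pt !rmorphB /=; ring.
  apply: le_trans (nrmD _ _) _; rewrite !nrmM !nrm_real.
  move: hs ht; rewrite /ball /= (distrC s) (distrC t) => /ltW hs /ltW ht.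
  apply: le_trans (_ : d / K * nrm u + d / K * nrm v <= _).
    by rewrite lerD // ler_wpM2r ?nrm_ge0.
  rewrite -mulrDr mulrAC ler_pdivrMr // ler_wpM2l ?(ltW d0) //.
  by rewrite /K lerDl.
have [[s t] /set_mem st hmax] := compact_EVT_max A0 cA cf.
exists (pt (s, t)); first exact: Apar.
move=> _ [s' [t' [s'b t'b ->]]]; apply: (hmax (s', t')).
by apply/mem_set; split; rewrite /= in_itv /= -ler_norml.
Qed.

(** Two entire functions with the same quasi-periodicity, both divisible by z^2,
    are proportional when the second has no other zero in a period parallelogram:
    their quotient attains its maximum modulus there, hence is constant. *)
Lemma quasi_periodic_prop (tau : upper R) (N D N1 D1 : C -> C)
    (k : int -> int -> C -> C) :
  (forall r, 0 < r -> psd r N1) -> (forall r, 0 < r -> psd r D1) ->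
  (forall z, N z = z ^+ 2 * N1 z) -> (forall z, D z = z ^+ 2 * D1 z) ->
  (forall l m z, N (z + l%:~R * val tau + m%:~R) = k l m z * N z) ->
  (forall l m z, D (z + l%:~R * val tau + m%:~R) = k l m z * D z) ->
  (forall s t : R, `|s| <= 2^-1 -> `|t| <= 2^-1 ->
     D1 (s%:C * val tau + t%:C) != 0) ->
  forall z, N1 z * D1 0 = N1 0 * D1 z.
Proof.
move=> psN psD NE DE qN qD D1n0.
have h0 : 0 <= 2^-1 :> R by [].
pose par z := exists s t : R,
  [/\ `|s| <= 2^-1, `|t| <= 2^-1 & z = s%:C * val tau + t%:C * 1].
have parD z : par z -> D1 z != 0.
  by case=> s [t [hs ht ->]]; rewrite mulr1; apply: D1n0.
have cc F z : (forall r, 0 < r -> psd r F) -> ccont F z.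
  move=> hF; have r0 : 0 < nrm z + 1 by rewrite ltr_wpDl ?nrm_ge0.
  by apply: (psd_ccont r0 _ (hF _ r0)); rewrite ltrDl.
have [|z0 pz0 hmax] := @evt_par (val tau) 1 2^-1 (fun z => nrm (N1 z / D1 z)) h0.
  move=> z pz e e0.
  have [d d0 hd] := ccont_div (cc N1 z psN) (cc D1 z psD) (parD z pz) e0.
  by exists d => // w /hd; apply: le_trans; apply: nrm_dist.
have hmax' z : par z -> nrm (N1 z) * nrm (D1 z0) <= nrm (N1 z0) * nrm (D1 z).
  move=> pz; have := hmax z pz; rewrite !nrmM !nrmV.
  have p1 : 0 < nrm (D1 z) by rewrite nrm_gt0; apply: parD.
  have p2 : 0 < nrm (D1 z0) by rewrite nrm_gt0; apply: parD.
  by rewrite ler_pdivrMr // mulrAC ler_pdivlMr.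
(* Reduction of an arbitrary point to the parallelogram. *)
have red z : exists l m w, par w /\ z = w + l%:~R * val tau + m%:~R.
  have round (x : R) : exists n : int, `|x - n%:~R| <= 2^-1.
    exists (Num.floor (x + 2^-1)); have := floor_le (x + 2^-1).
    by have := floorD1_gt (x + 2^-1); rewrite intrD ler_norml; lra.
  have y0 : 0 < complex.Im (val tau) by apply: (valP tau).
  have [l hl] := round (complex.Im z / complex.Im (val tau)).
  have [m hm] := round (complex.Re (z - l%:~R * val tau)
      - (complex.Im z / complex.Im (val tau) - l%:~R) * complex.Re (val tau)).
  pose s := complex.Im z / complex.Im (val tau) - l%:~R.
  pose t := complex.Re (z - l%:~R * val tau) - s * complex.Re (val tau) - m%:~R.
  exists l, m, (s%:C * val tau + t%:C * 1); split; first by exists s, t.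
  have y0' : complex.Im (val tau) != 0 by rewrite gt_eqF.
  apply/eqP; rewrite eq_complex !mulr1 !intC !(ReD, ImD) !(ReZ, ImZ) /= !addr0.
  rewrite /t /s ReD ReN intC ReZ; apply/andP; split; apply/eqP; field; exact: y0'.
move=> z1.
have glob z : nrm (N z) * nrm (D1 z0) <= nrm (N1 z0) * nrm (D z).
  have [l [m [w [pw ->]]]] := red z; rewrite qN qD !nrmM -mulrA.
  rewrite [leRHS]mulrCA ler_wpM2l ?nrm_ge0 // NE DE !(nrmM (w ^+ 2)) -mulrA.
  rewrite [leRHS]mulrCA ler_wpM2l ?nrm_ge0 //; exact: hmax'.
have par0 : par 0.
  by exists 0, 0; rewrite normr0 !mul0r addr0.
have glob1 z : nrm (N1 z) * nrm (D1 z0) <= nrm (N1 z0) * nrm (D1 z).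
  have [->|zn0] := eqVneq z 0; first exact: hmax'.
  have := glob z; rewrite NE DE !(nrmM (z ^+ 2)) -mulrA [leRHS]mulrCA ler_pM2l //.
  by rewrite nrmX exprn_gt0 // nrm_gt0.
pose r := 2 * (nrm z0 + nrm z1 + 1).
have r0 : 0 < r.
  by rewrite mulr_gt0 // ltr_wpDl // addr_ge0 ?nrm_ge0.
have n0 := nrm_ge0 z0; have n1 := nrm_ge0 z1.
have z0r : nrm z0 < r / 2 by rewrite /r mulrC mulKf ?pnatr_eq0 //; lra.
have mp z : nrm z <= r -> N1 z * D1 z0 = N1 z0 * D1 z.
  apply: (max_principle r0 z0r (psN r r0) (psD r r0) (parD z0 pz0)).
  by exists 1 => // w _; apply: glob1.
have m0 := mp 0; have mz := mp z1.
rewrite nrm0 in m0; have {}m0 := m0 (ltW r0).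
have {}mz : N1 z1 * D1 z0 = N1 z0 * D1 z1 by apply: mz; rewrite /r; lra.
apply: (mulIf (parD z0 pz0)).
rewrite mulrAC mz [RHS]mulrAC m0; ring.
Qed.

End LocalContinuity.

(** * Laurent series in e(z) *)

Section LaurentEntire.
Variable R : realType.
Local Notation C := R[i].

Definition laurent (c : int -> C) (g : C -> C) : Prop :=
  forall y, y != 0 -> hsum (fun r : int => c r * y ^ r) (g y).

(** A convergent Laurent series in e(z) is an entire function of z: expand every
    e(r z) and collect the powers of z. Convergence of the Laurent series on the
    circles of radii exp(2 pi r) and exp(-2 pi r) bounds the double family. *)
Lemma psd_laurent (c : int -> C) (g : C -> C) (r : R) : laurent c g -> 0 < r ->
  psd r (fun z => g (e2pi z)).
Proof.
move=> hc r0.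
(* The moduli of L and M are exp(2 pi r) and its inverse, so that one of L^m
   and M^m bounds e(m z) for |z| <= r, whatever the sign of m. *)
have [L [M [L0 M0 LE Labs]]] : exists L M : C, [/\ L != 0, M != 0,
    nrm L = expR (nrm (tpi R) * r) &
    forall m : int, nrm L ^+ `|m|%N <= nrm (L ^ m) + nrm (M ^ m)].
  have L0 : (expR (nrm (tpi R) * r))%:C != 0 :> C by rewrite realC_neq0 // expR_gt0.
  exists (expR (nrm (tpi R) * r))%:C, (expR (nrm (tpi R) * r))%:C^-1.
  split; rewrite ?invr_eq0 ?nrm_real ?ger0_norm ?expR_ge0 //.
  move=> [] n; rewrite ?NegzE ?abszN absz_nat.
    by rewrite -exprnP nrmX nrm_real ger0_norm ?expR_ge0 // lerDl nrm_ge0.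
  rewrite exprz_inv opprK -exprnP [nrm (_ ^+ _)]nrmX nrm_real.
  by rewrite ger0_norm ?expR_ge0 // lerDr nrm_ge0.
pose co (u : int * nat) : C :=
  c u.1 * ((tpi R * u.1%:~R) ^+ u.2 / (u.2)`!%:R).
have coE z u : co u * z ^+ u.2 =
    c u.1 * ((tpi R * u.1%:~R * z) ^+ u.2 / (u.2)`!%:R).
  by rewrite /co [(_ * z) ^+ _]exprMn; ring.
have rowsum z m : hsum (fun n => co (m, n) * z ^+ n) (c m * e2pi z ^ m).
  have -> : c m * e2pi z ^ m = c m * expC (tpi R * m%:~R * z).
    by rewrite -e2piMz e2piE; congr (_ * expC _); ring.
  have := hsumZ (c m) (hsum_expC (tpi R * m%:~R * z)).
  by congr hsum; apply/funext => n; rewrite (coE z (m, n)).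
have sco (z : C) : nrm z <= r -> summ (fun u => co u * z ^+ u.2).
  move=> zr.
  apply: (summ_pairs (u := fun m => nrm (c m) * nrm L ^+ `|m|%N)).
    move=> m A; under eq_bigr do rewrite (coE z (m, _)) nrmM /=.
    rewrite -mulr_sumr ler_wpM2l ?nrm_ge0 //.
    apply: le_trans (absum_ec _ A) _.
    rewrite LE -expRM_natl ler_expR.
    rewrite !nrmM mulrAC mulrC intC nrm_real -intr_norm -natr_absz.
    by rewrite ler_wpM2l ?ler0n // ler_wpM2l // !mulr_ge0 ?nrm_ge0.
  have h1 := hsum_summ (hc L L0).
  have h2 := hsum_summ (hc M M0).
  have abs (u : int -> C) : summ u -> summ (fun m => (nrm (u m))%:C).
    by move=> su; apply: summ_dom su => i; rewrite nrm_real ger0_norm ?nrm_ge0.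
  apply: summ_dom (summD (abs _ h1) (abs _ h2)) => i.
  rewrite -rmorphD [leRHS]nrm_real [leLHS]nrm_real.
  rewrite [leLHS]ger0_norm; last by rewrite mulr_ge0 ?exprn_ge0 ?nrm_ge0.
  rewrite [leRHS]ger0_norm; last by rewrite addr_ge0 ?nrm_ge0.
  rewrite [nrm (c i * L ^ i)]nrmM [nrm (c i * M ^ i)]nrmM -mulrDr.
  by rewrite ler_wpM2l ?nrm_ge0.
apply: (@ps_push R _ co snd) => //.
  by apply: sco; rewrite nrm_real gtr0_norm.
move=> z zr; have h := tsumP (sco z zr).
have := hsum_fst h (rowsum z) => h1.
by rewrite (hsum_uniq (hc _ (e2pi_neq0 z)) h1).
Qed.

End LaurentEntire.

(** * The form A of weight -2 and index 1 *)

Section FunctionA.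
Variable R : realType.
Local Notation C := R[i].
Implicit Types (q y z tau : C).

(** In terms of theta functions, A = - theta_1(z)^2 up to a power of q and a
    power of the product of the 1 - q^n. Dividing by the fourth power of vq gives
    the weak Jacobi form of weight -2 and index 1. *)
Definition Aq q y : C := (y - 2 + y^-1) * Phi q (- (q * y)) ^+ 2 * Phi q (- (q / y)) ^+ 2.

Lemma lau_Phi1 (t : C) (f : nat) (j : int) :
  lau (fun q y => Phi q (t * q ^+ f * y ^ j)).
Proof.
have n1 : nrm (1 : C) <= 1 by rewrite nrm1.
by apply: lau_eq (lau_Phi t f j n1 (ltn0Sn 0)) => q y _ _; rewrite mul1r expr1.
Qed.

Lemma lau_Aq : lau Aq.
Proof.
apply: lauM; first apply: lauM; first apply: lauD.
- by apply: lauB; [apply: lau_y 1|apply: lau_cst].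
- exact: lau_y (-1).
- apply: lauX; apply: lau_eq (lau_Phi1 (-1) 1 1) => q y _ _.
  by rewrite expr1 expr1z mulN1r mulNr.
- apply: lauX; apply: lau_eq (lau_Phi1 (-1) 1 (-1)) => q y _ _.
  by rewrite expr1 exprN1 mulN1r mulNr.
Qed.

Lemma Aq_inv q y : Aq q y^-1 = Aq q y.
Proof. by rewrite /Aq invrK; ring. Qed.

Lemma Aq_shift q y : nrm q < 1 -> q != 0 -> y != 0 ->
  Aq q (q * y) = (q * y ^+ 2)^-1 * Aq q y.
Proof.
move=> q1 q0 y0; rewrite /Aq.
have E1 := Phi_rec (- (q * y)) q1; rewrite mulrN in E1.
have E3 : q / (q * y) = y^-1 by field; rewrite y0 q0.
have E2 := Phi_rec (- y^-1) q1; rewrite mulrN in E2.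
rewrite E3 E2 E1.
move: (Phi q (- (q * (q * y)))) (Phi q (- (q / y))) => P Q.
by field; rewrite y0 q0.
Qed.

Lemma Aq1 q : Aq q 1 = 0.
Proof. by rewrite /Aq invr1 (_ : 1 - 2 + 1 = 0) ?mul0r //; ring. Qed.

(** Each factor of the product is nonzero in the annulus |q| < |y| < |q|^-1,
    except for y - 2 + y^-1 at y = 1. *)
Lemma Aq_neq0 q y : nrm q < 1 -> y != 0 -> y != 1 -> nrm (q * y) < 1 ->
  nrm (q / y) < 1 -> Aq q y != 0.
Proof.
move=> q1 y0 y1 h1 h2; rewrite /Aq !mulf_neq0 ?expf_neq0 ?Phi_neq0_small ?nrmN //.
have -> : y - 2 + y^-1 = (y - 1) ^+ 2 / y by field.
by rewrite mulf_neq0 ?invr_eq0 // expf_neq0 // subr_eq0.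
Qed.

Definition AT tau z : C := Aq (e2pi tau) (e2pi z).

Lemma AT_shift1 tau z : in_upper tau ->
  AT tau (z + tau) = e2pi (- (tau + 2 * z)) * AT tau z.
Proof.
move=> t0; rewrite /AT e2piD mulrC Aq_shift ?e2pi_neq0 ?e2pi_upper //.
by rewrite e2piN e2piD e2piMn mulrC.
Qed.

Lemma AT_elliptic tau z (l m : int) : in_upper tau ->
  AT tau (z + l%:~R * tau + m%:~R) =
  e2pi (- (l%:~R ^+ 2 * tau + 2 * l%:~R * z)) * AT tau z.
Proof.
move=> t0.
have -> : AT tau (z + l%:~R * tau + m%:~R) = AT tau (z + l%:~R * tau).
  by rewrite /AT e2piD e2pi_int mulr1.
elim: l z => [|l IH|l IH] z.
- by rewrite expr0n /= mul0r addr0 mulr0 mul0r addr0 oppr0 e2pi0 mul1r.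
- have -> : z + l.+1%:~R * tau = (z + l%:~R * tau) + tau.
    by rewrite intS intrD; ring.
  rewrite AT_shift1 // IH mulrA -e2piD; congr (e2pi _ * _).
  by rewrite intS intrD; ring.
have lS : (- l.+1%:Z)%:~R = (- l%:Z)%:~R - 1 :> C.
  by rewrite intS opprD addrC intrB.
have := AT_shift1 (z + (- l.+1%:Z)%:~R * tau) t0.
have -> : z + (- l.+1%:Z)%:~R * tau + tau = z + (- l%:Z)%:~R * tau.
  by rewrite lS; ring.
rewrite IH => E.
apply: (mulfI (e2pi_neq0 (- (tau + 2 * (z + (- l.+1%:Z)%:~R * tau))))).
rewrite -E [RHS]mulrA -e2piD; congr (e2pi _ * _).
by rewrite lS; ring.
Qed.

(** The quotient of AT by z^2, an entire function which does not vanish at 0. *)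
Definition AT1 tau z : C := e2pi (- z) * e2pi_quot z ^+ 2 *
  Phi (e2pi tau) (- (e2pi tau * e2pi z)) ^+ 2 *
  Phi (e2pi tau) (- (e2pi tau / e2pi z)) ^+ 2.

Lemma AT1E tau z : AT tau z = z ^+ 2 * AT1 tau z.
Proof.
have -> : z ^+ 2 * AT1 tau z = e2pi (- z) * (z * e2pi_quot z) ^+ 2 *
  Phi (e2pi tau) (- (e2pi tau * e2pi z)) ^+ 2 *
  Phi (e2pi tau) (- (e2pi tau / e2pi z)) ^+ 2 by rewrite /AT1; ring.
rewrite -e2pi_quotE e2piN /AT /Aq; congr (_ * _ * _).
by field; apply: e2pi_neq0.
Qed.

(** The product of the 1 - q^n over n >= 1. *)
Definition vq q : C := Phi q (- q).

Lemma vq_neq0 q : nrm q < 1 -> vq q != 0.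
Proof. by move=> q1; rewrite Phi_neq0_small ?nrmN. Qed.

Lemma AT1_0 tau : AT1 tau 0 = tpi R ^+ 2 * vq (e2pi tau) ^+ 4.
Proof.
rewrite /AT1 /e2pi_quot eqxx oppr0 e2pi0 divr1 !mulr1 mul1r -mulrA -exprD.
by [].
Qed.

Lemma laurent_Phi q (c : C) : nrm q < 1 ->
  laurent (fun r => if r is Posz n then phi n q * c ^+ n else 0)
          (fun y => Phi q (c * y)).
Proof.
move=> q1 y y0; set u := (fun r => _ * y ^ r).
apply/(@hsum_inj _ _ _ Posz u) => [m n [] //||].
  by move=> [n|n] h; rewrite /u ?mul0r //; have := h n; rewrite eqxx.
have -> : u \o Posz = (fun n => phi n q * (c * y) ^+ n).
  by apply/funext => n; rewrite /u /= exprMn mulrA.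
exact: hsum_Phi.
Qed.

Lemma psd_AT1 tau (r : R) : in_upper tau -> 0 < r -> psd r (AT1 tau).
Proof.
move=> /e2pi_upper q1 r0; apply: psdM => //; first apply: psdM => //.
- apply: psdM => //; last by apply: psdX => //; apply: psd_e2pi_quot.
  by apply: psd_eq (psd_e2pi (-1) r0) => z _; rewrite mulN1r.
- apply: psdX => //; apply: psd_eq (psd_laurent (laurent_Phi (- e2pi tau) q1) r0) => z _.
  by rewrite mulNr.
- apply: psdX => //.
  have r1 : 0 < r * nrm (-1 : C) + 1 by rewrite ltr_wpDl // mulr_ge0 ?nrm_ge0 // ltW.
  have h := psd_scale r0 (psd_laurent (laurent_Phi (- e2pi tau) q1) r1).
  by apply: psd_eq h => z _; rewrite mulN1r e2piN mulNr.
Qed.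

Lemma e2pi_par_lt tau (s t : R) : in_upper tau -> `|s| <= 2^-1 ->
  nrm (e2pi tau * e2pi (s%:C * tau + t%:C)) < 1 /\
  nrm (e2pi tau / e2pi (s%:C * tau + t%:C)) < 1.
Proof.
move=> t0; rewrite ler_norml => /andP[s1 s2]; rewrite -e2piD -e2piB.
have y0 : 0 < complex.Im tau := t0.
split; apply: e2pi_upper; rewrite /in_upper !(ImD, ImN) ImZ /= addr0.
  have -> : complex.Im tau + s * complex.Im tau = (1 + s) * complex.Im tau by ring.
  by rewrite mulr_gt0 //; move: s1; lra.
have -> : complex.Im tau - s * complex.Im tau = (1 - s) * complex.Im tau by ring.
by rewrite mulr_gt0 //; move: s2; lra.
Qed.

(** Comparing moduli gives s = 0; then t is an integer of absolute value at most
    1/2. *)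
Lemma e2pi_par_eq1 tau (s t : R) : in_upper tau -> `|t| <= 2^-1 ->
  e2pi (s%:C * tau + t%:C) = 1 -> s = 0 /\ t = 0.
Proof.
move=> t0 t2 E; have y0 : 0 < complex.Im tau := t0.
have s0 : s = 0.
  have h : expR (- (2 * pi * complex.Im (s%:C * tau + t%:C))) = expR (0 : R).
    by rewrite -nrm_e2pi E nrm1 expR0.
  move/expR_inj/eqP: h; rewrite ImD ImZ /= addr0 oppr_eq0 mulf_eq0.
  have p2 : 2 * pi != 0 :> R by rewrite mulf_neq0 // gt_eqF // pi_gt0.
  by rewrite (negbTE p2) mulf_eq0 (gt_eqF y0) orbF => /eqP.
split=> //; apply: e2pi_real_eq1 => //.
by move: E; rewrite s0 mul0r add0r.
Qed.

Lemma AT1_neq0 tau (s t : R) : in_upper tau -> `|s| <= 2^-1 -> `|t| <= 2^-1 ->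
  AT1 tau (s%:C * tau + t%:C) != 0.
Proof.
move=> t0 s2 t2; have q1 := e2pi_upper t0.
have [h1 h2] := e2pi_par_lt t t0 s2.
have E0 : e2pi_quot (s%:C * tau + t%:C) != 0.
  rewrite /e2pi_quot; have [_|z0] := eqVneq (s%:C * tau + t%:C) 0.
    exact: tpi_neq0.
  rewrite mulf_neq0 ?invr_eq0 // subr_eq0; apply: contraNneq z0.
  by move=> /(e2pi_par_eq1 t0 t2)[-> ->]; rewrite mul0r addr0.
rewrite /AT1; apply: mulf_neq0; first apply: mulf_neq0; first apply: mulf_neq0.
- exact: e2pi_neq0.
- exact: expf_neq0.
- by apply/expf_neq0/Phi_neq0_small; rewrite ?nrmN.
- by apply/expf_neq0/Phi_neq0_small; rewrite ?nrmN.
Qed.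

Lemma cocycle_neq0 (a b c e : int) (det1 : a * e - b * c = 1) tau : in_upper tau ->
  c%:~R * tau + e%:~R != 0.
Proof.
move=> t0; apply/eqP => j0.
have : complex.Im (c%:~R * tau + e%:~R) = 0 by rewrite j0.
rewrite ImD !intC ImZ /= addr0 => /eqP; rewrite mulf_eq0 (gt_eqF t0) orbF intr_eq0.
move=> /eqP c0; move: j0 det1; rewrite c0 mul0r add0r => /eqP; rewrite intr_eq0.
by move/eqP => ->; rewrite !mulr0.
Qed.

Definition AN tau z : C := AT tau z / vq (e2pi tau) ^+ 4.

(** A has weight -2 and index 1. As functions of z, the form A at tau and the
    transformed one are quasi-periodic with the same factors and vanish doubly at
    0, and the former has no zero off the lattice; so they are proportional, and
    the constant is read off at z = 0. *)
Lemma AN_modular (a b c e : int) (det1 : a * e - b * c = 1) (tau : upper R) z :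
  let j := c%:~R * val tau + e%:~R in
  AN (val (SL2_act det1 tau)) (z / j) =
  j ^- 2 * e2pi (c%:~R * z ^+ 2 / j) * AN (val tau) z.
Proof.
move=> j; pose t := val tau; pose s := val (SL2_act det1 tau).
have t0 : in_upper t by apply: (valP tau).
have s0 : in_upper s by apply: (valP (SL2_act det1 tau)).
have j0 : j != 0 by apply: (cocycle_neq0 det1).
have sE : s = (a%:~R * t + b%:~R) / j by [].
pose N w := e2pi (- (c%:~R * w ^+ 2 / j)) * AT s (w / j).
pose N1 w := e2pi (- (c%:~R / j) * w ^+ 2) * (j ^- 2 * AT1 s (j^-1 * w)).
have jE : j = c%:~R * t + e%:~R by [].
have detR : (a%:~R * e%:~R - b%:~R * c%:~R = 1 :> C).
  by rewrite -!intrM -intrB det1.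
have key w : N1 w * AT1 t 0 = N1 0 * AT1 t w.
  apply: (@quasi_periodic_prop _ tau N (AT t) N1 (AT1 t)
    (fun l m w => e2pi (- (l%:~R ^+ 2 * t + 2 * l%:~R * w)))).
  - move=> r r0; apply: psdM => //.
      apply: (@psd_sqr R r (fun x => e2pi (- (c%:~R / j) * x)) r0).
      by apply: psd_e2pi; rewrite exprn_gt0.
    apply: psdZ => //; apply: psd_scale => //; apply: psd_AT1 => //.
    by rewrite ltr_wpDl // mulr_ge0 ?nrm_ge0 // ltW.
  - by move=> r r0; apply: psd_AT1.
  - move=> w'; rewrite /N /N1 AT1E [w' / j]mulrC mulrA.
    rewrite (_ : - (c%:~R * w' ^+ 2 / j) = - (c%:~R / j) * w' ^+ 2); last by ring.
    by rewrite exprMn exprVn; ring.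
  - by move=> w'; apply: AT1E.
  - move=> l m w'.
    (* The period l t + m, divided by j, is the period l' s + m'. *)
    pose l' := l * e - m * c; pose m' := m * a - l * b.
    have lE : (l%:~R : C) = l'%:~R * a%:~R + m'%:~R * c%:~R.
      transitivity (l%:~R * (a%:~R * e%:~R - b%:~R * c%:~R) : C).
        by rewrite detR mulr1.
      by rewrite /l' /m' !intrB !intrM; ring.
    have mE : (m%:~R : C) = l'%:~R * b%:~R + m'%:~R * e%:~R.
      transitivity (m%:~R * (a%:~R * e%:~R - b%:~R * c%:~R) : C).
        by rewrite detR mulr1.
      by rewrite /l' /m' !intrB !intrM; ring.
    have -> : N (w' + l%:~R * t + m%:~R) =
        e2pi (- (c%:~R * (w' + l%:~R * t + m%:~R) ^+ 2 / j)) *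
        AT s (w' / j + l'%:~R * s + m'%:~R).
      rewrite /N; congr (_ * AT s _); rewrite sE lE mE jE; field; rewrite -jE j0; exact: isT.
    rewrite (AT_elliptic (w' / j) l' m' s0) /N [LHS]mulrA [RHS]mulrA -!e2piD.
    (* The two exponents differ by the integer K. *)
    pose K := - (l' ^+ 2 * a * b + 2 * l' * m' * b * c + m' ^+ 2 * c * e).
    congr (_ * _); rewrite -[RHS]mulr1 -[X in _ = _ * X](e2pi_int R K) -e2piD; congr e2pi.
    have KE : K%:~R = - (l'%:~R ^+ 2 * a%:~R * b%:~R
        + 2 * l'%:~R * m'%:~R * b%:~R * c%:~R
        + m'%:~R ^+ 2 * c%:~R * e%:~R) :> C.
      by rewrite /K !(intrN, intrD, intrM, rmorphXn).
    apply/eqP; rewrite -subr_eq0; apply/eqP; rewrite sE.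
    (* What remains is a multiple of the determinant relation. *)
    transitivity ((l'%:~R ^+ 2 * (a%:~R * t + b%:~R) + 2 * w' * l'%:~R) *
      (a%:~R * e%:~R - b%:~R * c%:~R - 1) / j); last by rewrite detR subrr mulr0 mul0r.
    rewrite KE lE mE jE; field; rewrite -jE j0; exact: isT.
  - by move=> l m w'; apply: AT_elliptic.
  - by move=> u v hu hv; apply: AT1_neq0.
have := key z; rewrite {2}/N1 !mulr0 expr0n mulr0 e2pi0 mul1r !AT1_0.
have v0 : vq (e2pi t) != 0 by apply/vq_neq0/e2pi_upper.
have v0' : vq (e2pi s) != 0 by apply/vq_neq0/e2pi_upper.
have p0 := tpi_neq0 R.
have Ne : AT s (z / j) = e2pi (c%:~R * z ^+ 2 / j) * (z ^+ 2 * N1 z).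
  have ee : e2pi (c%:~R * z ^+ 2 / j) * e2pi (- (c%:~R / j) * z ^+ 2) = 1.
    by rewrite -e2piD -[RHS](e2pi0 R); congr e2pi; ring.
  transitivity (e2pi (c%:~R * z ^+ 2 / j) * e2pi (- (c%:~R / j) * z ^+ 2) *
    (z ^+ 2 * (j ^- 2 * AT1 s (j^-1 * z)))); last by rewrite /N1; ring.
  by rewrite ee mul1r AT1E [z / j]mulrC exprMn exprVn; ring.
move=> E; rewrite /AN -/t -/s Ne AT1E.
have -> : N1 z = j ^- 2 * vq (e2pi s) ^+ 4 / vq (e2pi t) ^+ 4 * AT1 t z.
  apply: (mulIf (mulf_neq0 (expf_neq0 2 p0) (expf_neq0 4 v0))); rewrite E.
  by field; rewrite v0 j0.
by field; rewrite v0 v0' j0.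
Qed.

End FunctionA.

(** * The three half-period functions *)

Section HalfPeriods.
Variable R : realType.
Local Notation C := R[i].
Implicit Types (p q y z tau : C) (l m : int).

Definition half_period l m tau : C := (l%:~R * tau + m%:~R) / 2.

(** The translate of A by a half period, made quasi-periodic with the factors of
    A by the exponential in front, and normalised to the value 1 at z = 0. For
    (l, m) = (0,1), (1,0), (1,1) these are the squares of the quotients
    theta_i(z)/theta_i(0), i = 2, 4, 3. *)
Definition XT l m tau z : C :=
  e2pi (l%:~R * z) * AT tau (z + half_period l m tau) / AT tau (half_period l m tau).

Lemma XT_addl l m tau z : in_upper tau -> XT (l + 2) m tau z = XT l m tau z.
Proof.
move=> t0; have hE : half_period (l + 2) m tau = half_period l m tau + 1%:~R * tau + 0%:~R.
  by rewrite /half_period intrD; field.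
have sh w := AT_elliptic w 1 0 t0.
rewrite /XT hE.
have -> : z + (half_period l m tau + 1%:~R * tau + 0%:~R) =
  (z + half_period l m tau) + 1%:~R * tau + 0%:~R by ring.
have -> : e2pi ((l + 2)%:~R * z) = e2pi (l%:~R * z) * e2pi (2%:~R * z).
  by rewrite -e2piD -mulrDl -intrD.
rewrite !sh.
have e0 := e2pi_neq0.
have -> : e2pi (- (1%:~R ^+ 2 * tau + 2 * 1%:~R * (z + half_period l m tau))) =
   e2pi (- (1%:~R ^+ 2 * tau + 2 * 1%:~R * half_period l m tau)) / e2pi (2%:~R * z).
  by rewrite -e2piB; congr e2pi; ring.
have [A0|A0] := eqVneq (AT tau (half_period l m tau)) 0; first by rewrite A0 mulr0 invr0 !mulr0.
by field; rewrite A0 !e0.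
Qed.

Lemma XT_addr l m tau z : XT l (m + 2) tau z = XT l m tau z.
Proof.
have hE : half_period l (m + 2) tau = half_period l m tau + 1.
  by rewrite /half_period intrD; field.
by rewrite /XT hE addrA /AT !e2piD e2pi1 !mulr1.
Qed.

Lemma periodic2 (f : int -> C) : (forall i, f (i + 2) = f i) ->
  forall i, f i = f (i %% 2)%Z.
Proof.
move=> f2; have fM (n : nat) i : f (i + n%:Z * 2) = f i.
  elim: n i => [|n IH] i; first by rewrite mul0r addr0.
  have -> : i + n.+1%:Z * 2 = (i + n%:Z * 2) + 2 by rewrite intS; ring.
  by rewrite f2 IH.
move=> i; rewrite {1}(divz_eq i 2) addrC; case: (i %/ 2)%Z => n; first exact: fM.
rewrite -(fM n.+1) NegzE; congr f; ring.
Qed.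

(** Translating a half period by a period multiplies the two values of A by
    exponentials whose quotient compensates the change of the factor in front. *)
Lemma XT_parity l m tau z : in_upper tau ->
  XT l m tau z = XT (l %% 2)%Z (m %% 2)%Z tau z.
Proof.
move=> t0; rewrite (periodic2 (f := fun i => XT i m tau z)); last first.
  by move=> i; apply: XT_addl.
by rewrite (periodic2 (f := fun i => XT (l %% 2)%Z i tau z)) // => i; apply: XT_addr.
Qed.

(** The modular group permutes the half periods, and the weight of A cancels in
    the quotient. *)
Lemma XT_modular (a b c e : int) (det1 : a * e - b * c = 1) (tau : upper R) l m z :
  let j := c%:~R * val tau + e%:~R in
  XT l m (val (SL2_act det1 tau)) (z / j) =
  e2pi (c%:~R * z ^+ 2 / j) * XT (l * a + m * c) (l * b + m * e) (val tau) z.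
Proof.
move=> j; pose t := val tau; pose s := val (SL2_act det1 tau).
have t0 : in_upper t by apply: (valP tau).
have s0 : in_upper s by apply: (valP (SL2_act det1 tau)).
have j0 : j != 0 by apply: (cocycle_neq0 det1).
have sE : s = (a%:~R * t + b%:~R) / j by [].
have jE : j = c%:~R * t + e%:~R by [].
have detR : (a%:~R * e%:~R - b%:~R * c%:~R = 1 :> C).
  by rewrite -!intrM -intrB det1.
pose W := half_period (l * a + m * c) (l * b + m * e) t.
have WE : half_period l m s = W / j.
  rewrite /half_period /W /half_period sE jE !(intrD, intrM); field.
  by rewrite -jE j0.
have v0 : vq (e2pi t) != 0 by apply/vq_neq0/e2pi_upper.
have v0' : vq (e2pi s) != 0 by apply/vq_neq0/e2pi_upper.
have AE w : AT s (w / j) = vq (e2pi s) ^+ 4 / vq (e2pi t) ^+ 4 * j ^- 2 *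
    e2pi (c%:~R * w ^+ 2 / j) * AT t w.
  have := AN_modular det1 tau w; rewrite /AN -/t -/s -/j => h.
  have -> : AT s (w / j) = vq (e2pi s) ^+ 4 * (AT s (w / j) / vq (e2pi s) ^+ 4).
    by field.
  by rewrite h; field; rewrite v0 j0.
rewrite /XT -/t -/s WE -/W -mulrDl !AE.
have -> : e2pi (c%:~R * (z + W) ^+ 2 / j) = e2pi (c%:~R * z ^+ 2 / j) *
    e2pi (c%:~R * W ^+ 2 / j) * e2pi ((l * a + m * c)%:~R * z) / e2pi (l%:~R * (z / j)).
  rewrite -!e2piD -e2piB; congr e2pi; apply/eqP; rewrite -subr_eq0; apply/eqP.
  transitivity (- l%:~R * z * (a%:~R * e%:~R - b%:~R * c%:~R - 1) / j); last first.
    by rewrite detR subrr mulr0 mul0r.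
  rewrite /W /half_period jE !(intrD, intrM); field.
  by rewrite -jE j0.
have e0 := e2pi_neq0.
have [A0|A0] := eqVneq (AT t W) 0; first by rewrite A0 !(mulr0, invr0).
by field; rewrite A0 !e0 v0 v0' j0.
Qed.

Lemma XT_elliptic l m tau z (u v : int) : in_upper tau ->
  XT l m tau (z + u%:~R * tau + v%:~R) =
  e2pi (- (u%:~R ^+ 2 * tau + 2 * u%:~R * z)) * XT l m tau z.
Proof.
move=> t0; rewrite /XT.
have -> : z + u%:~R * tau + v%:~R + half_period l m tau =
  (z + half_period l m tau) + u%:~R * tau + v%:~R by ring.
rewrite AT_elliptic //.
have -> : e2pi (l%:~R * (z + u%:~R * tau + v%:~R)) *
   (e2pi (- (u%:~R ^+ 2 * tau + 2 * u%:~R * (z + half_period l m tau))) *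
     AT tau (z + half_period l m tau)) =
   e2pi (l%:~R * (z + u%:~R * tau + v%:~R)
     - (u%:~R ^+ 2 * tau + 2 * u%:~R * (z + half_period l m tau))) *
     AT tau (z + half_period l m tau) by rewrite mulrA -e2piD.
rewrite [RHS]mulrA [X in _ = X / _]mulrA -e2piD; congr (_ * _ / _).
rewrite -[RHS]mulr1 -[X in _ = _ * X](e2pi_int R (l * v - u * m)) -e2piD.
by congr e2pi; rewrite /half_period intrB !intrM; field.
Qed.

Lemma e2pi_halfE tau : e2pi (tau / 2) ^+ 2 = e2pi tau.
Proof. by rewrite -e2piMn mulrC divfK ?pnatr_eq0. Qed.

Definition x01 q y : C :=
  (y + 2 + y^-1) / 4 * Phi q (q * y) ^+ 2 * Phi q (q / y) ^+ 2 *
  Phi (q ^+ 2) (- q) ^+ 4.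

Definition x10 p y : C :=
  Phi (p ^+ 2) (- (p * y)) ^+ 2 * Phi (p ^+ 2) (- (p / y)) ^+ 2 * Phi p p ^+ 4.

Lemma Phi_pp_inv p : nrm p < 1 -> Phi (p ^+ 2) (- p) = (Phi p p)^-1 /\ Phi p p != 0.
Proof.
move=> p1; have E := Phi_euler p1.
have h : Phi p p != 0.
  by apply: contra_eq_neq E => ->; rewrite mul0r eq_sym oner_eq0.
by split=> //; apply: (mulfI h); rewrite E mulfV.
Qed.

(** The product expansions of the half-period functions; for odd l they are
    series in p = q^(1/2), and p -> - p exchanges the last two. *)
Lemma XT01 tau z : in_upper tau -> XT 0 1 tau z = x01 (e2pi tau) (e2pi z).
Proof.
move=> t0; have q1 := e2pi_upper t0.
have hE : half_period 0 1 tau = 2^-1 by rewrite /half_period mul0r add0r mul1r.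
rewrite /XT hE mul0r e2pi0 mul1r /AT e2piD e2pi_half.
move: (e2pi tau) (e2pi z) q1 (e2pi_neq0 z) => q y q1 y0.
have [Ei P0] := Phi_pp_inv q1.
rewrite /Aq /x01 Ei !(mulrN1, invrN, invr1, mulrN, opprK, mulr1).
move: (Phi q (q * y)) (Phi q (q / y)) => P Q.
by field; rewrite y0 P0.
Qed.

Lemma XT1 m tau z : in_upper tau ->
  XT 1 m tau z = x10 (e2pi (half_period 1 m tau)) (e2pi z).
Proof.
move=> t0; pose p := e2pi (half_period 1 m tau).
have hq : e2pi tau = p ^+ 2.
  rewrite /p -e2piMn /half_period mulrC divfK ?pnatr_eq0 // e2piD e2pi_int mulr1 mul1r.
  by [].
have q1 := e2pi_upper t0.
have p1 : nrm p < 1 by rewrite -(@expr_lt1 _ 2) ?nrm_ge0 // -nrmX -hq.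
rewrite /XT mul1r /AT e2piD -/p hq.
have p0 : p != 0 by apply: e2pi_neq0.
move: (e2pi z) (e2pi_neq0 z) => y y0.
have p21 : nrm (p ^+ 2) < 1 by rewrite -hq.
have [Ei P0] := Phi_pp_inv p1.
have Ap w : w != 0 -> Aq (p ^+ 2) (w * p) =
    (w * p)^-1 * Phi (p ^+ 2) (- (p * w)) ^+ 2 * Phi (p ^+ 2) (- (p / w)) ^+ 2.
  move=> w0; rewrite /Aq.
  have -> : p ^+ 2 / (w * p) = p / w by field; rewrite w0 p0.
  have := Phi_rec (- (p * w)) p21.
  have -> : p ^+ 2 * - (p * w) = - (p ^+ 2 * (w * p)) by ring.
  move=> ->; move: (Phi _ (- (p ^+ 2 * (w * p)))) (Phi _ (- (p / w))) => P Q.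
  by field; rewrite w0 p0.
have := Ap 1 (oner_neq0 _); rewrite mul1r mulr1 divr1 => ->.
rewrite Ap // Ei /x10.
move: (Phi _ (- (p * y))) (Phi _ (- (p / y))) => P Q.
by field; rewrite P0 y0 p0.
Qed.

Lemma XT10 tau z : in_upper tau ->
  XT 1 0 tau z = x10 (e2pi (tau / 2)) (e2pi z).
Proof. by move=> t0; rewrite XT1 // /half_period mul1r addr0. Qed.

Lemma XT11 tau z : in_upper tau ->
  XT 1 1 tau z = x10 (- e2pi (tau / 2)) (e2pi z).
Proof.
by move=> t0; rewrite XT1 // /half_period mul1r mulrDl mul1r e2piD e2pi_half mulrN1.
Qed.

Lemma lau_PhiS (s t : C) e f (j : int) : nrm s <= 1 -> (0 < e)%N ->
  forall G : C -> C -> C,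
  (forall q y, nrm q < 1 -> y != 0 ->
    Phi (s * q ^+ e) (t * q ^+ f * y ^ j) = G q y) -> lau G.
Proof. by move=> s1 e0 G h; apply: lau_eq (lau_Phi t f j s1 e0). Qed.

Lemma lau_x01_sqr : lau (fun p y => x01 (p ^+ 2) y).
Proof.
have n1 : nrm (1 : C) <= 1 by rewrite nrm1.
apply: lauM; first apply: lauM; first apply: lauM.
- apply: lauM; last exact: lau_cst.
  apply: lauD; last exact: lau_y (-1).
  by apply: lauD; [apply: lau_y 1|apply: lau_cst].
- apply: lauX; apply: (@lau_PhiS 1 1 2 2 1 n1) => // q y _ _.
  by rewrite !mul1r expr1z.
- apply: lauX; apply: (@lau_PhiS 1 1 2 2 (-1) n1) => // q y _ _.
  by rewrite !mul1r exprN1.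
- apply: lauX; apply: (@lau_PhiS 1 (-1) 4 2 0 n1) => // q y _ _.
  by rewrite !mul1r expr0z mulr1 mulN1r -exprM.
Qed.

Lemma lau_x10 : lau x10.
Proof.
have n1 : nrm (1 : C) <= 1 by rewrite nrm1.
apply: lauM; first apply: lauM.
- apply: lauX; apply: (@lau_PhiS 1 (-1) 2 1 1 n1) => // q y _ _.
  by rewrite !mul1r expr1z expr1 mulN1r mulNr.
- apply: lauX; apply: (@lau_PhiS 1 (-1) 2 1 (-1) n1) => // q y _ _.
  by rewrite !mul1r exprN1 expr1 mulN1r mulNr.
- apply: lauX; apply: (@lau_PhiS 1 1 1 1 0 n1) => // q y _ _.
  by rewrite !mul1r expr0z mulr1 expr1.
Qed.

Lemma lau_opp G : lau G -> lau (fun p y => G (- p : C) y : C).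
Proof.
move=> [a ha]; exists (fun k => (-1) ^+ k.1 * a k) => q y q1 y0.
have nq : nrm (- q) < 1 by rewrite nrmN.
have <- : (fun k => a k * ((- q) ^+ k.1 * y ^ k.2)) =
    (fun k => (-1) ^+ k.1 * a k * (q ^+ k.1 * y ^ k.2)).
  by apply/funext => k; rewrite [(- q) ^+ _]exprNn; ring.
exact: ha.
Qed.

End HalfPeriods.

(** * Even functions of index k at a fixed q *)

Section LaurentSeries.
Variable R : realType.
Local Notation C := R[i].
Implicit Types (q y z tau : C) (c d : int -> C) (g : C -> C).

Lemma laurent_lau (G : C -> C -> C) (a : nat * int -> C) q :
  (forall q y, nrm q < 1 -> y != 0 ->
     hsum (fun nr => a nr * (q ^+ nr.1 * y ^ nr.2)) (G q y)) ->
  nrm q < 1 ->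
  (forall r, hsum (fun n => a (n, r) * q ^+ n) (tsum (fun n => a (n, r) * q ^+ n))) /\
  laurent (fun r => tsum (fun n => a (n, r) * q ^+ n)) (G q).
Proof.
move=> ha q1.
have s1 r : summ (fun n => a (n, r) * q ^+ n).
  have I1 : injective (fun n : nat => (n, r)) by move=> ? ? [].
  have := summ_inj I1 (hsum_summ (ha q 1 q1 (oner_neq0 _))); congr summ.
  by apply/funext => n; rewrite /= exp1rz mulr1.
split=> [r|y y0]; first exact: tsumP.
apply: (hsum_push (p := snd) (hsum_summ (ha q y q1 y0)) (ha q y q1 y0)) => r.
apply/(@hsum_inj _ _ _ (fun n => (n, r))); first by move=> ? ? [].
  move=> [n' r'] /(_ n'); rewrite /restr /=; case: (r' =P r) => // -> .
  by rewrite eqxx.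
rewrite mulrC; have := hsumZ (y ^ r) (tsumP (s1 r)); congr hsum.
by apply/funext => n; rewrite /= /restr /= eqxx; ring.
Qed.

(** Averaging over y -> w y with w^(2^k) = -1 keeps the exponents divisible by
    2^(k+1), so a vanishing series has c_0 = - sum of the c_r y^r over the
    nonzero multiples r of 2^k, which tends to 0. Multiplying by a power of y
    gives the other coefficients. *)
Lemma laurent0 c : laurent c (fun=> 0) -> forall r, c r = 0.
Proof.
move=> hc.
have zero d : laurent d (fun=> 0) -> d 0 = 0.
  move=> hd.
  have av k : laurent (fun r => if (2 ^ k %| `|r|)%N then d r else 0) (fun=> 0).
    elim: k => [|k IH] y y0.
      by have := hd y y0; congr hsum; apply/funext => r; rewrite expn0 dvd1n.
    have [w hw] := @complex_root R (-1) (2 ^ k) (expn_gt0 2 k).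
    have w0 : w != 0.
      apply/eqP => w0; move/eqP: hw; rewrite w0 expr0n expn_eq0 /= eq_sym.
      by rewrite oppr_eq0 oner_eq0.
    have := hsumZ 2^-1 (hsumD (IH y y0) (IH (w * y) (mulf_neq0 w0 y0))).
    rewrite addr0 mulr0; congr hsum; apply/funext => r.
    rewrite expfzMl; case: ifPn => [d1|d1].
      have [m rE] : exists m : int, r = m * (2 ^ k)%N.
        exists (r %/ (2 ^ k)%N)%Z; apply/esym/eqP.
        by rewrite -dvdz_eq dvdzE absz_nat.
      have -> : w ^ r = (-1) ^+ `|m|%N.
        rewrite rE mulrC -exprz_exp -exprnP hw.
        by case: m {rE} => n; rewrite ?NegzE // -invr_expz -exprnP ?signrN // invr_sign.
      rewrite rE abszM absz_nat expnS dvdn_pmul2r ?expn_gt0 // dvdn2 -signr_odd.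
      by case: (odd _) => /=; field.
    rewrite ifN ?mul0r ?addr0 ?mulr0 //; apply: contra d1; apply: dvdn_trans.
    by rewrite expnS dvdn_mull.
  apply/nrm_small => e e0.
  have s1 := hsum_summ (hd 1 (oner_neq0 _)).
  have {}[A hA] := absum_tail s1 e0.
  pose k := (\sum_(r <- A) `|r|)%N.
  have h := av k 1 (oner_neq0 _).
  set u := (fun r => _) in h.
  have h0 : hsum (fun r : int => if r == 0 then d 0 else 0) (d 0).
    have E : (if (0 : int) == 0 then d 0 else 0) = d 0 by rewrite eqxx.
    have := @hsum1 R int (fun r => if r == 0 then d 0 else 0) 0.
    by rewrite E; apply=> r /negbTE ->.
  have := hsumB h0 h; rewrite subr0 => h1; apply: hsum_le h1 => B.
  apply: le_trans (_ : \sum_(r <- [fset r in B | r \notin A]%fset) nrm (d r * 1 ^ r) <= _).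
    rewrite (big_fsetID _ (fun r => r \notin A)) /= [X in _ + X]big1_fset ?addr0.
      apply: ler_sum => r _; rewrite /u; have [->|r0] := eqVneq r 0.
        by rewrite absz0 dvdn0 expr0z mulr1 subrr nrm0 nrm_ge0.
      by rewrite sub0r nrmN; case: ifP => // _; rewrite mul0r nrm0 nrm_ge0.
    move=> r; rewrite !inE /= negbK => /andP[rB rA] _; rewrite /u.
    have [->|r0] := eqVneq r 0; first by rewrite absz0 dvdn0 expr0z mulr1 subrr nrm0.
    rewrite ifN ?mul0r ?subr0 ?nrm0 //; apply/negP => /dvdn_leq.
    rewrite absz_gt0 => /(_ r0); apply/negP; rewrite -ltnNge.
    apply: leq_ltn_trans (ltn_expl k (ltnSn 1)).
    by rewrite /k (big_fsetD1 _ rA) leq_addr.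
  by apply: hA; apply/fdisjointP => r rA; rewrite !inE rA andbF.
move=> r; have := zero (fun s => c (s + r)); rewrite add0r; apply=> y y0.
have fI : injective (fun s : int => s + r) by apply: addIr.
have h := hsumZ (y ^ (- r)) (hc y y0); rewrite mulr0 in h.
have nf k : (forall s : int, s + r != k) -> y ^ (- r) * (c k * y ^ k) = 0.
  by move=> /(_ (k - r)); rewrite subrK eqxx.
have := (hsum_inj _ fI nf).2 h; congr hsum; apply/funext => s /=.
by rewrite mulrCA -expfzDr // (_ : - r + (s + r) = s) //; ring.
Qed.

Lemma laurent_uniq c d g : laurent c g -> laurent d g -> forall r, c r = d r.
Proof.
move=> hc hd r; apply/eqP; rewrite -subr_eq0; apply/eqP.
apply: (laurent0 (c := fun r => c r - d r)) => y y0.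
have := hsumB (hc y y0) (hd y y0); rewrite subrr; congr hsum; apply/funext => s.
by rewrite mulrBl.
Qed.

(** The coefficients c_r of an even function of index k at a fixed q satisfy
    c_(r+2k) = q^(r+k) c_r. The relation is stated for r + k >= 0 only, so that
    it makes sense at q = 0 too. *)
Definition index_coefs (k : nat) q c : Prop := (forall r, c (- r) = c r) /\
  forall (r : int) (n : nat), r + k%:Z = n%:Z -> c (r + 2 * k%:Z) = q ^+ n * c r.

(** The two relations reduce any coefficient to one with 0 <= r <= k. Hence even
    functions of index k form a space of dimension at most k + 1. For k = 0 the
    recurrence reads c_r = q^r c_r, whence c_r = 0 for r > 0. *)
Lemma index_coefs0 k q c : nrm q < 1 -> index_coefs k q c ->
  (forall r : nat, (r <= k)%N -> c r%:Z = 0) -> forall r, c r = 0.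
Proof.
move=> q1 [cN cS] c0.
have cabs r : c r = c `|r|%N%:Z.
  by case: r => n //; rewrite NegzE cN abszN absz_nat.
have nat0 n : c n%:Z = 0.
  have [m mn] := ubnP n; elim: m n mn => // m IH n; rewrite ltnS => nm.
  have [nk|kn] := leqP n k; first exact: c0.
  have := cS (n%:Z - 2 * k%:Z) (n - k)%N; rewrite subrK.
  have -> : n%:Z - 2 * k%:Z + k%:Z = (n - k)%N by lia.
  move=> /(_ erefl) E.
  have [k0|k0] := posnP k; last first.
    by rewrite E cabs IH ?mulr0 //; lia.
  have {}E : c n%:Z = q ^+ n * c n%:Z by move: E; rewrite k0 mulr0 subr0 subn0.
  apply/eqP; move/eqP: E; rewrite -subr_eq0 -{1}[c _]mul1r -mulrBl mulf_eq0.
  case/orP=> //; rewrite subr_eq0 => /eqP E.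
  have : nrm (q ^+ n) < 1.
    rewrite nrmX exprn_ilt1 ?nrm_ge0 //; lia.
  by rewrite -E nrm1 ltxx.
by move=> r; rewrite cabs.
Qed.

(** The functional equations of an even function of index k, read off its Laurent
    coefficients by uniqueness. *)
Lemma index_coefs_fun k q c g : q != 0 -> laurent c g ->
  (forall y, y != 0 -> g (q * y) = (q ^+ k * y ^+ (2 * k))^-1 * g y) ->
  (forall y, y != 0 -> g y^-1 = g y) -> index_coefs k q c.
Proof.
move=> q0 hc gq gN; split=> [r|r n rn].
  apply: (@laurent_uniq (fun r => c (- r)) c g _ hc) => y y0.
  have y0' : y^-1 != 0 by rewrite invr_eq0.
  have fI : injective (fun r : int => - r) by apply: oppr_inj.
  have nf (j : int) : (forall s : int, - s != j) -> c j * y^-1 ^ j = 0.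
    by move=> /(_ (- j)); rewrite opprK eqxx.
  have := (hsum_inj (g y^-1) fI nf).2 (hc _ y0').
  by rewrite gN //; congr hsum; apply/funext => s /=; rewrite exprz_inv opprK.
have h1 : laurent (fun r => c r * q ^ r) (fun y => g (q * y)).
  move=> y y0; apply: eq_hsum (hc _ (mulf_neq0 q0 y0)) => s.
  by rewrite expfzMl mulrA.
have h2 : laurent (fun r => q ^- k * c (r + 2 * k%:Z)) (fun y => g (q * y)).
  move=> y y0; rewrite gq //.
  have fI : injective (fun s : int => s + 2 * k%:Z) by apply: addIr.
  have nf (j : int) : (forall s : int, s + 2 * k%:Z != j) -> c j * y ^ j = 0.
    by move=> /(_ (j - 2 * k%:Z)); rewrite subrK eqxx.
  apply: eq_hsum (hsumZ _ ((hsum_inj (g y) fI nf).2 (hc y y0))) => s /=.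
  have -> : y ^ (s + 2 * k%:Z) = y ^ s * y ^+ (2 * k) by rewrite expfzDr.
  by field; rewrite !expf_neq0.
have := laurent_uniq h1 h2 r => E.
have qk : q ^+ k != 0 by rewrite expf_neq0.
apply: (mulfI (invr_neq0 qk)); rewrite -E.
have -> : q ^+ n = q ^ r * q ^+ k by rewrite !exprnP -expfzDr // rn.
by field.
Qed.

(** A polynomial with nonzero roots arbitrarily close to 0 is zero: split off the
    power of X, the cofactor is nonzero near 0. *)
Lemma poly_small_root (p : {poly C}) :
  (forall e : R, 0 < e -> exists x : C, [/\ x != 0, nrm x <= e & p.[x] = 0]) -> p = 0.
Proof.
move=> h; apply/eqP; apply: contrapT => /negP p0.
have [n [g [g0 pE]]] : exists (n : nat) (g : {poly C}), g.[0] != 0 /\ p = g * 'X^n.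
  have [n [g ng pE]] := multiplicity_XsubC p 0.
  by exists n, g; rewrite p0 /= in ng; rewrite pE subr0.
have cg : ccont (fun x => g.[x]) 0.
  apply: (@psd_ccont R _ 0 1 ltr01); rewrite ?nrm0 //.
  apply: psd_eq (@psd_sum R 1 _ (index_enum 'I_(size g)) xpredT
    (fun (i : 'I_(size g)) x => g`_i * x ^+ i) ltr01 _).
    by move=> x _; rewrite horner_coef.
  by move=> i; apply: psd_mono.
have [d d0 hd] := ccont_nz cg g0.
have [x [x0 xd px]] := h d d0.
have := hd x; rewrite subr0 => /(_ xd).
move: px; rewrite pE hornerM hornerXn => /eqP; rewrite mulf_eq0 expf_eq0.
rewrite (negbTE x0) andbF orbF => /eqP ->; rewrite nrm0 leNgt divr_gt0 //.
by rewrite nrm_gt0.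
Qed.

Section Span.
Variables (k : nat) (q : C) (P Q : C -> C) (cs : 'I_k.+1 -> int -> C).
Hypothesis q1 : nrm q < 1.
Hypothesis csP : forall j, laurent (cs j) (fun y => P y ^+ j * Q y ^+ (k - j)).
Hypothesis csV : forall j, index_coefs k q (cs j).
Hypothesis PQ : forall e : R, 0 < e ->
  exists y, [/\ y != 0, P y != 0, Q y != 0 & nrm (P y / Q y) <= e].

Definition span_mx : 'M[C]_k.+1 := \matrix_(j, r) cs j (r : nat)%:Z.

Lemma laurent_comb (v : 'I_k.+1 -> C) :
  laurent (fun r => \sum_j v j * cs j r)
          (fun y => \sum_j v j * (P y ^+ j * Q y ^+ (k - j))).
Proof.
move=> y y0; have := @hsum_sum R int _ (index_enum 'I_k.+1) xpredT
  (fun j r => v j * (cs j r * y ^ r)) _ (fun j _ => hsumZ (v j) (csP j y0)).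
congr hsum; apply/funext => r; rewrite mulr_suml; apply: eq_bigr => j _.
by rewrite mulrA.
Qed.

Lemma index_coefs_comb (v : 'I_k.+1 -> C) : index_coefs k q (fun r => \sum_j v j * cs j r).
Proof.
split=> [r|r n rn]; first by apply: eq_bigr => j _; rewrite (csV j).1.
by rewrite mulr_sumr; apply: eq_bigr => j _; rewrite ((csV j).2 r n rn); ring.
Qed.

(** The polynomial with coefficients v j vanishes at the values of P/Q, which
    come arbitrarily close to 0 without vanishing. *)
Lemma comb_eq0 (v : 'I_k.+1 -> C) :
  (forall y, y != 0 -> \sum_j v j * (P y ^+ j * Q y ^+ (k - j)) = 0) ->
  forall j, v j = 0.
Proof.
move=> h j; pose p := \poly_(i < k.+1) v (inord i).
have p0 : p = 0.
  apply: poly_small_root => e /PQ [y [y0 Py Qy Pe]]; exists (P y / Q y).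
  split=> //; first by rewrite mulf_neq0 // invr_eq0.
  rewrite horner_poly; apply: (mulfI (expf_neq0 k Qy)); rewrite mulr0; apply: etrans (h y y0).
  rewrite mulr_sumr; apply: eq_bigr => i _; rewrite inord_val.
  have ik : (i <= k)%N by rewrite -ltnS.
  rewrite -{1}(subnK ik) exprD expr_div_n.
  by field; rewrite expf_neq0.
have := coef_poly k.+1 (fun i => v (inord i)) j.
by rewrite -/p p0 coef0 ltn_ord inord_val.
Qed.

(** A linear relation between the rows is a combination of the P^j Q^(k-j) whose
    coefficients of index 0, ..., k vanish, hence all of them, so that it is
    trivial. *)
Lemma span_det : \det span_mx != 0.
Proof.
apply/det0P => -[v v0 vM].
have h : forall r, \sum_j v 0 j * cs j r = 0.
  apply: (index_coefs0 q1 (index_coefs_comb (fun j => v 0 j))) => r rk.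
  have rk' : (r < k.+1)%N by [].
  have := congr1 (fun u : 'rV_k.+1 => u 0 (Ordinal rk')) vM; rewrite !mxE => E.
  by rewrite -[RHS]E; apply: eq_bigr => j _; rewrite ?mxE.
have z : forall j, v 0 j = 0.
  apply: comb_eq0 => y y0; have := laurent_comb (fun j => v 0 j) y0.
  move=> /hsum_uniq; apply; have := @hsum0 R int; congr hsum.
  by apply/funext => r; rewrite h mul0r.
by case/eqP: v0; apply/rowP => j; rewrite mxE z.
Qed.

(** Cramer's rule: the k + 1 products form a basis of the even functions of index
    k, and the coordinates are rational functions of the Laurent coefficients. *)
Lemma span_repr c g : laurent c g -> index_coefs k q c ->
  let h j := ((\row_r c (r : nat)%:Z) *m invmx span_mx) 0 j in
  forall y, y != 0 -> g y = \sum_(j < k.+1) h j * (P y ^+ j * Q y ^+ (k - j)).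
Proof.
move=> hc [cN cS] h y y0.
have U : span_mx \in unitmx by rewrite unitmxE unitfE span_det.
have [wN wS] := index_coefs_comb h.
have z : forall r, c r - \sum_j h j * cs j r = 0.
  apply: (@index_coefs0 k q (fun r => c r - \sum_j h j * cs j r)) => //.
    split=> [r|r n rn]; first by rewrite cN wN.
    by rewrite (cS r n rn) (wS r n rn) mulrBr.
  move=> r rk; have rk' : (r < k.+1)%N by [].
  apply/eqP; rewrite subr_eq0; apply/eqP.
  transitivity (((\row_r c (r : nat)%:Z) *m invmx span_mx *m span_mx) 0 (Ordinal rk')).
    by rewrite mulmxKV // mxE.
  by rewrite mxE; apply: eq_bigr => j _; rewrite [span_mx j _]mxE.
apply: hsum_uniq (hc y y0) _; have := laurent_comb h y0; congr hsum.
by apply/funext => r; move/eqP: (z r); rewrite subr_eq0 => /eqP ->.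
Qed.

End Span.

End LaurentSeries.

(** * Holomorphy of Fourier series *)

Lemma differentiable_littleo (K : numFieldType) (V W : normedModType K)
    (f : V -> W) (df : {linear V -> W}) (p : V) : continuous df ->
  (forall e : K, 0 < e ->
     \forall h \near (0 : V), `|f (h + p) - (f p + df h)| <= e * `|h|) ->
  differentiable f p.
Proof.
move=> cdf hf.
have E : f \o shift p = cst (f p) + df +o_ 0 id.
  by apply: eqaddoE; apply/eqaddoP => e e0; apply: hf.
have dE := diff_unique cdf E.
by apply/diff_locallyP; rewrite dE.
Qed.

Section Holomorphy.
Variable R : realType.
Local Notation C := (R[i]^o).

Definition lin2 (D1 D2 : C) (p : C * C) : C := D1 * p.1 + D2 * p.2.

Lemma lin2_linear (D1 D2 : C) : linear (lin2 D1 D2).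
Proof.
move=> k p p'; rewrite /lin2 /= !mulrDr addrACA scalerDr.
by congr (_ + _ + _); rewrite /GRing.scale /= mulrCA.
Qed.

HB.instance Definition _ (D1 D2 : C) :=
  GRing.isLinear.Build _ _ _ _ (lin2 D1 D2) (lin2_linear D1 D2).

Lemma lin2_continuous (D1 D2 : C) : continuous (lin2 D1 D2).
Proof.
move=> p; apply: cvgD; apply: cvgM; try exact: cvg_cst.
  exact: cvg_fst.
exact: cvg_snd.
Qed.

Lemma differentiable_quad (f : C * C -> C) (p : C * C) (D1 D2 : C) (K d : R) :
  0 < d -> 0 <= K ->
  (forall (h : C * C) (M : R), M <= d -> nrm h.1 <= M -> nrm h.2 <= M ->
    nrm (f (h + p) - f p - (D1 * h.1 + D2 * h.2)) <= K * M ^+ 2) ->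
  differentiable f p.
Proof.
move=> d0 K0 hf.
apply: (@differentiable_littleo _ _ _ f (lin2 D1 D2) p (@lin2_continuous D1 D2)).
move=> e e0.
have [e' e'0 eE] : exists2 e' : R, 0 < e' & e = e'%:C.
  exists (complex.Re e); first by move: e0; rewrite ltcE => /andP[_].
  by rewrite RRe_real // gtr0_real.
apply/(@nbhs_ballP _ (C * C)%type).
pose m := Num.min d (e' / (K + 1)).
have m0 : 0 < m by rewrite lt_min d0 divr_gt0 // ltr_wpDl.
exists m%:C; first by rewrite /= ltcR.
move=> h [] /=; rewrite /ball /= !sub0r !normrN.
rewrite -[X in X < _ -> _]/(`|h.1 : R[i]|) -[X in _ -> X < _ -> _]/(`|h.2 : R[i]|).
rewrite !normE !ltcR => h1 h2.
pose M := Num.max (nrm h.1) (nrm h.2).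
have M0 : 0 <= M by rewrite le_max nrm_ge0.
have Mm : M < m by rewrite gt_max h1 h2.
have md : M <= d by apply/ltW; apply: lt_le_trans Mm _; rewrite ge_min lexx.
have me : M <= e' / (K + 1).
  by apply/ltW; apply: lt_le_trans Mm _; rewrite ge_min lexx orbT.
have hE : `|h| = M%:C.
  rewrite prod_normE -[X in Order.max X _]/(`|h.1 : R[i]|).
  rewrite -[X in Order.max _ X]/(`|h.2 : R[i]|) !normE /M.
  by case: (leP (nrm h.1) (nrm h.2)) => hh; [rewrite max_r|rewrite max_l];
    rewrite ?lecR // ltW.
rewrite hE eE -[X in X <= _]/(`|f (h + p) - (f p + lin2 D1 D2 h) : R[i]|).
rewrite normE -rmorphM lecR opprD addrA.
apply: le_trans (hf h M md _ _) _; rewrite ?le_max ?lexx ?orbT //.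
rewrite expr2 mulrA ler_wpM2r // mulrC.
move: me; rewrite ler_pdivlMr ?ltr_wpDl // => me; apply: le_trans me.
by rewrite ler_wpM2l // lerDl.
Qed.

Lemma sqr_le_exp (x : R) : 0 <= x -> x ^+ 2 <= 2 * expR x.
Proof.
move=> x0; have := expR_ge1Dxn 1 x0; rewrite !factS fact0 !muln1.
by have := sqr_ge0 x; lra.
Qed.

Lemma id_le_exp (x : R) : x <= expR x.
Proof. by have := expR_ge1Dx x; lra. Qed.

Lemma nrm_term (a q y : R[i]) (n : nat) (r : int) :
  nrm (a * (q ^+ n * y ^ r)) = nrm a * (nrm q ^+ n * nrm y ^ r).
Proof. by rewrite nrmM nrmM nrmX nrmXz. Qed.

Lemma term_mul (a q q' y y' : R[i]) (n : nat) (r : int) :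
  a * (q ^+ n * y ^ r) * (y' ^ r * q' ^+ n) = a * ((q' * q) ^+ n * (y' * y) ^ r).
Proof. by rewrite exprMn expfzMl; ring. Qed.

(** The weight of a term of a Laurent series is at most its sum at the two radii
    y E and y/E, whatever the sign of the exponent. *)
Lemma exp_majorant (A q y E : R) (n : nat) (r : int) : 0 <= A -> 0 <= q -> 0 <= y ->
  0 < E -> A * (q ^+ n * y ^ r) * (E ^+ n * E ^+ `|r|%N) <=
  A * ((q * E) ^+ n * (y * E) ^ r) + A * ((q * E) ^+ n * (y * E^-1) ^ r).
Proof.
move=> A0 q0 y0 E0.
have -> : A * (q ^+ n * y ^ r) * (E ^+ n * E ^+ `|r|%N) =
  A * (q ^+ n * E ^+ n * y ^ r) * E ^+ `|r|%N by ring.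
have -> : A * ((q * E) ^+ n * (y * E) ^ r) + A * ((q * E) ^+ n * (y * E^-1) ^ r) =
    A * (q ^+ n * E ^+ n * y ^ r) * (E ^ r + E^-1 ^ r).
  by rewrite exprMn !expfzMl; ring.
apply: ler_wpM2l; first by rewrite !mulr_ge0 ?exprn_ge0 ?exprz_ge0 // ltW.
case: r => k; rewrite ?NegzE ?abszN absz_nat.
  by rewrite -exprnP lerDl exprz_ge0 // invr_ge0 ltW.
by rewrite exprz_inv opprK -exprnP lerDr exprz_ge0 // ltW.
Qed.

(** A family that converges on the whole of C x H is absolutely summable with
    room to spare: at nearby points every term is multiplied by exp(w) with w
    linear in the displacement, and the remainders exp(w) - 1 - w sum up to a
    quadratic bound. *)
Lemma fourier_quad (G : R[i] -> R[i] -> R[i]) (z tau : R[i]) :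
  lau G -> in_upper tau ->
  exists D1 D2 (K d : R), [/\ 0 < d, 0 <= K &
   forall (h1 h2 : R[i]) (M : R), M <= d -> nrm h1 <= M -> nrm h2 <= M ->
   nrm (G (e2pi (h2 + tau)) (e2pi (h1 + z)) - G (e2pi tau) (e2pi z)
        - (D1 * h1 + D2 * h2)) <= K * M ^+ 2].
Proof.
move=> [a ha] t0; have y0 : 0 < complex.Im tau := t0.
pose d := complex.Im tau / 4; have d0 : 0 < d by rewrite divr_gt0.
have p0 := pi_gt0 R.
(* m u bounds the derivatives of the exponent of the term u in both variables,
   and the series still converges after a displacement by 2 d. *)
pose m (u : nat * int) : R := 2 * pi * (u.1%:R + (`|u.2|%N)%:R).
have m0 u : 0 <= m u.
  by rewrite /m mulr_ge0 ?addr_ge0 ?ler0n // mulr_ge0 // ltW.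
have md0 u : 0 <= m u * d by rewrite mulr_ge0 // ltW.
pose E : R := expR (4 * pi * d); have E0 : 0 < E by apply: expR_gt0.
pose t u : R[i] := a u * (e2pi tau ^+ u.1 * e2pi z ^ u.2).
have q1 := e2pi_upper t0.
have sE : summ (fun u => t u * (expR (2 * (m u * d)))%:C).
  have EC0 : E%:C != 0 :> R[i] by rewrite realC_neq0.
  have [q' q'1 nq'] : exists2 q' : R[i], nrm q' < 1 & nrm q' = nrm (e2pi tau) * E.
    exists (e2pi tau * E%:C); last by rewrite nrmM nrm_real gtr0_norm.
    rewrite nrmM nrm_e2pi nrm_real gtr0_norm // /E -expRD expR_lt1.
    have -> : - (2 * pi * complex.Im tau) + 4 * pi * d = - (pi * complex.Im tau).
      by rewrite /d; field.
    by rewrite oppr_lt0 mulr_gt0.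
  have [y1 y10 ny1] : exists2 y1 : R[i], y1 != 0 & nrm y1 = nrm (e2pi z) * E.
    exists (e2pi z * E%:C); last by rewrite nrmM nrm_real gtr0_norm.
    by rewrite mulf_neq0 // e2pi_neq0.
  have [y2 y20 ny2] : exists2 y2 : R[i], y2 != 0 & nrm y2 = nrm (e2pi z) * E^-1.
    exists (e2pi z / E%:C); last by rewrite nrmM nrmV nrm_real gtr0_norm.
    by rewrite mulf_neq0 ?invr_eq0 // e2pi_neq0.
  have s1 := hsum_summ (ha q' _ q'1 y10).
  have s2 := hsum_summ (ha q' _ q'1 y20).
  have abs (u : nat * int -> R[i]) : summ u -> summ (fun i => (nrm (u i))%:C).
    by move=> su; apply: summ_dom su => i; rewrite nrm_real ger0_norm ?nrm_ge0.
  apply: summ_dom (summD (abs _ s1) (abs _ s2)) => -[n r].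
  have -> : nrm (t (n, r) * (expR (2 * (m (n, r) * d)))%:C) =
      nrm (a (n, r)) * (nrm (e2pi tau) ^+ n * nrm (e2pi z) ^ r) *
      (E ^+ n * E ^+ `|r|%N).
    have -> : E ^+ n * E ^+ `|r|%N = expR (2 * (m (n, r) * d)).
      by rewrite /E -exprD -expRM_natl natrD; congr expR; rewrite /m /=; ring.
    by rewrite nrmM nrm_term nrm_real [X in _ * X]ger0_norm // expR_ge0.
  rewrite -rmorphD [leRHS]nrm_real [leRHS]ger0_norm ?addr_ge0 ?nrm_ge0 //.
  apply: le_trans (exp_majorant n r (nrm_ge0 (a (n, r))) (nrm_ge0 (e2pi tau))
    (nrm_ge0 (e2pi z)) E0) _.
  by rewrite -nq' -ny1 -ny2 -!nrm_term.
have sE1 : summ (fun u => t u * (expR (m u * d))%:C).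
  apply: summ_dom sE => u.
  rewrite [leLHS]nrmM [leRHS]nrmM ler_wpM2l ?nrm_ge0 // !nrm_real.
  rewrite !ger0_norm ?expR_ge0 // ler_expR.
  by have := md0 u; lra.
have slin (c : nat * int -> R[i]) : (forall u, nrm (c u) <= m u) ->
    summ (fun u => t u * c u).
  move=> cm; apply: summ_dom (summZ (d^-1)%:C sE1) => u.
  rewrite [X in _ <= nrm X]mulrCA [leLHS]nrmM [leRHS]nrmM ler_wpM2l ?nrm_ge0 //.
  rewrite nrmM !nrm_real ger0_norm ?invr_ge0 ?(ltW d0) //.
  rewrite ger0_norm ?expR_ge0 // mulrC ler_pdivlMr //.
  apply: le_trans (id_le_exp _); rewrite ler_wpM2r ?(ltW d0) //.
pose c1 (u : nat * int) : R[i] := tpi R * u.2%:~R.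
pose c2 (u : nat * int) : R[i] := tpi R * u.1%:R.
have nint (r : int) : nrm (r%:~R : R[i]) = (`|r|%N)%:R.
  by rewrite intC nrm_real -intr_norm -natr_absz.
have n1 u : nrm (c1 u) = 2 * pi * (`|u.2|%N)%:R by rewrite /c1 nrmM nrm_tpi nint.
have n2 u : nrm (c2 u) = 2 * pi * u.1%:R by rewrite /c2 nrmM nrm_tpi nrm_nat.
have c1m u : nrm (c1 u) <= m u.
  rewrite n1 /m ler_wpM2l ?mulr_ge0 ?(ltW p0) //.
  by rewrite lerDr.
have c2m u : nrm (c2 u) <= m u.
  rewrite n2 /m ler_wpM2l ?mulr_ge0 ?(ltW p0) //.
  by rewrite lerDl.
have h1 := tsumP (slin c1 c1m); have h2 := tsumP (slin c2 c2m).
have [B hB] := sE.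
exists (tsum (fun u => t u * c1 u)), (tsum (fun u => t u * c2 u)), (2 / d ^+ 2 * B), d.
have B0 := absum_ge0 hB.
split=> //; first by rewrite mulr_ge0 // divr_ge0 // exprn_ge0 // ltW.
move=> k1 k2 M Md k1M k2M.
have M0 : 0 <= M by apply: le_trans k1M; apply: nrm_ge0.
pose w u := c1 u * k1 + c2 u * k2.
have wm u : nrm (w u) <= m u * M.
  apply: le_trans (nrmD _ _) _; rewrite [nrm (_ * k1)]nrmM [nrm (_ * k2)]nrmM.
  apply: le_trans (_ : nrm (c1 u) * M + nrm (c2 u) * M <= _).
    by rewrite lerD // ler_wpM2l ?nrm_ge0.
  by rewrite -mulrDl ler_wpM2r // n1 n2 /m -mulrDr addrC.
have t0' : in_upper (k2 + tau).
  rewrite /in_upper ImD; have := nrm_Im k2; rewrite ler_norml => /andP[h _].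
  by move: Md k2M y0 h; rewrite /d; lra.
have q1' := e2pi_upper t0'.
have hE : hsum (fun u => t u * expC (w u)) (G (e2pi (k2 + tau)) (e2pi (k1 + z))).
  apply: eq_hsum (ha _ _ q1' (e2pi_neq0 (k1 + z))) => u.
  have -> : expC (w u) = e2pi k1 ^ u.2 * e2pi k2 ^+ u.1.
    rewrite -e2piMz -e2piMn -e2piD e2piE /w /c1 /c2; congr expC; ring.
  by rewrite (e2piD k2 tau) (e2piD k1 z) term_mul.
have h0 : hsum t (G (e2pi tau) (e2pi z)) by apply: ha => //; apply: e2pi_neq0.
have := hsumB (hsumB hE h0) (hsumD (hsumZ k1 h1) (hsumZ k2 h2)).
rewrite [k1 * _]mulrC [k2 * _]mulrC; apply: hsum_le => A.
have Mdd : (M / d) ^+ 2 = M ^+ 2 / d ^+ 2 by rewrite expr_div_n.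
apply: le_trans (_ : \sum_(u <- A) (2 * (M / d) ^+ 2) *
    nrm (t u * (expR (2 * (m u * d)))%:C) <= _).
  apply: ler_sum => u _.
  have -> : t u * expC (w u) - t u - (k1 * (t u * c1 u) + k2 * (t u * c2 u)) =
    t u * (expC (w u) - 1 - w u) by rewrite /w; ring.
  rewrite [leLHS]nrmM [nrm (t u * _%:C)]nrmM [leRHS]mulrCA ler_wpM2l ?nrm_ge0 //.
  rewrite nrm_real ger0_norm ?expR_ge0 //.
  apply: le_trans (nrm_expC_sub1z _) _.
  apply: le_trans (_ : (m u * M) ^+ 2 * expR (m u * d) <= _).
    apply: ler_pM; rewrite ?exprn_ge0 ?nrm_ge0 ?expR_ge0 //.
      by rewrite lerXn2r // nnegrE ?nrm_ge0 // mulr_ge0.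
    by rewrite ler_expR; apply: le_trans (wm u) _; rewrite ler_wpM2l.
  have -> : 2 * (m u * d) = m u * d + m u * d by ring.
  rewrite expRD [leRHS]mulrA ler_wpM2r ?expR_ge0 //.
  have -> : (m u * M) ^+ 2 = (M / d) ^+ 2 * (m u * d) ^+ 2.
    by rewrite -exprMn mulrACA mulVf ?lt0r_neq0 // mulr1 [M * _]mulrC.
  have -> : 2 * (M / d) ^+ 2 * expR (m u * d) =
    (M / d) ^+ 2 * (2 * expR (m u * d)) by ring.
  by apply: ler_wpM2l; [apply: sqr_ge0|apply: sqr_le_exp].
rewrite -mulr_sumr Mdd.
have -> : 2 / d ^+ 2 * B * M ^+ 2 = 2 * (M ^+ 2 / d ^+ 2) * B by ring.
by rewrite ler_wpM2l // !mulr_ge0 ?invr_ge0 ?exprn_ge0 // ltW.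
Qed.

Definition jac (G : R[i] -> R[i] -> R[i]) : jacobi_fun R :=
  fun p => G (e2pi (val p.2)) (e2pi p.1).

Lemma lau_holomorphic G : lau G -> holomorphic (jac G).
Proof.
move=> hG z tau.
have t0 : in_upper (val tau) by apply: (valP tau).
have y0 : 0 < complex.Im (val tau) := t0.
have [D1 [D2 [K [d [d0 K0 hq]]]]] := fourier_quad z hG t0.
pose d' := Num.min d (complex.Im (val tau) / 2).
have d'0 : 0 < d' by rewrite lt_min d0 divr_gt0.
apply: (@differentiable_quad _ _ D1 D2 K d') => // -[h1 h2] M /= Md h1M h2M.
have [Md1 Md2] : M <= d /\ M <= complex.Im (val tau) / 2.
  by move: Md; rewrite le_min => /andP[].
have t0' : in_upper (h2 + val tau).
  rewrite /in_upper ImD; have := nrm_Im h2; rewrite ler_norml => /andP[h _].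
  by move: Md2 h2M y0 h; lra.
have -> : extend0 (jac G) (h1 + z, h2 + val tau) = G (e2pi (h2 + val tau)) (e2pi (h1 + z)).
  by rewrite /extend0 /= insubT.
have -> : extend0 (jac G) (z, val tau) = G (e2pi (val tau)) (e2pi z).
  by rewrite /extend0 /= valK.
exact: hq.
Qed.

Lemma lau_fourier G : lau G -> fourier_nonneg (jac G).
Proof.
case=> a ha; exists a => z tau; apply/hsum_cvgP; apply: ha; last exact: e2pi_neq0.
exact: e2pi_upper (valP tau).
Qed.

(** The expansion of a function on C x H covers the punctured disc; at q = 0 the
    terms with n > 0 vanish, so convergence there follows from convergence at any
    other q. *)
Lemma fourier_lau (f : jacobi_fun R) : fourier_nonneg f ->
  exists2 G, lau G & f = jac G.
Proof.
case=> a ha.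
have h q y : nrm q < 1 -> q != 0 -> y != 0 ->
    exists l, hsum (fun nr => a nr * (q ^+ nr.1 * y ^ nr.2)) l.
  move=> q1 q0 y0; have [tau <-] := e2pi_upper_surj q0 q1.
  have [z <-] := e2pi_surj y0; exists (f (z, tau)).
  exact/hsum_cvgP/ha.
have s q y : nrm q < 1 -> y != 0 ->
    summ (fun nr => a nr * (q ^+ nr.1 * y ^ nr.2)).
  move=> q1 y0; have [q0|q0] := eqVneq q 0; last first.
    by have [l hl] := h q y q1 q0 y0; apply: hsum_summ hl.
  have h2 : nrm (2^-1 : R[i]) < 1 by rewrite nrmV nrm_nat invf_lt1 ?ltr1n.
  have h20 : (2^-1 : R[i]) != 0 by rewrite invr_eq0 pnatr_eq0.
  have [l /hsum_summ] := h _ y h2 h20 y0; apply: summ_dom => -[n r] /=.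
  rewrite q0 expr0n; case: n => [|n] /=; first by rewrite expr0.
  by rewrite mul0r mulr0 nrm0 nrm_ge0.
exists (fun q y => tsum (fun nr => a nr * (q ^+ nr.1 * y ^ nr.2))).
  by exists a => q y q1 y0; apply: tsumP; apply: s.
apply/funext => -[z tau]; rewrite /jac /=; apply/esym/tsumE.
exact/hsum_cvgP/ha.
Qed.

End Holomorphy.

(** * Power series on the open unit disc *)

Section DiscSeries.
Variable R : realType.
Local Notation C := R[i].
Implicit Types (q y z : C) (F : C -> C) (G : C -> C -> C).

Definition dps F : Prop := exists a : nat -> C,
  forall q, nrm q < 1 -> hsum (fun n => a n * q ^+ n) (F q).

Lemma dps_lau F : dps F -> lau (fun q _ => F q).
Proof.
case=> a ha; apply: (@lau_push R _ a id (fun=> 0)) => q y q1 _.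
by apply: eq_hsum (ha q q1) => n; rewrite expr0z mulr1.
Qed.

Lemma lau_dps G y : lau G -> y != 0 -> dps (fun q => G q y).
Proof.
case=> a ha y0.
have h2 : nrm (2^-1 : C) < 1 by rewrite nrmV nrm_nat invf_lt1 ?ltr1n.
pose c n := tsum (fun r => a (n, r) * y ^ r).
have sc n : summ (fun r => a (n, r) * y ^ r).
  have I1 : injective (fun r : int => (n, r)) by move=> ? ? [].
  have h := summ_inj I1 (hsum_summ (ha _ y h2 y0)).
  apply: summ_dom (summZ ((2%:R : C) ^+ n) h) => r /=.
  by rewrite mulrCA [_ ^+ n * (_ * _)]mulrA -exprMn mulfV ?pnatr_eq0 // expr1n mul1r.
exists c => q q1.
apply: (hsum_fst (ha q y q1 y0)) => n /=.
rewrite [X in hsum _ X]mulrC; apply: eq_hsum (hsumZ (q ^+ n) (tsumP (sc n))) => r.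
by rewrite mulrCA.
Qed.

Lemma dps_psd F r : dps F -> 0 < r -> r < 1 -> psd r F.
Proof.
by move=> /dps_lau h r0 r1; apply: (lau_psd h (oner_neq0 _)).
Qed.

Lemma dps_eq F F' : (forall q, nrm q < 1 -> F q = F' q) -> dps F -> dps F'.
Proof. by move=> E [a ha]; exists a => q q1; rewrite -E //; apply: ha. Qed.

Lemma dpsD F F' : dps F -> dps F' -> dps (fun q => F q + F' q).
Proof.
by move=> /dps_lau h /dps_lau h'; apply: (lau_dps (lauD h h') (oner_neq0 _)).
Qed.

Lemma dpsM F F' : dps F -> dps F' -> dps (fun q => F q * F' q).
Proof.
by move=> /dps_lau h /dps_lau h'; apply: (lau_dps (lauM h h') (oner_neq0 _)).
Qed.

Lemma dps_cst c : dps (fun=> c).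
Proof. exact: (lau_dps (lau_cst c) (oner_neq0 _)). Qed.

Lemma dps_id : dps id.
Proof.
apply: dps_eq (lau_dps (lau_mono 1 1 0) (oner_neq0 _)) => q _.
by rewrite mul1r expr1 expr0z mulr1.
Qed.

Lemma dpsX F n : dps F -> dps (fun q => F q ^+ n).
Proof. by move=> /dps_lau h; apply: (lau_dps (lauX n h) (oner_neq0 _)). Qed.

Lemma dpsZ c F : dps F -> dps (fun q => c * F q).
Proof. by move=> h; apply: dpsM => //; apply: dps_cst. Qed.

Lemma dpsB F F' : dps F -> dps F' -> dps (fun q => F q - F' q).
Proof.
move=> h h'; apply: dps_eq (dpsD h (dpsZ (-1) h')) => q _.
by rewrite mulN1r.
Qed.

Lemma dps_sum (I : Type) (s : seq I) (P : pred I) (F : I -> C -> C) :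
  (forall i, dps (F i)) -> dps (fun q => \sum_(i <- s | P i) F i q).
Proof.
move=> hF; elim: s => [|i s IH].
  by apply: dps_eq (dps_cst 0) => q _; rewrite big_nil.
case Pi : (P i); last by apply: dps_eq IH => q _; rewrite big_cons Pi.
by apply: dps_eq (dpsD (hF i) IH) => q _; rewrite big_cons Pi.
Qed.

Lemma dps_prod (I : Type) (s : seq I) (P : pred I) (F : I -> C -> C) :
  (forall i, dps (F i)) -> dps (fun q => \prod_(i <- s | P i) F i q).
Proof.
move=> hF; elim: s => [|i s IH].
  by apply: dps_eq (dps_cst 1) => q _; rewrite big_nil.
case Pi : (P i); last by apply: dps_eq IH => q _; rewrite big_cons Pi.
by apply: dps_eq (dpsM (hF i) IH) => q _; rewrite big_cons Pi.
Qed.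

Lemma dps_det n (M : 'I_n -> 'I_n -> C -> C) : (forall i j, dps (M i j)) ->
  dps (fun q => \det (\matrix_(i, j) M i j q)).
Proof.
move=> h; rewrite /determinant; apply: dps_sum => s.
apply: dpsZ; apply: dps_prod => i.
under eq_fun do rewrite mxE.
exact: h.
Qed.

Lemma dps_adj n (M : 'I_n -> 'I_n -> C -> C) i0 j0 : (forall i j, dps (M i j)) ->
  dps (fun q => (\adj (\matrix_(i, j) M i j q)) i0 j0).
Proof.
move=> h; pose N i j := M (lift j0 i) (lift i0 j).
have hN i j : dps (N i j) by apply: h.
apply: dps_eq (dpsZ ((-1) ^+ (j0 + i0)) (dps_det hN)) => q _.
rewrite mxE /cofactor; congr (_ * \det _).
by apply/matrixP => i j; rewrite !mxE.
Qed.

(** Identities between disc series extend to the puncture. *)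
Lemma dps_at0 F F' : dps F -> dps F' ->
  (forall q, nrm q < 1 -> q != 0 -> F q = F' q) -> F 0 = F' 0.
Proof.
move=> h h' E; apply/eqP; rewrite -subr_eq0; apply/eqP.
have r0 : 0 < 2^-1 :> R by [].
have r1 : 2^-1 < 1 :> R by rewrite invf_lt1 ?ltr1n.
have n0 : nrm (0 : C) < 2^-1 by rewrite nrm0.
have [K K0 hK] := psd_lip r0 n0 (dps_psd (dpsB h h') r0 r1).
apply: nrm_small => e e0; pose m := Num.min 2^-1 (e / K).
have m0 : 0 < m by rewrite lt_min r0 divr_gt0.
have nm : nrm (m%:C) = m by rewrite nrm_real gtr0_norm.
have m2 : nrm (m%:C) <= 2^-1 by rewrite nm ge_min lexx.
have := hK m%:C m2; rewrite subr0 nm (E m%:C); last 2 first.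
- by apply: le_lt_trans m2 r1.
- exact: realC_neq0.
rewrite subrr sub0r nrmN => h1; apply: le_trans h1 _.
by rewrite mulrC -ler_pdivlMr // ge_min lexx orbT.
Qed.

Lemma dps_shift F : dps F -> F 0 = 0 ->
  exists2 F', dps F' & forall q, nrm q < 1 -> F q = q * F' q.
Proof.
case=> a ha F0.
have n0 : nrm (0 : C) < 1 by rewrite nrm0.
have a0 : a 0%N = 0.
  rewrite -F0; apply: hsum_uniq (ha 0 n0); rewrite -[X in hsum _ X]mulr1.
  apply: (@hsum1 R _ (fun n => a n * 0 ^+ n) 0%N) => -[|n] // _.
  by rewrite exprS mul0r mulr0.
pose G q := if q == 0 then a 1%N else F q / q.
exists G => [|q q1]; last first.
  by rewrite /G; case: eqVneq => [->|q0]; rewrite ?mul0r ?F0 // mulrCA mulfV ?mulr1.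
exists (fun n => a n.+1) => q q1; rewrite /G; case: eqVneq => [->|q0].
  have E : a 1%N * 0 ^+ 0 = a 1%N by rewrite mulr1.
  rewrite -[X in hsum _ X]E.
  apply: (@hsum1 R _ (fun n => a n.+1 * 0 ^+ n) 0%N) => -[|n] // _.
  by rewrite exprS mul0r mulr0.
have := hsum_shift (ha q q1); rewrite a0 mul0r subr0 => /(hsumZ q^-1) h.
rewrite mulrC; apply: eq_hsum h => n.
by rewrite exprS; field.
Qed.

End DiscSeries.

(** * Even functions of index k over the disc *)

Section Index.
Variable R : realType.
Local Notation C := R[i].
Implicit Types (q y z : C) (G : C -> C -> C) (k : nat).

(** Even functions with the elliptic transformation law of index k, expressed in
    q and y. *)
Definition quasi k G : Prop := forall q y, nrm q < 1 -> q != 0 -> y != 0 ->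
  G q (q * y) = (q ^+ k * y ^+ (2 * k))^-1 * G q y /\ G q y^-1 = G q y.

Lemma quasiM k l G H : quasi k G -> quasi l H ->
  quasi (k + l) (fun q y => G q y * H q y).
Proof.
move=> hG hH q y q1 q0 y0.
have [-> ->] := hG q y q1 q0 y0; have [-> ->] := hH q y q1 q0 y0; split=> //.
by rewrite mulnDr !exprD; field; rewrite !expf_neq0.
Qed.

Lemma quasiX k G n : quasi k G -> quasi (k * n) (fun q y => G q y ^+ n).
Proof.
move=> hG; elim: n => [|n IH] q y q1 q0 y0.
  by rewrite !muln0 !expr0 mul1r invr1 mul1r.
by rewrite mulnS !(exprS (G _ _)); apply: quasiM hG IH q y q1 q0 y0.
Qed.

Lemma quasi_Aq : quasi 1 (@Aq R).
Proof.
by move=> q y q1 q0 y0; rewrite muln1 expr1 Aq_inv Aq_shift.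
Qed.

(** At q = 0 the functional equations are void, and the relations follow by
    continuity, as both sides are disc series. *)
Lemma quasi_coefs k G (a : nat * int -> C) :
  (forall q y, nrm q < 1 -> y != 0 ->
     hsum (fun nr => a nr * (q ^+ nr.1 * y ^ nr.2)) (G q y)) ->
  quasi k G -> forall q, nrm q < 1 ->
  index_coefs k q (fun r => tsum (fun n => a (n, r) * q ^+ n)).
Proof.
move=> ha qG.
pose c q r := tsum (fun n => a (n, r) * q ^+ n).
have cd r : dps (fun q => c q r).
  by exists (fun n => a (n, r)) => q q1; have [h _] := laurent_lau ha q1; apply: h.
have V q : nrm q < 1 -> q != 0 -> index_coefs k q (c q).
  move=> q1 q0; have [_ h] := laurent_lau ha q1.
  by apply: (index_coefs_fun q0 h) => y y0; have [] := qG q y q1 q0 y0.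
move=> q q1; have [q0|q0] := eqVneq q 0; last exact: V.
rewrite q0 -/(c 0); split=> [r|r n rn].
  apply: (dps_at0 (F := fun q => c q (- r)) (F' := fun q => c q r)) => // p p1 p0.
  by have [h _] := V p p1 p0.
apply: (dps_at0 (F := fun q => c q (r + 2 * k%:Z)) (F' := fun q => q ^+ n * c q r)).
- exact: cd.
- by apply: dpsM => //; apply: dpsX; apply: dps_id.
by move=> p p1 p0; have [_ h] := V p p1 p0; apply: h.
Qed.

(** Over the whole disc the coordinates of F in the basis P^j Q^(k-j) are
    quotients of disc series with the common denominator D, the determinant of
    the coefficient matrix, which has no zero. *)
Lemma quasi_repr (P Q : C -> C -> C) k F :
  lau P -> lau Q -> quasi 1 P -> quasi 1 Q ->
  (forall q, nrm q < 1 -> forall e : R, 0 < e -> exists y,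
     [/\ y != 0, P q y != 0, Q q y != 0 & nrm (P q y / Q q y) <= e]) ->
  lau F -> quasi k F ->
  exists (D : C -> C) (N : 'I_k.+1 -> C -> C),
    [/\ dps D, forall j, dps (N j), forall q, nrm q < 1 -> D q != 0 &
     forall q y, nrm q < 1 -> y != 0 ->
       F q y = \sum_(j < k.+1) N j q / D q * (P q y ^+ j * Q q y ^+ (k - j))].
Proof.
move=> lP lQ qP qQ hPQ lF qF.
have lG (j : 'I_k.+1) : lau (fun q y => P q y ^+ j * Q q y ^+ (k - j)).
  by apply: lauM; apply: lauX.
have qG (j : 'I_k.+1) : quasi k (fun q y => P q y ^+ j * Q q y ^+ (k - j)).
  have jk : (j <= k)%N by rewrite -ltnS.
  have := quasiM (quasiX j qP) (quasiX (k - j) qQ).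
  by rewrite !mul1n subnKC.
have [a ha] := choice lG.
have [b hb] := lF.
pose cs q j r := tsum (fun n => a j (n, r) * q ^+ n).
pose c q r := tsum (fun n => b (n, r) * q ^+ n).
have csd j r : dps (fun q => cs q j r).
  by exists (fun n => a j (n, r)) => q q1; have [h _] := laurent_lau (ha j) q1; apply: h.
have cd r : dps (fun q => c q r).
  by exists (fun n => b (n, r)) => q q1; have [h _] := laurent_lau hb q1; apply: h.
pose M q := span_mx (cs q).
pose N (j : 'I_k.+1) q := \sum_(r < k.+1) c q (r : nat)%:Z * (\adj (M q)) r j.
have csP q : nrm q < 1 -> forall j, laurent (cs q j) (fun y => P q y ^+ j * Q q y ^+ (k - j)).
  by move=> q1 j; have [_ h] := laurent_lau (ha j) q1.
have csV q : nrm q < 1 -> forall j, index_coefs k q (cs q j).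
  by move=> q1 j; apply: (quasi_coefs (ha j)).
have D0 q : nrm q < 1 -> \det (M q) != 0.
  by move=> q1; apply: (span_det q1 (csP q q1) (csV q q1) (hPQ q q1)).
exists (fun q => \det (M q)), N; split=> //.
- by apply: (dps_det (M := fun j r q => cs q j (r : nat)%:Z)).
- move=> j; apply: dps_sum => r; apply: dpsM; first exact: cd.
  by apply: (dps_adj (M := fun j r q => cs q j (r : nat)%:Z)).
move=> q y q1 y0.
have [_ hF] := laurent_lau hb q1.
rewrite (span_repr q1 (csP q q1) (csV q q1) (hPQ q q1) hF (quasi_coefs hb qF q1) y0).
apply: eq_bigr => j _; congr (_ * _).
rewrite /invmx unitmxE unitfE D0 // -scalemxAr !mxE mulrC; congr (_ / _).
by apply: eq_bigr => r _; rewrite mxE.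
Qed.

End Index.

(** * Weak Jacobi forms from symmetric polynomials *)

Section Generators.
Variable R : realType.
Local Notation C := R[i].
Implicit Types (p q y z : C) (F : C -> C -> C -> C) (k : nat).

Definition Gp F p y : C := F (x01 (p ^+ 2) y) (x10 p y) (x10 (- p) y).

(** Substituting the three half-period functions in a polynomial F. For symmetric
    F the two square roots of q give the same value, so Gq F is a series in q,
    not only in its square root. *)
Definition Gq F q y : C := Gp F (sqrtc q) y.

(** What is used of a symmetric homogeneous polynomial of degree k in three
    variables. Symmetry under two transpositions implies full symmetry. *)
Record sympoly k F : Prop := Sympoly {
  sym12 : forall x y z, F x y z = F y x z;
  sym23 : forall x y z, F x y z = F x z y;
  homog : forall c x y z, F (c * x) (c * y) (c * z) = c ^+ k * F x y z;
  lauF : forall G1 G2 G3, lau G1 -> lau G2 -> lau G3 ->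
    lau (fun q y => F (G1 q y) (G2 q y) (G3 q y))
}.

Lemma Gq_sqr k F p y : sympoly k F -> Gq F (p ^+ 2) y = Gp F p y.
Proof.
move=> hF; have /eqP : (sqrtc (p ^+ 2) - p) * (sqrtc (p ^+ 2) + p) = 0.
  by rewrite -subr_sqr sqr_sqrtc subrr.
rewrite mulf_eq0 subr_eq0 addr_eq0 /Gq => /orP[/eqP->//|/eqP->].
by rewrite /Gp sqrrN opprK (sym23 hF).
Qed.

Lemma lau_Gp k F : sympoly k F -> lau (Gp F).
Proof.
move=> hF; apply: (lauF hF); [exact: lau_x01_sqr|exact: lau_x10|].
exact: (lau_opp (@lau_x10 R)).
Qed.

Lemma lau_Gq k F : sympoly k F -> lau (Gq F).
Proof.
move=> hF; have [H lH HE] : exists2 H, lau H & forall q y, nrm q < 1 -> y != 0 ->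
    H (q ^+ 2) y = Gp F q y.
  apply: lau_even; first exact: (lau_Gp hF).
  by move=> q y _ _; rewrite /Gp sqrrN opprK (sym23 hF).
apply: lau_eq lH => q y q1 y0.
rewrite /Gq -HE ?sqr_sqrtc //.
by rewrite -(@expr_lt1 _ 2) ?nrm_ge0 // -nrmX sqr_sqrtc.
Qed.

Lemma Gq_XT k F (tau : R[i]) z : in_upper tau -> sympoly k F ->
  Gq F (e2pi tau) (e2pi z) = F (XT 0 1 tau z) (XT 1 0 tau z) (XT 1 1 tau z).
Proof.
move=> t0 hF; rewrite XT01 // XT10 // XT11 // -[in LHS]e2pi_halfE (Gq_sqr _ _ hF).
by rewrite /Gp e2pi_halfE.
Qed.

(** SL2(Z) permutes the three nonzero classes modulo 2, by all of its six
    permutations. *)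
Lemma XT_perm k F (a b c e : int) (tau : R[i]) z : in_upper tau ->
  a * e - b * c = 1 -> sympoly k F ->
  F (XT c e tau z) (XT a b tau z) (XT (a + c) (b + e) tau z) =
  F (XT 0 1 tau z) (XT 1 0 tau z) (XT 1 1 tau z).
Proof.
move=> t0 det1 hF; have s12 := sym12 hF; have s23 := sym23 hF.
have par (i : int) : (i %% 2)%Z = 0 \/ (i %% 2)%Z = 1 by lia.
have det2 : ((a %% 2)%Z * (e %% 2)%Z != (b %% 2)%Z * (c %% 2)%Z)%R.
  apply/eqP => E; have : ((a * e) %% 2)%Z = ((b * c) %% 2)%Z.
    by rewrite -(modzMm a) -(modzMm b) E.
  lia.
rewrite (XT_parity c) // (XT_parity a) // (XT_parity (a + c)) //.
rewrite -(modzDm a) -(modzDm b).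
move: det2; case: (par a) => ->; case: (par b) => ->; case: (par c) => ->;
  case: (par e) => -> //= _.
all: first [by rewrite s12|by rewrite s23|by rewrite s23 s12|by rewrite s12 s23
  |by rewrite s12 s23 s12].
Qed.

Lemma Gq_elliptic k F : sympoly k F -> elliptic_law k (jac (Gq F)).
Proof.
move=> hF l m z tau; have t0 : in_upper (val tau) := valP tau.
rewrite /jac /= !(Gq_XT _ t0 hF) !XT_elliptic // (homog hF) -e2piMn; congr (e2pi _ * _).
by rewrite mulrN.
Qed.

Lemma Gq_modular k F : sympoly k F -> modular_law k (jac (Gq F)).
Proof.
move=> hF a b c e det1 z tau; have t0 : in_upper (val tau) := valP tau.
rewrite /jac /= !(Gq_XT _ _ hF) //; last exact: (valP (SL2_act det1 tau)).
rewrite !XT_modular // (homog hF) -e2piMn; congr (e2pi _ * _); first by ring.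
by rewrite !mul0r !mul1r !add0r !addr0 -(XT_perm z t0 det1 hF).
Qed.

Lemma Gq_jacobi k F : sympoly k F -> weak_jacobi_form k (jac (Gq F)).
Proof.
move=> hF; split.
- exact: lau_holomorphic (lau_Gq hF).
- exact: Gq_modular.
- exact: Gq_elliptic.
- exact: lau_fourier (lau_Gq hF).
Qed.

(** Evenness is the modular law for the matrix -1, which acts trivially on H and
    maps z to -z. *)
Lemma jacobi_quasi k (G : C -> C -> C) :
  elliptic_law k (jac G) -> modular_law k (jac G) -> quasi k G.
Proof.
move=> hE hM q y q1 q0 y0.
have [tau tauE] := e2pi_upper_surj q0 q1.
have [z zE] := e2pi_surj y0.
split.
  have := hE 1 0 z tau; rewrite /jac /= addr0 mul1r e2piD tauE zE [y * q]mulrC => ->.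
  by rewrite expr1n mul1r mulr1 e2piN e2piMn e2piD tauE e2piMn zE exprMn exprM.
have det1 : (-1) * (-1) - 0 * 0 = 1 :> int by [].
have tE : SL2_act det1 tau = tau.
  by apply/val_inj; rewrite /= /moebius !mul0r !add0r addr0; field.
have := hM (-1) 0 0 (-1) det1 z tau; rewrite tE /jac /= tauE mul0r add0r zE.
rewrite invrN invr1 mulrN1 e2piN zE => ->.
by rewrite mulr0 !mul0r e2pi0 mul1r.
Qed.

(** The first generator is the sum of the three half-period functions; it is 3 at
    z = 0, where A vanishes. *)
Definition Bf x y z : C := x + y + z.
(** Each half-period function is a common multiple of A times wp(z) - e_i, so
    that the differences are multiples of A by e_j - e_i: C2f, C3f and Df give,
    up to constants, the invariants g2 and g3 and the discriminant of the
    Weierstrass cubic. *)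
Definition C2f x y z : C := (x - y) ^+ 2 + (y - z) ^+ 2 + (z - x) ^+ 2.
Definition C3f x y z : C := (2 * x - y - z) * (2 * y - x - z) * (2 * z - x - y).
Definition Df x y z : C := ((x - y) * (y - z) * (z - x)) ^+ 2.

Lemma sympoly_B : sympoly 1 Bf.
Proof.
split=> [x y z|x y z|c x y z|G1 G2 G3 h1 h2 h3]; rewrite /Bf; try by ring.
by do 2![apply: lauD => //].
Qed.

Lemma sympoly_C2 : sympoly 2 C2f.
Proof.
split=> [x y z|x y z|c x y z|G1 G2 G3 h1 h2 h3]; rewrite /C2f; try by ring.
by apply: lauD; first apply: lauD; apply: lauX; apply: lauB.
Qed.

Lemma sympoly_C3 : sympoly 3 C3f.
Proof.
split=> [x y z|x y z|c x y z|G1 G2 G3 h1 h2 h3]; rewrite /C3f; try by ring.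
by apply: lauM; first apply: lauM; do 2![apply: lauB => //]; apply: lauZ.
Qed.

Lemma sympoly_D : sympoly 6 Df.
Proof.
split=> [x y z|x y z|c x y z|G1 G2 G3 h1 h2 h3]; rewrite /Df; try by ring.
by apply: lauX; apply: lauM; first apply: lauM; apply: lauB.
Qed.

Lemma x01_at1 q : nrm q < 1 -> x01 q 1 = 1.
Proof.
move=> q1; rewrite /x01 invr1 !mulr1.
have -> : (1 + 2 + 1) / 4 = 1 :> C by field.
rewrite mul1r -exprD -exprMn Phi_euler // expr1n //.
Qed.

Lemma x01_atN1 q : x01 q (-1) = 0.
Proof. by rewrite /x01 invrN invr1 (_ : -1 + 2 - 1 = 0) ?mul0r //; ring. Qed.

Lemma x10_at1 p : nrm p < 1 -> x10 p 1 = 1.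
Proof.
move=> p1; rewrite /x10 mulr1 divr1 -exprD mulrC -exprMn Phi_euler // expr1n //.
Qed.

Lemma Gq_at1 F q : nrm q < 1 -> Gq F q 1 = F 1 1 1.
Proof.
move=> q1; have s1 : nrm (sqrtc q) < 1.
  by rewrite -(@expr_lt1 _ 2) ?nrm_ge0 // -nrmX sqr_sqrtc.
by rewrite /Gq /Gp x01_at1 ?x10_at1 ?nrmN ?sqr_lt1.
Qed.

Lemma x10_atp p : nrm p < 1 -> p != 0 -> x10 p p = 0.
Proof.
move=> p1 p0; rewrite /x10 divff // (_ : Phi (p ^+ 2) (- 1) = 0).
  by rewrite expr0n mulr0 mul0r.
by rewrite (Phi_rec (-1) (sqr_lt1 p1)) subrr mul0r.
Qed.

Lemma quasi_x01 : quasi 1 (@x01 R).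
Proof.
move=> q y q1 q0 y0; rewrite muln1 expr1; split; last by rewrite /x01 invrK; ring.
rewrite /x01.
have E1 := Phi_rec (q * y) q1.
have E3 : q / (q * y) = y^-1 by field; rewrite y0 q0.
have E2 := Phi_rec y^-1 q1.
rewrite E3 E2 E1.
move: (Phi q (q * (q * y))) (Phi q (q / y)) (Phi (q ^+ 2) (- q)) => P Q W.
by field; rewrite y0 q0.
Qed.

Lemma x10_shift p y : nrm p < 1 -> p != 0 -> y != 0 ->
  x10 p (p ^+ 2 * y) = (p ^+ 2 * y ^+ 2)^-1 * x10 p y.
Proof.
move=> p1 p0 y0; rewrite /x10.
have q1 := sqr_lt1 p1.
have E1 := Phi_rec (- (p * y)) q1; rewrite mulrN in E1.
have A1 : p * (p ^+ 2 * y) = p ^+ 2 * (p * y) by ring.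
have A2 : p / (p ^+ 2 * y) = (p * y)^-1 by field; rewrite y0 p0.
have E2 := Phi_rec (- (p * y)^-1) q1; rewrite mulrN in E2.
have A3 : p ^+ 2 / (p * y) = p / y by field; rewrite y0 p0.
rewrite A1 A2 E2 A3 E1.
move: (Phi _ (- (p ^+ 2 * (p * y)))) (Phi _ (- (p / y))) (Phi p p) => P Q W.
by field; rewrite y0 p0.
Qed.

Lemma x10_inv p y : x10 p y^-1 = x10 p y.
Proof. by rewrite /x10 invrK; ring. Qed.

End Generators.

(** * Differences of the half-period functions *)

Section Differences.
Variable R : realType.
Local Notation C := R[i].
Implicit Types (p q y z : C) (F : C -> C -> C -> C) (k : nat).

Lemma lau_laurent (G : C -> C -> C) q : lau G -> nrm q < 1 -> exists c, laurent c (G q).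
Proof.
by case=> a ha q1; have [_ h] := laurent_lau ha q1; eexists; exact: h.
Qed.

(** As y = e(t) tends to 1 along the unit circle, A tends to 0 without vanishing
    and Q does not. This makes comb_eq0 applicable. *)
Lemma Aq_ratio q (Q : C -> C) (c : int -> C) : nrm q < 1 -> laurent c Q -> Q 1 != 0 ->
  forall e : R, 0 < e -> exists y, [/\ y != 0, Aq q y != 0, Q y != 0 &
    nrm (Aq q y / Q y) <= e].
Proof.
move=> q1 hQ Q1 e e0; have [cA hA] := lau_laurent (@lau_Aq R) q1.
have n01 : nrm (0 : C) < 1 by rewrite nrm0.
have cc g d : laurent d g -> ccont (fun z => g (e2pi z)) 0.
  by move=> hg; apply: (psd_ccont ltr01 n01); apply: psd_laurent hg ltr01.
have Q1' : Q (e2pi 0) != 0 by rewrite e2pi0.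
have [d d0 hd] := ccont_div (cc _ _ hA) (cc _ _ hQ) Q1' e0.
have [d' d'0 hd'] := ccont_nz (cc _ _ hQ) Q1'.
pose t := Num.min (Num.min d d') 2^-1.
have t0 : 0 < t by rewrite !lt_min d0 d'0 invr_gt0 ltr0n.
have [td [td' t2]] : t <= d /\ t <= d' /\ t <= 2^-1.
  by rewrite /t !ge_min !lexx !orbT.
have nt : nrm (t%:C - 0) = t by rewrite subr0 nrm_real gtr0_norm.
have ny : nrm (e2pi t%:C) = 1 by rewrite nrm_e2pi /= mulr0 oppr0 expR0.
exists (e2pi t%:C); split.
- exact: e2pi_neq0.
- have yq : nrm (q / e2pi t%:C) < 1 by rewrite (nrmM q) nrmV ny invr1 mulr1.
  have qy : nrm (q * e2pi t%:C) < 1 by rewrite (nrmM q) ny mulr1.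
  apply: Aq_neq0 => //; first exact: e2pi_neq0.
  apply/eqP => h; have := t0.
  rewrite (e2pi_real_eq1 _ h) ?ltxx //.
  by rewrite gtr0_norm.
- have := hd' t%:C; rewrite nt => /(_ td'); apply: contraTneq => ->.
  by rewrite nrm0 -ltNge divr_gt0 // nrm_gt0.
- have := hd t%:C; rewrite nt => /(_ td).
  by rewrite e2pi0 Aq1 mul0r subr0.
Qed.

Lemma AqN1_neq0 q : nrm q < 1 -> Aq q (-1) != 0.
Proof.
move=> q1; have n : (-1 : C) != 0 by rewrite oppr_eq0 oner_neq0.
apply: Aq_neq0; rewrite ?mulrN1 ?invrN ?invr1 ?mulrN1 ?nrmN //.
by rewrite eqr_oppLR -subr_eq0 opprK (_ : 1 + 1 = 2%:R) ?pnatr_eq0.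
Qed.

(** The half-period functions differ by multiples of A. The span of x01 and A
    contains x10, both sides being of index 1, and the coordinates are determined
    at y = 1, where A vanishes, and at y = -1, where x01 vanishes. *)
Lemma x10_sub p y : nrm p < 1 -> p != 0 -> y != 0 ->
  (x10 p y - x01 (p ^+ 2) y) * Aq (p ^+ 2) (-1) = x10 p (-1) * Aq (p ^+ 2) y.
Proof.
move=> p1 p0 y0; pose q := p ^+ 2.
have q1 : nrm q < 1 := sqr_lt1 p1.
have q0 : q != 0 by rewrite expf_neq0.
have N1 : (-1 : C) != 0 by rewrite oppr_eq0 oner_neq0.
have [cQ hQ] := lau_laurent (@lau_x01_sqr R) p1; rewrite -/q in hQ.
have [cA hA] := lau_laurent (@lau_Aq R) q1.
have [cX hX] := lau_laurent (@lau_x10 R) p1.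
pose cs (j : 'I_2) := if (j : nat) == 0%N then cQ else cA.
have csP (j : 'I_2) : laurent (cs j) (fun y => Aq q y ^+ j * x01 q y ^+ (1 - j)).
  case: j => -[|[|//]] /= ? w w0; rewrite /cs /= ?mul1r ?mulr1; first exact: hQ.
  exact: hA.
have V g c : laurent c g ->
    (forall y, y != 0 -> g (q * y) = (q * y ^+ 2)^-1 * g y /\ g y^-1 = g y) ->
    index_coefs 1 q c.
  by move=> hc h; apply: (index_coefs_fun q0 hc) => w /h[]; rewrite ?expr1.
have VQ : index_coefs 1 q cQ.
  apply: V hQ _ => w w0; have := quasi_x01 q1 q0 w0; rewrite expr1 //.
have VA : index_coefs 1 q cA.
  apply: V hA _ => w w0; have := quasi_Aq q1 q0 w0; rewrite expr1 //.
have VX : index_coefs 1 q cX.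
  by apply: V hX _ => w w0; rewrite x10_inv x10_shift.
have csV (j : 'I_2) : index_coefs 1 q (cs j) by rewrite /cs; case: ifP.
have x1 : x01 q 1 != 0 by rewrite x01_at1 ?oner_neq0.
have H := span_repr q1 csP csV (Aq_ratio q1 hQ x1) hX VX.
set h := fun j => _ in H.
have {}H w : w != 0 -> x10 p w = h ord0 * x01 q w + h (lift ord0 ord0) * Aq q w.
  move=> w0; rewrite (H w w0) !big_ord_recl big_ord0 addr0 /=.
  by rewrite mul1r mulr1 /bump.
have := H 1 (oner_neq0 _); rewrite x10_at1 // x01_at1 // Aq1 mulr0 addr0 mulr1 => h1.
have := H (-1) N1; rewrite x01_atN1 mulr0 add0r => hN.
by rewrite (H y y0) -h1 hN -/q; ring.
Qed.

Lemma x10N1_neq0 p : nrm p < 1 -> x10 p (-1) != 0.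
Proof.
move=> p1; have q1 := sqr_lt1 p1; have [_ h] := Phi_pp_inv p1.
rewrite /x10 invrN invr1 mulrN1 opprK !mulf_neq0 ?expf_neq0 //.
all: exact: Phi_neq0_small.
Qed.

(** The quotient by p of the difference of x10 and its conjugate at y = -1, in
    closed form: it is a series in p without zeros in the disc, which gives the
    simple zero of the discriminant at the cusp. *)
Definition wdiff p : C := - 4 * Phi (p ^+ 2) (p ^+ 2) ^+ 4 * Phi (- p) (- p) ^+ 4 *
  Phi p p ^+ 4 * Aq (p ^+ 2) (-1).

Lemma Phi_at1 q : nrm q < 1 -> Phi q 1 = 2 * Phi q q.
Proof. by move=> q1; rewrite (Phi_rec 1 q1) mulr1. Qed.

(** The difference of the two conjugates is a multiple of A as a function of y.
    The factor is found at y = p, a zero of x10 p. *)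
Lemma x10N1_sub p : nrm p < 1 -> p != 0 -> x10 p (-1) - x10 (- p) (-1) = p * wdiff p.
Proof.
move=> p1 p0; have q1 := sqr_lt1 p1.
have np1 : nrm (- p) < 1 by rewrite nrmN.
have np0 : - p != 0 by rewrite oppr_eq0.
have E1 := x10_sub p1 p0 p0.
have := x10_sub np1 np0 p0; rewrite sqrrN => E2.
have [Ei P0] := Phi_pp_inv p1.
have X2 : x10 (- p) p = 4 * Phi (p ^+ 2) (p ^+ 2) ^+ 4 * Phi (- p) (- p) ^+ 4.
  rewrite /x10 sqrrN !mulNr !opprK divff // Phi_at1 // -expr2.
  by move: (Phi _ _) (Phi _ _) => u v; ring.
have AE : Aq (p ^+ 2) p = p^-1 / Phi p p ^+ 4.
  rewrite /Aq (_ : p ^+ 2 / p = p) ?Ei; last by field.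
  have := Phi_rec (- p) q1; rewrite Ei mulrN => E.
  have -> : (p - 2 + p^-1) = (1 - p) ^+ 2 / p by field.
  transitivity (p^-1 * ((1 - p) * Phi (p ^+ 2) (- (p ^+ 2 * p))) ^+ 2 * (Phi p p)^-1 ^+ 2).
    by move: (Phi _ _) (Phi _ _) => u v; ring.
  by rewrite -E; field; rewrite p0 P0.
apply: (mulIf (_ : Aq (p ^+ 2) p != 0)).
  by rewrite AE mulf_neq0 ?invr_eq0 ?expf_neq0.
rewrite mulrBl -E1 -E2 x10_atp // X2 AE /wdiff.
move: (Phi (p ^+ 2) (p ^+ 2)) (Phi (- p) (- p)) (x01 _ _) (Aq _ _) => u v w t.
by field; rewrite P0 p0.
Qed.

End Differences.

(** * Modular forms from polynomials in the differences *)

Section ModularForms.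
Variable R : realType.
Local Notation C := R[i].
Implicit Types (p q y z : C) (F : C -> C -> C -> C) (H N D : C -> C) (k : nat).

Lemma nrm_sqrtc q : nrm q < 1 -> nrm (sqrtc q) < 1.
Proof.
by move=> q1; rewrite -(@expr_lt1 _ 2) ?nrm_ge0 // -nrmX sqr_sqrtc.
Qed.

Definition translation F := forall t x y z, F (t + x) (t + y) (t + z) = F x y z.

(** After translation by x01, the three arguments are 0 and two multiples of A
    with factors independent of y; by homogeneity F is a constant times A^k. The
    case q = 0 follows by continuity. *)
Lemma Gq_AqN1 k F q y : sympoly k F -> translation F -> nrm q < 1 -> y != 0 ->
  Gq F q y * Aq q (-1) ^+ k = Gq F q (-1) * Aq q y ^+ k.
Proof.
move=> hF tF; have N1 : (-1 : C) != 0 by rewrite oppr_eq0 oner_neq0.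
have punct q' w : nrm q' < 1 -> q' != 0 -> w != 0 ->
    Gq F q' w * Aq q' (-1) ^+ k = Gq F q' (-1) * Aq q' w ^+ k.
  move=> q1 q0 w0; rewrite -(sqr_sqrtc q'); set p := sqrtc q'.
  have p1 : nrm p < 1 := nrm_sqrtc q1.
  have p0 : p != 0.
    by apply: contra_neq q0 => p0; rewrite -(sqr_sqrtc q') -/p p0 expr0n.
  rewrite !(Gq_sqr _ _ hF) /Gp mulrC -(homog hF) x01_atN1.
  rewrite -(tF (- (Aq (p ^+ 2) (-1) * x01 (p ^+ 2) w))) addNr.
  have np1 : nrm (- p) < 1 by rewrite nrmN.
  have np0 : - p != 0 by rewrite oppr_eq0.
  have E1 := x10_sub p1 p0 w0.
  have := x10_sub np1 np0 w0; rewrite sqrrN => E2.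
  have -> : - (Aq (p ^+ 2) (-1) * x01 (p ^+ 2) w) + Aq (p ^+ 2) (-1) * x10 p w =
    Aq (p ^+ 2) w * x10 p (-1) by rewrite [RHS]mulrC -E1; ring.
  have -> : - (Aq (p ^+ 2) (-1) * x01 (p ^+ 2) w) + Aq (p ^+ 2) (-1) * x10 (- p) w =
    Aq (p ^+ 2) w * x10 (- p) (-1) by rewrite [RHS]mulrC -E2; ring.
  by rewrite -{1}(mulr0 (Aq (p ^+ 2) w)) (homog hF) mulrC.
move=> q1 y0; have [->|q0] := eqVneq q 0; last exact: punct.
have dG w : w != 0 -> dps (fun q => Gq F q w) by apply: lau_dps (lau_Gq hF).
have dA w : w != 0 -> dps (fun q => Aq q w ^+ k).
  by move=> w0; apply: dpsX; apply: lau_dps (@lau_Aq R) w0.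
by apply: (dps_at0 (dpsM (dG y y0) (dA _ N1)) (dpsM (dG _ N1) (dA y y0))) => q' *; apply: punct.
Qed.

(** The modular form of weight 2k attached to a polynomial F in the differences,
    namely the quotient of Gq F by the k-th power of the normalised A, evaluated
    at y = -1. *)
Definition EF k F q : C := Gq F q (-1) * vq q ^+ (4 * k) / Aq q (-1) ^+ k.

Lemma Gq_EF k F tau z : sympoly k F -> translation F -> in_upper tau ->
  Gq F (e2pi tau) (e2pi z) = EF k F (e2pi tau) * AN tau z ^+ k.
Proof.
move=> hF tF t0; have q1 := e2pi_upper t0.
have A0 := AqN1_neq0 q1; have v0 := vq_neq0 q1.
apply: (mulIf (expf_neq0 k A0)).
rewrite (Gq_AqN1 hF tF q1 (e2pi_neq0 z)) /EF /AN /AT.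
move: (Gq F _ (-1)) (Aq _ (-1)) (Aq _ (e2pi z)) (vq (e2pi tau)) A0 v0 => g a b v a0 v0.
rewrite expr_div_n -exprM; field.
by rewrite !expf_neq0.
Qed.

(** Quotients of disc series without poles in the disc, kept as fractions. *)
Definition qm H : Prop := exists N D, [/\ dps N, dps D, forall q, nrm q < 1 -> D q != 0 &
  forall q, nrm q < 1 -> H q = N q / D q].

(** Holomorphic modular forms of weight w for SL2(Z), as functions of q: the
    value at q = 0 is the value at the cusp. Negative weights are included, for
    the induction on the weight. *)
Definition mf (w : int) H := qm H /\
  forall (a b c e : int) (det1 : a * e - b * c = 1) (tau : upper R),
  H (e2pi (val (SL2_act det1 tau))) = (c%:~R * val tau + e%:~R) ^ w * H (e2pi (val tau)).

Lemma dps_Phi (s t : C) e f : nrm s <= 1 -> (0 < e)%N ->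
  dps (fun q => Phi (s * q ^+ e) (t * q ^+ f)).
Proof.
move=> s1 e0; apply: dps_eq (lau_dps (lau_Phi t f 0 s1 e0) (oner_neq0 _)) => q _.
by rewrite expr0z mulr1.
Qed.

Lemma dps_vq : dps (@vq R).
Proof.
have n1 : nrm (1 : C) <= 1 by rewrite nrm1.
apply: dps_eq (dps_Phi (-1) 1 n1 (ltn0Sn 0)) => q _.
by rewrite expr1 mul1r mulN1r.
Qed.

Lemma dps_AqN1 : dps (fun q : C => Aq q (-1)).
Proof. by apply: (lau_dps (@lau_Aq R)); rewrite oppr_eq0 oner_neq0. Qed.

Lemma dps_GqN1 k F : sympoly k F -> dps (fun q => Gq F q (-1)).
Proof. by move=> hF; apply: (lau_dps (lau_Gq hF)); rewrite oppr_eq0 oner_neq0. Qed.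

Lemma qm_EF k F : sympoly k F -> qm (EF k F).
Proof.
move=> hF; exists (fun q => Gq F q (-1) * vq q ^+ (4 * k)), (fun q => Aq q (-1) ^+ k).
split=> //.
- by apply: dpsM; [apply: dps_GqN1 hF|apply: dpsX; apply: dps_vq].
- by apply: dpsX; apply: dps_AqN1.
- by move=> q q1; rewrite expf_neq0 // AqN1_neq0.
Qed.

Lemma AN_half tau : in_upper tau -> exists z, AN tau z != 0.
Proof.
move=> t0; exists 2^-1; rewrite /AN /AT e2pi_half mulf_neq0 ?AqN1_neq0 ?e2pi_upper //.
by rewrite invr_eq0 expf_neq0 // vq_neq0 // e2pi_upper.
Qed.

(** Compare the transformation laws of Gq F, of weight 0, and of A^k, of weight
    -2k, at a point where A does not vanish. *)
Lemma mf_EF k F : sympoly k F -> translation F -> mf (2 * k)%N (EF k F).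
Proof.
move=> hF tF; split=> [|a b c e det1 tau]; first exact: qm_EF.
have t0 : in_upper (val tau) := valP tau.
have [z Az] := AN_half t0.
have := Gq_modular hF det1 z tau; rewrite /jac /= !(Gq_EF _ hF tF) //; last first.
  exact: (valP (SL2_act det1 tau)).
have := AN_modular det1 tau z => /= ->.
have j0 := cocycle_neq0 det1 t0.
set j := _ + _ in j0 *; set u := e2pi (c%:~R * z ^+ 2 / j).
have -> : e2pi (k%:R * c%:~R * z ^+ 2 / j) = u ^+ k.
  by rewrite /u -e2piMn; congr e2pi; ring.
move: (AN _ z) Az (EF k F _) (EF k F _) => A A0 E1 E2.
have u0 : u != 0 := e2pi_neq0 _.
clearbody u.
rewrite !exprMn exprVn -exprM => E.
apply: (mulIf (expf_neq0 k A0)); apply: (mulfI (expf_neq0 k u0)).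
transitivity (j ^+ (2 * k) * (u ^+ k * (E1 * A ^+ k))); last by rewrite -exprnP; ring.
by rewrite -E; field; rewrite expf_neq0.
Qed.

End ModularForms.

(** * The forms E4, E6 and Delta *)

Section Eisenstein.
Variable R : realType.
Local Notation C := R[i].
Implicit Types (p q y z : C) (F : C -> C -> C -> C) (H N D : C -> C) (k : nat) (u v w : int).

Lemma qm_eq H H' : (forall q, nrm q < 1 -> H q = H' q) -> qm H -> qm H'.
Proof. by move=> E [N [D [hN hD D0 HE]]]; exists N, D; split=> // q q1; rewrite -E ?HE. Qed.

Lemma qm_cst (c : C) : qm (fun=> c).
Proof.
exists (fun=> c), (fun=> 1); split; try exact: dps_cst.
  by move=> *; apply: oner_neq0.
by move=> *; rewrite divr1.
Qed.

Lemma qmD H H' : qm H -> qm H' -> qm (fun q => H q + H' q).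
Proof.
move=> [N [D [hN hD D0 HE]]] [N' [D' [hN' hD' D'0 HE']]].
exists (fun q => N q * D' q + N' q * D q), (fun q => D q * D' q); split.
- by apply: dpsD; apply: dpsM.
- exact: dpsM.
- by move=> q q1; rewrite mulf_neq0 ?D0 ?D'0.
- by move=> q q1; rewrite HE // HE' //; field; rewrite D0 // D'0.
Qed.

Lemma qmM H H' : qm H -> qm H' -> qm (fun q => H q * H' q).
Proof.
move=> [N [D [hN hD D0 HE]]] [N' [D' [hN' hD' D'0 HE']]].
exists (fun q => N q * N' q), (fun q => D q * D' q); split; try exact: dpsM.
- by move=> q q1; rewrite mulf_neq0 ?D0 ?D'0.
- by move=> q q1; rewrite HE // HE' //; field; rewrite D0 // D'0.
Qed.

Lemma mf_eq w H H' : (forall q, nrm q < 1 -> H q = H' q) -> mf w H -> mf w H'.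
Proof.
move=> E [h1 h2]; split; first exact: qm_eq E h1.
move=> a b c e det1 tau.
rewrite -(E _ (e2pi_upper (valP (SL2_act det1 tau)))) h2.
by rewrite (E _ (e2pi_upper (valP tau))).
Qed.

Lemma mfD w H H' : mf w H -> mf w H' -> mf w (fun q => H q + H' q).
Proof.
move=> [h1 h2] [h1' h2']; split; first exact: qmD.
by move=> a b c e det1 tau; rewrite h2 h2' mulrDr.
Qed.

Lemma mfM u v H H' : mf u H -> mf v H' -> mf (u + v) (fun q => H q * H' q).
Proof.
move=> [h1 h2] [h1' h2']; split; first exact: qmM.
move=> a b c e det1 tau; rewrite h2 h2' expfzDr; first by ring.
exact: cocycle_neq0 det1 _ (valP tau).
Qed.

Lemma mf_cst (c : C) : mf 0 (fun=> c).
Proof.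
split; first exact: qm_cst.
by move=> a b e f det1 tau; rewrite expr0z mul1r.
Qed.

Lemma mfZ w c H : mf w H -> mf w (fun q => c * H q).
Proof. by move=> h; have := mfM (mf_cst c) h; rewrite add0r. Qed.

Lemma mfX w H n : mf w H -> mf (w * n%:Z) (fun q => H q ^+ n).
Proof.
move=> h; elim: n => [|n IH].
  by rewrite mulr0; apply: mf_eq (mf_cst 1) => q _; rewrite expr0.
rewrite intS mulrDr mulr1; apply: mf_eq (mfM h IH) => q _.
by rewrite exprS.
Qed.

(** Up to constant factors, the Eisenstein series of weights 4 and 6 and the
    discriminant. *)
Definition E4 : C -> C := EF 2 (@C2f R).
Definition E6 : C -> C := EF 3 (@C3f R).
Definition Delta : C -> C := EF 6 (@Df R).

Lemma translation_C2 : translation (@C2f R). Proof. by move=> *; rewrite /C2f; ring. Qed.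
Lemma translation_C3 : translation (@C3f R). Proof. by move=> *; rewrite /C3f; ring. Qed.
Lemma translation_D : translation (@Df R). Proof. by move=> *; rewrite /Df; ring. Qed.

Lemma mf_E4 : mf 4 E4. Proof. exact: mf_EF (sympoly_C2 R) translation_C2. Qed.
Lemma mf_E6 : mf 6 E6. Proof. exact: mf_EF (sympoly_C3 R) translation_C3. Qed.
Lemma mf_Delta : mf 12 Delta. Proof. exact: mf_EF (sympoly_D R) translation_D. Qed.

Lemma EF_0 k F : sympoly k F -> EF k F 0 = F 0 1 1 / (-4) ^+ k.
Proof.
move=> hF; have n0 : nrm (0 : C) < 1 by rewrite nrm0.
have P0 : Phi (0 : C) 0 = 1 := Phi0 n0.
rewrite /EF /vq oppr0 P0 expr1n mulr1 /Aq !mul0r oppr0 P0 expr1n !mulr1.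
have -> : -1 - 2 + (-1)^-1 = -4 :> C by field.
have E : (0 : C) = 0 ^+ 2 by rewrite expr0n.
rewrite {1}E (Gq_sqr _ _ hF) /Gp -E x01_atN1 oppr0 /x10 -E !mul0r oppr0 P0.
by rewrite !expr1n !mulr1.
Qed.

Lemma E4_0 : E4 0 = 8^-1.
Proof. by rewrite /E4 (EF_0 (sympoly_C2 R)) /C2f; field. Qed.

Lemma E6_0 : E6 0 = 32^-1.
Proof. by rewrite /E6 (EF_0 (sympoly_C3 R)) /C3f; field. Qed.

(** The discriminant of a cubic in terms of its two invariants. *)
Lemma Df_C2_C3 x y z : C2f x y z ^+ 3 / 2 = C3f x y z ^+ 2 + 27 * Df x y z :> C.
Proof. by rewrite /C2f /C3f /Df; field. Qed.

Lemma Delta_E4_E6 q : nrm q < 1 -> E4 q ^+ 3 / 2 = E6 q ^+ 2 + 27 * Delta q.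
Proof.
move=> q1; have A0 := AqN1_neq0 q1.
rewrite /E4 /E6 /Delta /EF.
have := Df_C2_C3 (x01 (sqrtc q ^+ 2) (-1)) (x10 (sqrtc q) (-1)) (x10 (- sqrtc q) (-1)).
rewrite -!/(Gp _ _ _) -!/(Gq _ _ _).
move: (Gq _ _ _) (Gq _ _ _) (Gq _ _ _) (Aq _ _) (vq q) A0 => a b c d v d0 E.
transitivity (c ^+ 3 / 2 * v ^+ 24 / d ^+ 6); first by field; rewrite d0.
by rewrite E; field; rewrite d0.
Qed.

(** The discriminant has a simple zero at the cusp and no other zero: with q =
    p^2 it is the square of the product of the three differences at y = -1, one
    of which is p times the unit wdiff and the two others of which are units. *)
Lemma Delta_shift : exists N D, [/\ dps N, dps D,
  forall q, nrm q < 1 -> N q != 0 /\ D q != 0 &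
  forall q, nrm q < 1 -> Delta q = q * N q / D q].
Proof.
pose G q := Gq (@Df R) q (-1) * vq q ^+ (4 * 6).
have n0 : nrm (0 : C) < 1 by rewrite nrm0.
have dG : dps G by apply: dpsM; [apply: dps_GqN1 (sympoly_D R)|apply: dpsX; apply: dps_vq].
have GE p : G (p ^+ 2) = vq (p ^+ 2) ^+ (4 * 6) *
    (x10 p (-1) * x10 (- p) (-1) * (x10 p (-1) - x10 (- p) (-1))) ^+ 2.
  by rewrite /G (Gq_sqr _ _ (sympoly_D R)) /Gp x01_atN1 /Df; ring.
have n1 : nrm (1 : C) <= 1 by rewrite nrm1.
have N1 : (-1 : C) != 0 by rewrite oppr_eq0 oner_neq0.
have [N dN GN] : exists2 N, dps N & forall q, nrm q < 1 -> G q = q * N q.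
  apply: dps_shift => //.
  have := GE 0; rewrite expr0n oppr0 => ->; ring.
have sq (f : C -> C) : dps f -> dps (fun p : C => f (p ^+ 2)).
  case=> a ha; have l : lau (fun p _ => f (p ^+ 2)).
    apply: (@lau_push R _ a (fun n => (2 * n)%N) (fun=> 0)) => q y q1 _.
    by apply: eq_hsum (ha _ (sqr_lt1 q1)) => n; rewrite expr0z mulr1 exprM.
  exact: lau_dps l (oner_neq0 _).
have opp (f : C -> C) : dps f -> dps (fun p : C => f (- p)).
  by move=> /dps_lau/lau_opp/lau_dps; apply; apply: (oner_neq0 _).
have dP : dps (fun p : C => Phi p p).
  by apply: dps_eq (dps_Phi 1 1 n1 (ltn0Sn 0)) => q _; rewrite expr1 mul1r.
have dx : dps (fun p => x10 p (-1)) := lau_dps (@lau_x10 R) N1.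
have dw : dps (@wdiff R).
  apply: dpsM; first apply: dpsM; first apply: dpsM; first apply: dpsM.
  - exact: dps_cst.
  - by apply: dpsX; apply: (sq (fun p => Phi p p)).
  - by apply: dpsX; apply: (opp (fun p => Phi p p)).
  - exact: dpsX.
  - by apply: (sq (fun q => Aq q (-1))); apply: dps_AqN1.
pose V p := (x10 p (-1) * x10 (- p) (-1) * wdiff p) ^+ 2 * vq (p ^+ 2) ^+ (4 * 6).
have dV : dps V.
  apply: dpsM; last by apply: dpsX; apply: (sq (@vq R)); apply: dps_vq.
  by apply: dpsX; apply: dpsM => //; apply: dpsM => //; apply: (opp (fun p => x10 p (-1))).
have NV p : nrm p < 1 -> p != 0 -> N (p ^+ 2) = V p.
  move=> p1 p0; apply: (mulfI (expf_neq0 2 p0)).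
  by rewrite -GN ?sqr_lt1 // GE x10N1_sub // /V; ring.
have w0 p : nrm p < 1 -> wdiff p != 0.
  move=> p1; have np1 : nrm (- p) < 1 by rewrite nrmN.
  have [_ h1] := Phi_pp_inv p1; have [_ h2] := Phi_pp_inv np1.
  have [_ h3] := Phi_pp_inv (sqr_lt1 p1).
  rewrite /wdiff; move: (Aq _ _) (AqN1_neq0 (sqr_lt1 p1)) => A A0.
  by rewrite !mulf_neq0 ?expf_neq0 // oppr_eq0 pnatr_eq0.
have V0 p : nrm p < 1 -> V p != 0.
  move=> p1; have np1 : nrm (- p) < 1 by rewrite nrmN.
  apply: mulf_neq0; last exact: expf_neq0 (vq_neq0 (sqr_lt1 p1)).
  apply: expf_neq0; apply: mulf_neq0; last exact: w0.
  by apply: mulf_neq0; apply: x10N1_neq0.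
have NV' p : nrm p < 1 -> N (p ^+ 2) = V p.
  move=> p1; have [->|] := eqVneq p 0; last exact: NV.
  exact: (dps_at0 (sq _ dN) dV NV).
exists N, (fun q => Aq q (-1) ^+ 6); split=> //.
- by apply: dpsX; apply: dps_AqN1.
- move=> q q1; rewrite expf_neq0 ?AqN1_neq0 //; split=> //.
  by rewrite -(sqr_sqrtc q) NV' ?V0 ?nrm_sqrtc.
- by move=> q q1; rewrite -GN.
Qed.

Lemma Delta_0 : Delta 0 = 0.
Proof. by have [N [D [_ _ _ ->]]] := Delta_shift; rewrite ?nrm0 // !mul0r. Qed.

Lemma Delta_neq0 q : nrm q < 1 -> q != 0 -> Delta q != 0.
Proof.
move=> q1 q0; have [N [D [_ _ nz ->]]] := Delta_shift => //.
by have [h1 h2] := nz q q1; rewrite !mulf_neq0 // invr_eq0.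
Qed.

End Eisenstein.

(** * The structure of the ring of modular forms *)

Section Vanishing.
Variable R : realType.
Local Notation C := R[i].
Implicit Types (p q y z : C) (H N D : C -> C) (k : nat) (u v w : int).

Lemma expR_Npi : expR (- pi) <= 5^-1 :> R.
Proof.
have p2 : 2 <= pi :> R := pi_ge2 R.
have h : 5 <= expR (pi / 4 + pi / 4 + pi / 4 + pi / 4) :> R.
  rewrite !expRD; have := expR_ge1Dx (pi / 4 : R).
  set x := expR _ => hx; have x2 : 3 / 2 <= x by lra.
  have y2 : 9 / 4 <= x * x by nra.
  by rewrite -!mulrA mulrA; move: (x * x) y2 => y y2; nra.
have E : pi / 4 + pi / 4 + pi / 4 + pi / 4 = pi :> R by field.
by rewrite E in h; rewrite expRN lef_pV2 ?posrE ?expR_gt0 ?ltr0n.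
Qed.

Lemma Im_Ninv z : complex.Im (- z^-1) =
  complex.Im z / (complex.Re z ^+ 2 + complex.Im z ^+ 2).
Proof. by case: z => x y /=; rewrite opprK. Qed.

(** Translations and the inversion raise the imaginary part above 1/2, as the
    inversion doubles it on the rest of the strip of half-width 1/2. *)
Lemma reduction (P : upper R -> Prop) :
  (forall s t : upper R, e2pi (val s) = e2pi (val t) -> P s -> P t) ->
  (forall (s t : upper R), val s = - (val t)^-1 -> P s -> P t) ->
  (forall t : upper R, 2^-1 <= complex.Im (val t) -> P t) ->
  forall t, P t.
Proof.
move=> PT PS Pbig.
have step n : forall t : upper R, 2^-1 <= 2 ^+ n * complex.Im (val t) -> P t.
  elim: n => [|n IH] t ht; first by apply: Pbig; rewrite mul1r in ht.
  have [/Pbig//|y2] := leP 2^-1 (complex.Im (val t)).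
  pose m := Num.floor (complex.Re (val t) + 2^-1).
  have y0 : 0 < complex.Im (val t) := valP t.
  have s0 : in_upper (val t - m%:~R).
    by rewrite /in_upper ImD ImN !intC /= oppr0 addr0.
  apply: (PT (Sub (val t - m%:~R) s0)).
    by rewrite /= e2piB e2pi_int divr1.
  set s := Sub _ _; have sy : complex.Im (val s) = complex.Im (val t).
    by rewrite /s /= ImD ImN !intC /= oppr0 addr0.
  have sx : complex.Re (val s) ^+ 2 <= 4^-1.
    have : `|complex.Re (val s)| <= 2^-1.
      rewrite /s /= ReD ReN !intC /=.
      have := floor_le (complex.Re (val t) + 2^-1); have := floorD1_gt (complex.Re (val t) + 2^-1).
      rewrite -/m intrD ler_norml => h1 h2; apply/andP; split; lra.
    rewrite -(@ler_sqr _ `|_|) ?nnegrE // real_normK ?num_real // => h.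
    by apply: le_trans h _; lra.
  have det1 : 0 * 0 - (-1) * 1 = 1 :> int by [].
  apply: (PS (SL2_act det1 s)); first by rewrite /= /moebius !mul0r mul1r addr0 add0r mulN1r.
  apply: IH; apply: le_trans ht _; rewrite exprS -mulrA (mulrCA 2) ler_wpM2l ?exprn_ge0 //.
  have -> : val (SL2_act det1 s) = - (val s)^-1.
    by rewrite /= /moebius !mul0r mul1r addr0 add0r mulN1r.
  rewrite Im_Ninv sy; move: (complex.Re _) sx (complex.Im _) y2 y0 => x sx y y2 y0.
  have Y : y ^+ 2 <= 4^-1 by nra.
  have n0 : 0 < x ^+ 2 + y ^+ 2 by rewrite ltr_wpDl ?sqr_ge0 ?exprn_gt0.
  by rewrite ler_pdivlMr //; nra.
move=> t; have y0 : 0 < complex.Im (val t) := valP t.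
pose n := Num.truncn (complex.Im (val t))^-1.
apply: (step n.+1); rewrite -ler_pdivrMr //.
have := truncnS_gt (complex.Im (val t))^-1; rewrite -/n => h.
have h2 : n.+1%:R <= 2 ^+ n.+1 :> R by rewrite -natrX ler_nat ltnW // ltn_expl.
have := invr_gt0 (complex.Im (val t)); rewrite y0; move: (_^-1) h => y h hy.
by move: (n.+1%:R) (_ ^+ n.+1) h h2 => a b *; lra.
Qed.

Lemma e2pi_small (tau : C) : 2^-1 <= complex.Im tau -> nrm (e2pi tau) <= 5^-1.
Proof.
move=> h; rewrite nrm_e2pi; apply: le_trans expR_Npi; rewrite ler_expR lerN2.
by have := pi_gt0 R; move: (pi : R) => x x0; nra.
Qed.

Lemma mf0_le H (M : R) : mf 0 H -> nrm (H 0) <= M ->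
  (forall q, nrm q <= 5^-1 -> nrm (H q) <= M) -> forall q, nrm q < 1 -> nrm (H q) <= M.
Proof.
move=> [_ hM] H0 small q q1; have [->//|q0] := eqVneq q 0.
have [tau <-] := e2pi_upper_surj q0 q1.
apply: (@reduction (fun t => nrm (H (e2pi (val t))) <= M)).
- by move=> s t ->.
- move=> s t st.
  have det1 : 0 * 0 - (-1) * 1 = 1 :> int by [].
  have E : s = SL2_act det1 t.
    by apply/val_inj; rewrite st /= /moebius !mul0r mul1r addr0 add0r mulN1r.
  by rewrite E (hM _ _ _ _ det1 t) expr0z mul1r.
- by move=> t h; apply: small; apply: e2pi_small.
Qed.

(** By the reduction, the modulus of H on the disc is bounded by its maximum over
    a square inside the disc, attained at some z0; by the maximum principle H is
    constant on a disc containing 0 and z0, so that the bound is 0. *)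
Lemma mf0_cusp H : mf 0 H -> H 0 = 0 -> forall q, nrm q < 1 -> H q = 0.
Proof.
move=> hH H0; have [[N [D [dN dD D0 HE]]] _] := hH.
(* The bound on |e(tau)| for Im tau >= 1/2. *)
pose b : R := 5^-1; have b0 : 0 <= b by rewrite invr_ge0.
have par_small z : (exists s t : R, [/\ `|s| <= b, `|t| <= b & z = s%:C * 'i + t%:C * 1]) ->
    nrm z <= 2 / 5.
  move=> [s [t [hs ht ->]]]; apply: le_trans (nrmD _ _) _.
  rewrite !nrmM nrm1 !nrm_real (_ : nrm 'i = 1) ?mulr1.
    by rewrite /b in hs ht; lra.
  by rewrite nrm_sqrt /= expr0n expr1n add0r sqrtr1.
have h25 : 2 / 5 < 1 :> R by lra.
have r0 : 0 < 9 / 10 :> R by lra.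
have r1 : 9 / 10 < 1 :> R by lra.
have pN := dps_psd dN r0 r1; have pD := dps_psd dD r0 r1.
have [z pz zr|z0 pz0 hmax] := @evt_par R 'i 1 b (fun z => nrm (N z / D z)) b0.
  have zs := par_small z pz.
  have zr9 : nrm z < 9 / 10 by lra.
  have z1 : nrm z < 1 by lra.
  move=> e0; have [d d0 hd] := ccont_div (psd_ccont r0 zr9 pN) (psd_ccont r0 zr9 pD) (D0 z z1) e0.
  by exists d => // w /hd; apply: le_trans; apply: nrm_dist.
have zs := par_small z0 pz0.
have z1 : nrm z0 < 1 by lra.
have n01 : nrm (0 : C) < 1 by rewrite nrm0.
have glob q : nrm q < 1 -> nrm (H q) <= nrm (N z0 / D z0).
  apply: mf0_le => //; first by rewrite H0 nrm0 nrm_ge0.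
  move=> w wb; have w1 : nrm w < 1 by rewrite /b in wb; lra.
  rewrite HE //; apply: hmax; exists (complex.Im w), (complex.Re w); split.
  - by apply: le_trans (nrm_Im w) wb.
  - by apply: le_trans (nrm_Re w) wb.
  - by rewrite mulr1; case: (w) => x y; simpc.
have Dz0 := D0 z0 z1.
have glob' (w : C) : nrm w < 1 -> nrm (N w) * nrm (D z0) <= nrm (N z0) * nrm (D w).
  move=> w1; have := glob w w1; rewrite HE // !nrmM !nrmV.
  rewrite ler_pdivrMr ?nrm_gt0 ?D0 // mulrAC ler_pdivlMr ?nrm_gt0 //.
have z0r : nrm z0 < 9 / 10 / 2 by lra.
have E : N z0 = 0.
  have n0r : nrm (0 : C) <= 9 / 10 by rewrite nrm0 ltW.
  have N0 : N 0 = 0.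
    apply/eqP; move: H0; rewrite HE // => /eqP.
    by rewrite mulf_eq0 invr_eq0 (negbTE (D0 0 n01)) orbF.
  have loc : exists2 d : R, 0 < d & forall z, nrm (z - z0) <= d ->
      nrm (N z) * nrm (D z0) <= nrm (N z0) * nrm (D z).
    exists (1 / 10) => [|z hz]; first by lra.
    by apply: glob'; have := nrmD (z - z0) z0; rewrite subrK; lra.
  have := max_principle r0 z0r pN pD Dz0 loc n0r; rewrite N0 mul0r => E.
  apply/eqP; have : N z0 * D 0 == 0 by rewrite -E.
  by rewrite mulf_eq0 (negbTE (D0 0 n01)) orbF.
by move=> q /glob; rewrite E mul0r nrm0 => /nrm_le0.
Qed.

Lemma qm_at0 H : qm H -> (forall q, nrm q < 1 -> q != 0 -> H q = 0) ->
  forall q, nrm q < 1 -> H q = 0.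
Proof.
move=> [N [D [dN dD D0 HE]]] h q q1; have [q0|q0] := eqVneq q 0; last exact: h.
rewrite HE // q0 (dps_at0 dN (dps_cst 0)) ?mul0r // => t t1 t0.
by have /eqP := h t t1 t0; rewrite HE // mulf_eq0 invr_eq0 (negbTE (D0 t t1)) orbF => /eqP.
Qed.

(** With w = -(n+1), the function H^12 Delta^(n+1) has weight 0 and vanishes at
    the cusp. *)
Lemma mf_neg H n : mf (- n.+1%:Z) H -> forall q, nrm q < 1 -> H q = 0.
Proof.
move=> hH; have h0 : mf 0 (fun q => H q ^+ 12 * Delta q ^+ n.+1).
  have := mfM (mfX 12 hH) (mfX n.+1 (mf_Delta R)).
  by rewrite (_ : - _ * _ + _ = 0) //; ring.
have z := mf0_cusp h0; rewrite Delta_0 expr0n mulr0 in z.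
apply: qm_at0 hH.1 _ => q q1 q0.
have /eqP := z erefl q q1; rewrite mulf_eq0 !expf_eq0 (negbTE (Delta_neq0 q1 q0)) andbF orbF.
by move=> /eqP.
Qed.

(** The only zero of Delta in the disc is a simple one at the cusp, so the
    quotient by Delta has no pole. *)
Lemma mf_cusp w H : mf w H -> H 0 = 0 -> exists2 G, mf (w - 12) G &
  forall q, nrm q < 1 -> H q = Delta q * G q.
Proof.
move=> [[N [D [dN dD D0 HE]]] hM] H0.
have n01 : nrm (0 : C) < 1 by rewrite nrm0.
have N0 : N 0 = 0.
  by apply/eqP; move: H0; rewrite HE // => /eqP; rewrite mulf_eq0 invr_eq0 (negbTE (D0 0 n01)) orbF.
have [N' dN' NE] := dps_shift dN N0.
have [A [B [dA dB AB0 DlE]]] := Delta_shift R.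
pose G q := N' q * B q / (D q * A q).
have GE q : nrm q < 1 -> H q = Delta q * G q.
  move=> q1; have [a0 b0] := AB0 q q1.
  rewrite HE // NE // DlE // /G; move: (D q) (D0 q q1) (A q) (B q) a0 b0 => d d0 a b a0 b0.
  by field; rewrite d0 a0 b0.
exists G => //; split.
  exists (fun q => N' q * B q), (fun q => D q * A q); split=> //; try exact: dpsM.
  by move=> q q1; rewrite mulf_neq0 ?D0 //; have [] := AB0 q q1.
move=> a b c e det1 tau.
have [_ hD] := mf_Delta R.
have t1 := e2pi_upper (valP tau); have s1 := e2pi_upper (valP (SL2_act det1 tau)).
have j0 := cocycle_neq0 det1 (valP tau).
have := hM a b c e det1 tau; rewrite (GE _ s1) (GE _ t1) hD => E.
apply: (mulfI (Delta_neq0 t1 (e2pi_neq0 _))); apply: (mulfI (expfz_neq0 12 j0)).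
rewrite mulrA E [X in _ = X](_ : _ = Delta (e2pi (val tau)) * (
  ((c%:~R * val tau + e%:~R) ^ 12 * (c%:~R * val tau + e%:~R) ^ (w - 12)) * G (e2pi (val tau)))).
  by rewrite -expfzDr // (addrC 12) subrK; ring.
by ring.
Qed.

Lemma mf_sub_cusp w H M : mf w H -> mf w M -> M 0 != 0 ->
  exists2 G, mf (w - 12) G & forall q, nrm q < 1 -> H q = H 0 / M 0 * M q + Delta q * G q.
Proof.
move=> hH hM M0; have h := mfD hH (mfZ (- (H 0 / M 0)) hM).
have [|G hG GE] := mf_cusp h; first by rewrite mulNr divfK // subrr.
by exists G => // q q1; rewrite -GE //; ring.
Qed.

(** In weights below 12 the quotient by Delta has negative weight, so a form is
    determined by its value at the cusp. *)
Lemma mf_low (n : nat) H M : (n < 12)%N -> mf n%:Z H -> mf n%:Z M -> M 0 != 0 ->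
  forall q, nrm q < 1 -> H q = H 0 / M 0 * M q.
Proof.
move=> n12 hH hM M0 q q1; have [G hG ->] := mf_sub_cusp hH hM M0; last by [].
have E : n%:Z - 12 = - (11 - n).+1%:Z by lia.
by rewrite E in hG; rewrite (mf_neg hG q1) mulr0 addr0.
Qed.

Lemma half_disc : nrm (2^-1 : C) < 1 /\ (2^-1 : C) != 0.
Proof. by rewrite nrmV nrm_nat invf_lt1 ?ltr1n // invr_eq0 pnatr_eq0. Qed.

Lemma E4_0_neq0 : E4 (0 : C) != 0. Proof. by rewrite E4_0 invr_eq0 pnatr_eq0. Qed.
Lemma E6_0_neq0 : E6 (0 : C) != 0. Proof. by rewrite E6_0 invr_eq0 pnatr_eq0. Qed.

(** The square and the cube of a form of weight 2 are proportional to E4 and to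
    E6; this would make E4^3 and E6^2 proportional, with the factor that gives
    Delta = 0, unless the form vanishes. *)
Lemma mf2_eq0 H : mf 2 H -> forall q, nrm q < 1 -> H q = 0.
Proof.
move=> hH.
have h2 := mf_low (n := 4) isT (mfX 2 hH) (mf_E4 R) E4_0_neq0.
have h3 := mf_low (n := 6) isT (mfX 3 hH) (mf_E6 R) E6_0_neq0.
have [H0|H0] := eqVneq (H 0) 0.
  move=> q q1; have := h2 q q1; rewrite H0 expr0n !mul0r => /eqP.
  by rewrite expf_eq0 => /andP[_ /eqP].
have [q1 q0] := half_disc.
have /eqP[] := Delta_neq0 q1 q0.
have := Delta_E4_E6 q1; have /= := h2 _ q1; have /= := h3 _ q1.
rewrite E4_0 E6_0 !invrK.
move: (E4 _) (E6 _) (Delta _) (H _) (H 0) H0 => x y d h a a0 e3 e2 e.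
have : a ^+ 6 * (512 * x ^+ 3) = a ^+ 6 * (1024 * y ^+ 2).
  transitivity ((h ^+ 2) ^+ 3); first by rewrite e2; ring.
  by rewrite exprAC e3; ring.
move=> /(mulfI (expf_neq0 6 a0)) E.
have : 27 * d = 0.
  have -> : 27 * d = (512 * x ^+ 3 - 1024 * y ^+ 2) / 1024.
    have -> : 512 * x ^+ 3 = 1024 * (x ^+ 3 / 2) by field.
    by rewrite e; field.
  by rewrite E subrr mul0r.
by move/eqP; rewrite mulf_eq0 pnatr_eq0 => /eqP.
Qed.

(** Every form of weight 2j is a polynomial in E4, E6 and Delta: subtracting a
    multiple of a monomial in E4 and E6 makes it vanish at the cusp, and dividing
    by Delta lowers the weight by 12. As an induction principle, this applies to
    the functions H A^j directly. *)
Lemma mf_ind (P : nat -> (C -> C) -> Prop) :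
  (forall j H H', (forall q, nrm q < 1 -> H q = H' q) -> P j H -> P j H') ->
  (forall j, P j (fun=> 0)) -> (forall c, P 0%N (fun=> c)) ->
  (forall j H H', P j H -> P j H' -> P j (fun q => H q + H' q)) ->
  (forall i j H H', P i H -> P j H' -> P (i + j)%N (fun q => H q * H' q)) ->
  P 2%N (@E4 R) -> P 3%N (@E6 R) -> P 6%N (@Delta R) ->
  forall j H, mf (2 * j)%N H -> P j H.
Proof.
move=> Peq P0 Pc PD PM P4 P6 PDl.
(* A monomial in E4 and E6 with at most one factor E6. *)
have mono j : (1 < j)%N -> exists M, [/\ mf (2 * j)%N M, M 0 != 0 & P j M].
  have even b : exists M, [/\ mf (2 * (2 * b))%N M, M 0 != 0 & P (2 * b)%N M].
    elim: b => [|b [M [hM M0 PMM]]].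
      by exists (fun=> 1); split; [exact: mf_cst|exact: oner_neq0|exact: Pc].
    exists (fun q => E4 q * M q); split.
    - by have := mfM (mf_E4 R) hM; rewrite (_ : 4 + _ = (2 * (2 * b.+1))%N%:Z) //; lia.
    - by rewrite mulf_neq0 ?E4_0_neq0.
    - by rewrite (_ : (2 * b.+1 = 2 + 2 * b)%N); [apply: PM|lia].
  move=> j1; have [jo|je] := boolP (odd j); last first.
    by have [M hM] := even j./2; exists M; rewrite (_ : j = (2 * j./2)%N) //; lia.
  have [M [hM M0 PMM]] := even (j.-1./2.-1).
  exists (fun q => E6 q * M q); split.
  - by have := mfM (mf_E6 R) hM; rewrite (_ : 6 + _ = (2 * j)%N%:Z) //; lia.
  - by rewrite mulf_neq0 ?E6_0_neq0.
  - by rewrite (_ : j = (3 + 2 * j.-1./2.-1)%N); [apply: PM|lia].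
elim/ltn_ind => -[|[|j]] IH H hH.
- have := mf_low (n := 0) isT hH (mf_cst 1) (oner_neq0 _).
  by rewrite divr1 mulr1 => h; apply: Peq (Pc (H 0)) => q /h.
- by apply: Peq (P0 1%N) => q /(mf2_eq0 hH).
have [M [hM M0 PMM]] := mono j.+2 isT.
have [G hG GE] := mf_sub_cusp hH hM M0.
have PG : P j.+2 (fun q => Delta q * G q).
  have [j6|j6] := ltnP j 4.
    apply: Peq (P0 _) => q q1.
    have E : (2 * j.+2)%N%:Z - 12 = - (12 - 2 * j.+2).-1.+1%:Z by lia.
    by rewrite E in hG; rewrite (mf_neg hG q1) mulr0.
  rewrite (_ : j.+2 = (6 + (j - 4))%N); last by lia.
  apply: PM => //; apply: IH; first by lia.
  by rewrite (_ : (2 * (j - 4))%N%:Z = (2 * j.+2)%N%:Z - 12) //; lia.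
apply: Peq (PD _ _ _ (PM _ _ _ _ (Pc (H 0 / M 0)) PMM) PG) => q q1.
by rewrite (GE q q1).
Qed.

End Vanishing.

(** * The ring of weak Jacobi forms of weight 0 *)

Section Ring.
Variable R : realType.
Local Notation C := R[i].
Local Notation J := (jacobi_fun R).
Implicit Types (f g : J) (k l : nat).

(** Holomorphy is a consequence of the Fourier expansion, so weak Jacobi forms
    can be handled through their expressions in q and y. *)
Lemma jacobi_jac k f : weak_jacobi_form k f -> exists G : C -> C -> C,
  [/\ f = jac G, lau G, modular_law k (jac G) & elliptic_law k (jac G)].
Proof. by move=> [_ hm he /fourier_lau[G lG fE]]; exists G; rewrite -fE. Qed.

Lemma jac_jacobi k (G : C -> C -> C) : lau G -> modular_law k (jac G) -> elliptic_law k (jac G) ->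
  weak_jacobi_form k (jac G).
Proof. by move=> h *; split=> //; [apply: lau_holomorphic|apply: lau_fourier]. Qed.

Lemma jacobi0 k : weak_jacobi_form k (0 : J).
Proof.
have -> : (0 : J) = jac (fun _ _ => 0 : C) by [].
by apply: jac_jacobi => [|? *|? *]; [exact: lau_cst|rewrite /jac mulr0..].
Qed.

Lemma jacobi_cst (c : C) : weak_jacobi_form 0 (cst c : J).
Proof.
have -> : (cst c : J) = jac (fun _ _ => c : C) by [].
apply: jac_jacobi => [|? *|? *]; first exact: lau_cst.
  by rewrite /jac !mul0r e2pi0 mul1r.
by rewrite /jac !mul0r oppr0 e2pi0 mul1r.
Qed.

Lemma jacobiD k f g : weak_jacobi_form k f -> weak_jacobi_form k g -> weak_jacobi_form k (f + g).
Proof.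
move=> /jacobi_jac[F [-> lF mF eF]] /jacobi_jac[G [-> lG mG eG]].
have -> : jac F + jac G = jac (fun q y => F q y + G q y) by [].
apply: jac_jacobi; first exact: lauD.
  move=> a b c e det1 z tau; have := mF a b c e det1 z tau; have := mG a b c e det1 z tau.
  by rewrite /jac /= => -> ->; rewrite [RHS]mulrDr.
move=> l m z tau; have := eF l m z tau; have := eG l m z tau.
by rewrite /jac /= => -> ->; rewrite [RHS]mulrDr.
Qed.

Lemma jacobiM k l f g : weak_jacobi_form k f -> weak_jacobi_form l g ->
  weak_jacobi_form (k + l) (f * g).
Proof.
move=> /jacobi_jac[F [-> lF mF eF]] /jacobi_jac[G [-> lG mG eG]].
have -> : jac F * jac G = jac (fun q y => F q y * G q y) by [].
apply: jac_jacobi; first exact: lauM.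
  move=> a b c e det1 z tau; have := mF a b c e det1 z tau; have := mG a b c e det1 z tau.
  rewrite /jac /= => -> ->; rewrite natrD !mulrDl e2piD; ring.
move=> i m z tau; have := eF i m z tau; have := eG i m z tau.
by rewrite /jac /= => -> ->; rewrite natrD !mulrDl opprD e2piD; ring.
Qed.

Lemma ring_jacobiD (p p' : {poly J}) : weak_jacobi_ring p -> weak_jacobi_ring p' ->
  weak_jacobi_ring (p + p').
Proof. by move=> h h' k; rewrite coefD; apply: jacobiD. Qed.

Lemma ring_jacobiM (p p' : {poly J}) : weak_jacobi_ring p -> weak_jacobi_ring p' ->
  weak_jacobi_ring (p * p').
Proof.
move=> h h' k; rewrite coefM; elim/big_ind: _ => [|f g|i _]; first exact: jacobi0.
  exact: jacobiD.
have ik : (i <= k)%N by rewrite -ltnS.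
by rewrite -{1}(subnKC ik); apply: jacobiM.
Qed.

Lemma ring_jacobi_hom k f : weak_jacobi_form k f -> weak_jacobi_ring (f *: 'X^k).
Proof.
move=> h i; rewrite coefZ coefXn; case: eqP => [->|_]; first by rewrite mulr1.
rewrite mulr0; exact: jacobi0.
Qed.

Lemma ring_jacobi_cst (c : C) : weak_jacobi_ring (cst_poly c).
Proof.
move=> i; rewrite /cst_poly coefC; case: eqP => [->|_]; first exact: jacobi_cst.
exact: jacobi0.
Qed.

Lemma ring_jacobi1 : weak_jacobi_ring (1 : {poly J}).
Proof.
have -> : 1 = cst_poly (1 : C) by [].
exact: ring_jacobi_cst.
Qed.

Lemma ring_jacobi_mmap n (x : 'I_n -> {poly J}) (P : mpoly.mpoly n C) :
  (forall i, weak_jacobi_ring (x i)) -> weak_jacobi_ring (mpoly.mmap (@cst_poly R) x P).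
Proof.
move=> hx; rewrite /mpoly.mmap.
have hX (a : {poly J}) m : weak_jacobi_ring a -> weak_jacobi_ring (a ^+ m).
  move=> ha; elim: m => [|m IH]; last by rewrite exprS; apply: ring_jacobiM.
  exact: ring_jacobi1.
elim/big_ind: _ => [|a b|m _].
- by move=> i; rewrite coef0; apply: jacobi0.
- exact: ring_jacobiD.
apply: ring_jacobiM; first exact: ring_jacobi_cst.
rewrite /mpoly.mmap1; elim/big_ind: _ => [|a b|i _]; last by apply: hX.
  exact: ring_jacobi1.
exact: ring_jacobiM.
Qed.

Lemma cst_polyB : additive (@cst_poly R).
Proof. by move=> a b; rewrite /cst_poly -polyCB. Qed.

Lemma cst_polyM : multiplicative (@cst_poly R).
Proof. by split=> [a b|] //; rewrite /cst_poly -polyCM. Qed.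

HB.instance Definition _ := GRing.isAdditive.Build C {poly J} (@cst_poly R) cst_polyB.
HB.instance Definition _ := GRing.isMultiplicative.Build C {poly J} (@cst_poly R) cst_polyM.

Variable x : 'I_3 -> {poly J}.
(** The functions which, placed in degree k, belong to the algebra generated by
    x. *)
Definition gen k f := exists P : mpoly.mpoly 3 C, mpoly.mmap (@cst_poly R) x P = f *: 'X^k.

Lemma gen0 k : gen k 0.
Proof. by exists 0; rewrite mpoly.mmap0 scale0r. Qed.

Lemma gen_cst c : gen 0 (cst c).
Proof. by exists (mpoly.mpolyC 3 c); rewrite mpoly.mmapC expr0 alg_polyC. Qed.

Lemma genD k f g : gen k f -> gen k g -> gen k (f + g).
Proof. by move=> [P hP] [Q hQ]; exists (P + Q); rewrite mpoly.mmapD hP hQ scalerDl. Qed.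

Lemma genM k l f g : gen k f -> gen l g -> gen (k + l) (f * g).
Proof.
move=> [P hP] [Q hQ]; exists (P * Q); rewrite rmorphM /= hP hQ.
by rewrite -scalerAl -scalerAr scalerA -exprD.
Qed.

End Ring.

(** * The three generators generate *)

Section Generation.
Variable R : realType.
Local Notation C := R[i].
Local Notation J := (jacobi_fun R).
Implicit Types (f g : J) (k l : nat).

Definition An (q y : C) : C := Aq q y / vq q ^+ 4.

Lemma AqB_ratio (q : C) : nrm q < 1 -> forall e : R, 0 < e -> exists y,
  [/\ y != 0, Aq q y != 0, Gq (@Bf R) q y != 0 & nrm (Aq q y / Gq (@Bf R) q y) <= e].
Proof.
move=> q1; have [c hB] := lau_laurent (lau_Gq (sympoly_B R)) q1.
apply: (Aq_ratio q1 hB); rewrite Gq_at1 // /Bf.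
by rewrite (_ : 1 + 1 + 1 = 3%:R) ?pnatr_eq0 //; ring.
Qed.

Lemma AB_ratio (q : C) : nrm q < 1 -> forall e : R, 0 < e -> exists y,
  [/\ y != 0, An q y != 0, Gq (@Bf R) q y != 0 & nrm (An q y / Gq (@Bf R) q y) <= e].
Proof.
move=> q1 e e0; have v0 := vq_neq0 q1.
have n0 : 0 < nrm (vq q ^+ 4) by rewrite nrm_gt0 expf_neq0.
have [y [y0 A0 B0 h]] := AqB_ratio q1 (mulr_gt0 e0 n0).
exists y; split=> //; first by rewrite /An mulf_neq0 // invr_eq0 expf_neq0.
by rewrite /An mulrAC (nrmM (_ / _)) nrmV ler_pdivrMr.
Qed.

(** Indexed by natural numbers so that its value at each of the three indices is
    available by computation. *)
Definition gfun (i : nat) : J :=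
  nth 0 [:: jac (Gq (@Bf R)); jac (Gq (@C2f R)); jac (Gq (@C3f R))] i.

Definition gener (i : 'I_3) : {poly J} := gfun i *: 'X^(i.+1).

Lemma gfun_jacobi (i : 'I_3) : weak_jacobi_form i.+1 (gfun i).
Proof.
case: i => -[|[|[|//]]] ? /=; apply: Gq_jacobi.
- exact: sympoly_B.
- exact: sympoly_C2.
- exact: sympoly_C3.
Qed.

Lemma gen_gfun (i : 'I_3) : gen gener i.+1 (gfun i).
Proof. by exists (mpoly.mpolyX C (mpoly.mnm1 i)); rewrite mpoly.mmapX mpoly.mmap1U. Qed.

Lemma fctX f n p : (f ^+ n) p = f p ^+ n :> C.
Proof. by elim: n => // n IH; rewrite !exprS -IH. Qed.

Lemma gen_exp (x : 'I_3 -> {poly J}) k f n : gen x k f -> gen x (n * k) (f ^+ n).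
Proof.
move=> h; elim: n => [|n IH]; first exact: gen_cst.
by rewrite mulSn exprS; apply: genM.
Qed.

(** The function H A^j on C x H, of weight 0 and index j when H is a modular form
    of weight 2j. *)
Definition mfun (j : nat) (H : C -> C) : J :=
  fun p => H (e2pi (val p.2)) * An (e2pi (val p.2)) (e2pi p.1) ^+ j.

Lemma Gq_mfun k F : sympoly k F -> translation F -> jac (Gq F) = mfun k (EF k F).
Proof.
move=> hF tF; apply/funext => -[z tau]; rewrite /jac /mfun /=.
exact: (Gq_EF _ hF tF (valP tau)).
Qed.

Lemma mfunM i j H H' : mfun (i + j) (fun q => H q * H' q) = mfun i H * mfun j H'.
Proof.
apply/funext => p; rewrite /mfun.
transitivity ((H (e2pi (val p.2)) * An (e2pi (val p.2)) (e2pi p.1) ^+ i) *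
   (H' (e2pi (val p.2)) * An (e2pi (val p.2)) (e2pi p.1) ^+ j)); last by [].
by rewrite exprD; ring.
Qed.

(** By mf_ind it is enough to treat E4 A^2 and E6 A^3, which are generators, and
    Delta A^6, which is a polynomial in these. *)
Lemma gen_mfun j H : mf (2 * j)%N H -> gen gener j (mfun j H).
Proof.
apply: (@mf_ind R (fun j H => gen gener j (mfun j H))) => {j H}.
- move=> j H H' E; congr (gen _ _ _); apply/funext => p; rewrite /mfun E //.
  exact: e2pi_upper (valP _).
- move=> j; have -> : mfun j (fun=> 0) = 0 by apply/funext => p; rewrite /mfun mul0r.
  exact: gen0.
- move=> c; have -> : mfun 0 (fun=> c) = cst c.
    by apply/funext => p; rewrite /mfun expr0 mulr1.
  exact: gen_cst.
- move=> j H H' h h'.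
  have -> : mfun j (fun q => H q + H' q) = mfun j H + mfun j H'.
    by apply/funext => p; rewrite /mfun mulrDl.
  exact: genD.
- by move=> i j H H' h h'; rewrite mfunM; apply: genM.
- rewrite -(Gq_mfun (sympoly_C2 R) (@translation_C2 R)).
  exact: (gen_gfun (Ordinal (isT : 1 < 3)%N)).
- rewrite -(Gq_mfun (sympoly_C3 R) (@translation_C3 R)).
  exact: (gen_gfun (Ordinal (isT : 2 < 3)%N)).
- rewrite -(Gq_mfun (sympoly_D R) (@translation_D R)).
  have h2 := gen_exp 3 (gen_gfun (Ordinal (isT : 1 < 3)%N)).
  have h3 := gen_exp 2 (gen_gfun (Ordinal (isT : 2 < 3)%N)).
  have := genD (genM (gen_cst gener (54^-1 : C)) h2) (genM (gen_cst gener (- 27^-1 : C)) h3).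
  congr (gen _ _ _); apply/funext => p.
  transitivity (54^-1 * gfun 1 p ^+ 3 + - 27^-1 * gfun 2 p ^+ 2 : C).
    by rewrite -!fctX.
  rewrite /gfun /jac /=.
  have := Df_C2_C3 (x01 (sqrtc (e2pi (val p.2)) ^+ 2) (e2pi p.1))
    (x10 (sqrtc (e2pi (val p.2))) (e2pi p.1))
    (x10 (- sqrtc (e2pi (val p.2))) (e2pi p.1)).
  rewrite -!/(Gp _ _ _) -!/(Gq _ _ _).
  move: (Gq (@C2f R) _ _) (Gq (@C3f R) _ _) (Gq (@Df R) _ _) => a b d E.
  have -> : d = (a ^+ 3 / 2 - b ^+ 2) / 27 by rewrite E; field.
  by field.
Qed.

(** Expand a form in the products A^j B^(k-j). The coefficients are quotients of
    disc series, and comparing the transformation laws of both sides shows, by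
    uniqueness of the coordinates, that the j-th one is modular of weight 2j. *)
Lemma gen_form k f : weak_jacobi_form k f -> gen gener k f.
Proof.
move=> /jacobi_jac[F [-> lF mF eF]].
have lB := lau_Gq (sympoly_B R); have mB := Gq_modular (sympoly_B R).
have qB : quasi 1 (Gq (@Bf R)) := jacobi_quasi (Gq_elliptic (sympoly_B R)) mB.
have [D [N [dD dN D0 FE]]] :=
  quasi_repr (@lau_Aq R) lB (@quasi_Aq R) qB AqB_ratio lF (jacobi_quasi eF mF).
pose h (j : 'I_k.+1) (q : C) := N j q * vq q ^+ (4 * j) / D q.
have {}FE q y : nrm q < 1 -> y != 0 ->
    F q y = \sum_(j < k.+1) h j q * (An q y ^+ j * Gq (@Bf R) q y ^+ (k - j)).
  move=> q1 y0; rewrite FE //; apply: eq_bigr => j _; rewrite /h /An expr_div_n -exprM.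
  move: (vq q) (vq_neq0 q1) (D q) (D0 q q1) (Gq _ _ _) => v v0 d d0 b.
  by field; rewrite d0 expf_neq0.
have hm (j : 'I_k.+1) : mf (2 * j)%N (h j).
  split.
    exists (fun q => N j q * vq q ^+ (4 * j)), D; split=> //.
    by apply: dpsM => //; apply: dpsX; apply: dps_vq.
  move=> a b c e det1 tau.
  have t1 := e2pi_upper (valP tau); have s1 := e2pi_upper (valP (SL2_act det1 tau)).
  have j0 := cocycle_neq0 det1 (valP tau).
  set s := e2pi (val (SL2_act det1 tau)) in s1 *; set t := e2pi (val tau) in t1 *.
  set J0 := c%:~R * val tau + e%:~R in j0 *.
  pose v (i : 'I_k.+1) := h i s * (J0 ^+ (2 * i))^-1 - h i t.
  have /(_ j)/eqP : forall i, v i = 0.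
    apply: (comb_eq0 (AB_ratio t1)) => y y0.
    have [z <-] := e2pi_surj y0.
    have := mF a b c e det1 z tau; rewrite /jac /= FE ?e2pi_neq0 // FE ?e2pi_neq0 //.
    rewrite -/s -/t -/J0.
    have := mB a b c e det1 z tau; rewrite /jac /= -/s -/t -/J0 => ->.
    have -> : An s (e2pi (z / J0)) = J0 ^- 2 * e2pi (c%:~R * z ^+ 2 / J0) * An t (e2pi z).
      exact: AN_modular.
    set u := e2pi (c%:~R * z ^+ 2 / J0).
    have u0 : u != 0 := e2pi_neq0 _.
    have -> : e2pi (1%:R * c%:~R * z ^+ 2 / J0) = u by rewrite mul1r.
    have -> : e2pi (k%:R * c%:~R * z ^+ 2 / J0) = u ^+ k.
      by rewrite /u -e2piMn; congr e2pi; ring.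
    clearbody u; move: (An t _) (Gq _ _ _) => A B E.
    apply: (mulfI (expf_neq0 k u0)); rewrite mulr0.
    pose L := \sum_(i < k.+1) h i s * ((J0 ^- 2 * u * A) ^+ i * (u * B) ^+ (k - i)).
    transitivity (L - u ^+ k * \sum_(i < k.+1) h i t * (A ^+ i * B ^+ (k - i))).
      rewrite /L !mulr_sumr -sumrB; apply: eq_bigr => i _.
      have ik : (i <= k)%N by rewrite -ltnS.
      have -> : u ^+ k = u ^+ i * u ^+ (k - i) by rewrite -exprD subnKC.
      rewrite /v !exprMn exprVn -exprM.
      by move: (h i s) (h i t) => m n; ring.
    by rewrite /L E subrr.
  rewrite /v subr_eq0 => /eqP E.
  by rewrite -E -exprnP mulrC divfK // expf_neq0.
have -> : jac F = \sum_(j < k.+1) mfun j (h j) * jac (Gq (@Bf R)) ^+ (k - j).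
  apply/funext => p; rewrite /jac FE ?e2pi_neq0 ?(e2pi_upper (valP _)) //.
  rewrite fct_sumE; apply: eq_bigr => j _.
  transitivity (mfun j (h j) p * jac (Gq (@Bf R)) p ^+ (k - j)); last by rewrite -fctX.
  by rewrite /mfun mulrA.
elim/big_ind: _ => [|f1 f2|j _]; [exact: gen0|exact: genD|].
have jk : (j <= k)%N by rewrite -ltnS.
have := genM (gen_mfun (hm j)) (gen_exp (k - j) (gen_gfun ord0)).
by rewrite muln1 subnKC.
Qed.

End Generation.

(** * The three generators are algebraically independent *)

Section Independence.
Variable R : realType.
Local Notation C := R[i].
Local Notation J := (jacobi_fun R).

Lemma qm_ccont (H : C -> C) : qm H -> ccont H 0.
Proof.
move=> [N [D [dN dD D0 HE]]] e e0.
have [r0 r1] : 0 < 2^-1 :> R /\ 2^-1 < 1 :> R by rewrite invf_lt1 ?ltr1n.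
have n0 : nrm (0 : C) < 2^-1 by rewrite nrm0.
have n1 : nrm (0 : C) < 1 by rewrite nrm0.
have [d d0 hd] := ccont_div (psd_ccont r0 n0 (dps_psd dN r0 r1))
  (psd_ccont r0 n0 (dps_psd dD r0 r1)) (D0 0 n1) e0.
exists (Num.min d 2^-1); first by rewrite lt_min d0.
move=> z; rewrite le_min => /andP[/hd h z2]; rewrite subr0 in z2.
by rewrite !HE // (le_lt_trans z2).
Qed.

(** The function 27 Delta/E4^3 is continuous at the cusp, where it vanishes. *)
Lemma Delta_E4_small (e : R) : 0 < e -> exists q : C, [/\ nrm q < 1, q != 0, E4 q != 0 &
  nrm (27 * Delta q / E4 q ^+ 3) <= e].
Proof.
move=> e0; have [[qE _] [qD _]] := (mf_E4 R, mf_Delta R).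
have cD := qm_ccont (qmM (qm_cst 27) qD).
have cE := qm_ccont (qmM qE (qmM qE qE)).
have h0 := E4_0_neq0 R; have E0 := mulf_neq0 h0 (mulf_neq0 h0 h0).
have [d d0 hd] := ccont_div cD cE E0 e0.
have [d' d'0 hd'] := ccont_nz cE E0.
pose t := Num.min (Num.min d d') 2^-1.
have t0 : 0 < t by rewrite !lt_min d0 d'0 invr_gt0 ltr0n.
have [td [td' t2]] : t <= d /\ t <= d' /\ t <= 2^-1 by rewrite /t !ge_min !lexx !orbT.
have nt : nrm t%:C = t by rewrite nrm_real gtr0_norm.
exists t%:C; split.
- by rewrite nt (le_lt_trans t2) // invf_lt1 ?ltr1n.
- exact: realC_neq0.
- have := hd' t%:C; rewrite subr0 nt => /(_ td') h.
  apply/eqP => E; move: h; rewrite E mul0r nrm0 leNgt divr_gt0 ?ltr0n // nrm_gt0.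
  exact: E0.
- have := hd t%:C; rewrite subr0 nt => /(_ td).
  by rewrite Delta_0 mulr0 mul0r subr0 !exprS expr0 mulr1.
Qed.

(** With s^2 = E4 and t = E6/s^3, an isobaric polynomial in E4 and E6 is a power
    of s times a polynomial p in t, and t^2 = 1/2 - 27 Delta/E4^3 takes values
    arbitrarily close to, but different from, 1/2. So if p were nonzero, the
    polynomial with roots 1/2 - z^2, for z the roots of p, would have nonzero
    roots arbitrarily close to 0. *)
Lemma isobaric (I : Type) (r : seq I) (P : pred I) (a : I -> C) (b c : I -> nat) (j : nat) :
  (forall i, P i -> (2 * b i + 3 * c i = j)%N) ->
  (forall q, nrm q < 1 -> q != 0 -> \sum_(i <- r | P i) a i * (E4 q ^+ b i * E6 q ^+ c i) = 0) ->
  \sum_(i <- r | P i) a i *: 'X^(c i) = 0 :> {poly C}.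
Proof.
move=> wt hz; set p := \sum_(i <- r | P i) _; apply/eqP; apply: contrapT => /negP p0.
have [rs pE] := closed_field_poly_normal p.
pose N : {poly C} := \prod_(z <- rs) ('X - (2^-1 - z ^+ 2)%:P).
have : N = 0.
  apply: poly_small_root => e e0; have [q [q1 q0 E0 he]] := Delta_E4_small e0.
  have n27 : 27 != 0 :> C by rewrite pnatr_eq0.
  have U0 : 27 * Delta q / E4 q ^+ 3 != 0.
    apply: mulf_neq0; first exact: mulf_neq0 n27 (Delta_neq0 q1 q0).
    by rewrite invr_eq0 expf_neq0.
  have [u uE] : exists u, u = 27 * Delta q / E4 q ^+ 3 by eexists.
  rewrite -uE in he U0; exists u; split=> //.
  pose s := sqrtc (E4 q); have sE : s ^+ 2 = E4 q := sqr_sqrtc _.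
  have s0 : s != 0 by apply: contra_neq E0 => s0; rewrite -sE s0 expr0n.
  pose t := E6 q / s ^+ 3.
  have pow (x y w d : C) m n : w != 0 -> w ^+ 2 = x ->
      w ^+ (2 * m + 3 * n) * (d * (y / w ^+ 3) ^+ n) = d * (x ^+ m * y ^+ n).
    move=> w0 <-; rewrite exprD !exprM expr_div_n.
    by field; rewrite !expf_neq0.
  have pt : p.[t] = 0.
    apply: (mulfI (expf_neq0 j s0)); rewrite mulr0 -(hz q q1 q0) /p horner_sum mulr_sumr.
    apply: eq_bigr => i Pi; rewrite hornerZ hornerXn -(wt i Pi).
    exact: pow s0 sE.
  have tr : t \in rs.
    move: pt; rewrite pE hornerZ horner_prod => /eqP; rewrite mulf_eq0 lead_coef_eq0 (negbTE p0) /=.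
    rewrite prodf_seq_eq0 => /hasP[z zr]; by rewrite hornerXsubC subr_eq0 => /eqP ->.
  rewrite /N horner_prod (big_rem t tr) /= hornerXsubC.
  have -> : u - (2^-1 - t ^+ 2) = 0; last by rewrite mul0r.
  rewrite uE.
  have -> : t ^+ 2 = E6 q ^+ 2 / E4 q ^+ 3 by rewrite -sE /t; field.
  have := Delta_E4_E6 q1; move: (Delta q) (E6 q) (E4 q) E0 => d y x x0 E.
  have -> : 27 * d = x ^+ 3 / 2 - y ^+ 2 by rewrite E; ring.
  by field.
by move/eqP; apply/negP/monic_neq0/monic_prod_XsubC.
Qed.

Let i1 : 'I_3 := Ordinal (isT : 1 < 3)%N.
Let i2 : 'I_3 := Ordinal (isT : 2 < 3)%N.
Let wt (m : mpoly.multinom 3) := (2 * m i1 + 3 * m i2)%N.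
Let dg (m : mpoly.multinom 3) := (m ord0 + wt m)%N.

Lemma coef_gener (P : mpoly.mpoly 3 C) k p :
  (mpoly.mmap (@cst_poly R) (@gener R) P)`_k p =
  \sum_(m <- mpoly.msupp P | dg m == k) mpoly.mcoeff m P *
    (@gfun R 0 p ^+ (m ord0) * @gfun R 1 p ^+ (m i1) * @gfun R 2 p ^+ (m i2)).
Proof.
rewrite /mpoly.mmap coef_sum fct_sumE [RHS]big_mkcond /=; apply: eq_bigr => m _.
have -> : mpoly.mmap1 (@gener R) m =
    (@gfun R 0 ^+ (m ord0) * @gfun R 1 ^+ (m i1) * @gfun R 2 ^+ (m i2)) *: 'X^(dg m).
  rewrite /mpoly.mmap1 !big_ord_recl big_ord0 mulr1.
  have -> : lift ord0 (ord0 : 'I_2) = i1 by apply: val_inj.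
  have -> : lift ord0 (lift ord0 (ord0 : 'I_1)) = i2 by apply: val_inj.
  rewrite /gener !exprZn -!exprM -!scalerAl -!scalerAr !scalerA -!exprD.
  by rewrite /dg /wt !mulrA /= mul1n.
rewrite /cst_poly coefCM coefZ coefXn eq_sym.
case: eqP => _; last by rewrite !mulr0.
rewrite mulr1.
transitivity (mpoly.mcoeff m P * ((@gfun R 0 ^+ m ord0) p * (@gfun R 1 ^+ m i1) p *
  (@gfun R 2 ^+ m i2) p)); first by [].
by rewrite !fctX.
Qed.

(** The component of degree k is a combination of the products A^j B^(k-j) for
    every tau, so each coefficient vanishes. The coefficient of A^j is an
    isobaric polynomial of weight 2j in E4 and E6, where a monomial is determined
    by its exponent of E6. *)
Lemma mmap_gener_eq0 (P : mpoly.mpoly 3 C) :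
  mpoly.mmap (@cst_poly R) (@gener R) P = 0 -> P = 0.
Proof.
move=> P0; apply/eqP; rewrite -mpoly.msupp_eq0 -size_eq0 -leqn0 leqNgt -has_predT.
apply/hasP => -[m0 m0P _].
pose k := dg m0; pose j := wt m0; have jk : (j <= k)%N by rewrite leq_addl.
pose c m : bool := (dg m == k) && (inord (wt m) == inord j :> 'I_k.+1).
have cwt m : c m -> wt m = j.
  case/andP=> /eqP dm /eqP/(congr1 val); rewrite /= !inordK //; last first.
    by rewrite ltnS -dm leq_addl.
have zero (q : C) : nrm q < 1 -> q != 0 ->
    \sum_(m <- mpoly.msupp P | c m) mpoly.mcoeff m P * (E4 q ^+ m i1 * E6 q ^+ m i2) = 0.
  move=> q1 q0; have [tau tauE] := e2pi_upper_surj q0 q1.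
  (* The coefficient of A^i B^(k-i). *)
  pose v (i : 'I_k.+1) := \sum_(m <- mpoly.msupp P | (dg m == k) && (inord (wt m) == i))
    mpoly.mcoeff m P * (E4 q ^+ m i1 * E6 q ^+ m i2).
  apply: (@comb_eq0 R k (An q) (Gq (@Bf R) q) (AB_ratio q1) v _ (inord j)) => y y0.
  have [z zE] := e2pi_surj y0.
  have := coef_gener P k (z, tau); rewrite P0 coef0 => H.
  apply: etrans (esym H); rewrite (partition_big (fun m => inord (wt m) : 'I_k.+1) xpredT) //=.
  apply: eq_bigr => i _; rewrite /v mulr_suml; apply: eq_bigr => m /andP[/eqP dm /eqP wm].
  have g0 : @gfun R 0 (z, tau) = Gq (@Bf R) q y by rewrite /gfun /jac /= tauE zE.
  have g1 : @gfun R 1 (z, tau) = E4 q * An q y ^+ 2.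
    by rewrite -tauE -zE /gfun [nth _ _ _](Gq_mfun (sympoly_C2 R) (@translation_C2 R)).
  have g2 : @gfun R 2 (z, tau) = E6 q * An q y ^+ 3.
    by rewrite -tauE -zE /gfun [nth _ _ _](Gq_mfun (sympoly_C3 R) (@translation_C3 R)).
  have iE : (i : nat) = wt m by rewrite -wm inordK // ltnS -dm leq_addl.
  have ki : (k - i = m ord0)%N by rewrite iE -dm /dg addnK.
  rewrite g0 g1 g2 ki iE /wt; move: (E4 q) (E6 q) (An q y) (Gq _ q y) => x u A B.
  by rewrite exprD !exprM !exprMn; ring.
have := isobaric cwt zero => /(congr1 (fun p : {poly C} => p`_(m0 i2))).
rewrite coef0 coef_sum big_mkcond (bigD1_seq m0) ?mpoly.msupp_uniq //=.
rewrite [c m0]/c !eqxx /= coefZ coefXn eqxx mulr1 big1 ?addr0 => [/eqP|m mm].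
  by rewrite -[_ == 0]negbK -mpoly.mcoeff_msupp m0P.
case: ifP => // cm; rewrite coefZ coefXn; case: eqP => [e2|_]; last by rewrite mulr0.
case/eqP: mm; apply/mpoly.mnmP.
have ew := cwt m cm; have ed : dg m = dg m0 by case/andP: cm => /eqP.
have e0 : m ord0 = m0 ord0 by move: ed; rewrite /dg ew => /addIn.
have e1 : m i1 = m0 i1 by move: ew; rewrite /j /wt; lia.
case=> -[|[|[|//]]] h.
- by rewrite (_ : Ordinal h = ord0) //; apply: val_inj.
- by rewrite (_ : Ordinal h = i1) //; apply: val_inj.
- by rewrite (_ : Ordinal h = i2) //; apply: val_inj.
Qed.

End Independence.

Theorem proposition4p1 (R : realType) :
  exists x : 'I_3 -> {poly (jacobi_fun R)},
    (forall i : 'I_3, weak_jacobi_homogeneous i.+1 (x i)) /\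
    freely_generated x (@weak_jacobi_ring R).
Proof.
exists (@gener R); split=> [i|].
  by exists (gfun i); first exact: gfun_jacobi.
split.
- move=> P _; apply: ring_jacobi_mmap => i; apply: ring_jacobi_hom.
  exact: gfun_jacobi.
- move=> P Q _ _ PQ; apply: subr0_eq; apply: mmap_gener_eq0.
  by rewrite mpoly.mmapB PQ subrr.
- move=> p hp; have [P hP] : exists P, mpoly.mmap (@cst_poly R) (@gener R) P = p.
    rewrite -[p]coefK poly_def; elim/big_ind: _ => [|a b [Pa <-] [Pb <-]|i _].
    - by exists 0; rewrite mpoly.mmap0.
    - by exists (Pa + Pb); rewrite mpoly.mmapD.
    - exact: gen_form (hp i).
  by exists P.
Qed.
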